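(* Let $G$ be a locally compact group and let $A$ be a $G$-injective $G$-$C^*$-algebra. Then $A\rtimes_{\mathrm{inj}}G=A\rtimes_{\max}G$, i.e. $\|\cdot\|_{\mathrm{inj}}=\|\cdot\|_{\max}$ on $C_c(G,A)$.
   Context: A $G$-$C^*$-algebra is a $C^*$-algebra $A$ with a strongly continuous action of $G$ by automorphisms. $C_c(G,A)$ carries its usual convolution $*$-algebra structure; $A\rtimes_{\max}G$ is its maximal $C^*$-completion. For an equivariant $*$-homomorphism $\phi:A\to B$, $\phi\rtimes G$ denotes the map $C_c(G,A)\to C_c(G,B)$, $f\mapsto\phi\circ f$, and its extension to completions. ''ccp'' means contractive completely positive. An equivariant ccp map $\phi:A\to B$ between $G$-$C^*$-algebras is $G$-injective if for every $G$-$C^*$-algebra $C$ and every equivariant injective $*$-homomorphism $\iota:A\to C$ there is an equivariant ccp map $\widetilde\phi:C\to B$ with $\widetilde\phi\circ\iota=\phi$. A $G$-$C^*$-algebra $B$ is $G$-injective if every equivariant ccp map $A\to B$ from any $G$-$C^*$-algebra $A$ is $G$-injective. For an equivariant injective $*$-homomorphism $\iota:A\to B$ of $G$-$C^*$-algebras, put $\|a\|_\iota:=\|(\iota\rtimes G)(a)\|_{B\rtimes_{\max}G}$ for $a\in C_c(G,A)$. The injective norm on $C_c(G,A)$ is $\|a\|_{\mathrm{inj}}:=\inf\{\|a\|_\iota : \iota:A\to B\text{ an equivariant injective }*\text{-homomorphism}\}$, and $A\rtimes_{\mathrm{inj}}G$ is the corresponding completion of $C_c(G,A)$. *)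

(* Defs.v *)
From HB Require Import structures.
From mathcomp Require Import all_boot all_order all_algebra.
From mathcomp Require Import complex.
From mathcomp Require Import all_classical all_reals all_analysis.

Set Implicit Arguments.
Unset Strict Implicit.
Unset Printing Implicit Defensive.

Import Order.TTheory GRing.Theory Num.Theory.
Import numFieldNormedType.Exports.

Local Open Scope classical_set_scope.
Local Open Scope ring_scope.
Local Open Scope complex_scope.

HB.mixin Record isTopologicalGroup G of Group G & Topological G := {
  mulg_continuous : continuous (fun xy : G * G => (xy.1 * xy.2)%g);
  invg_continuous : continuous (fun x : G => (x^-1)%g)
}.

#[short(type="topGroupType")]
HB.structure Definition TopologicalGroup :=
  {G of Group G & Topological G & isTopologicalGroup G}.

(* A copy of [G] pointed at 1: the library's generated sigma-algebras live on
   pointed types. *)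
Definition pointed_copy (G : topGroupType) : Type := G.
HB.instance Definition _ (G : topGroupType) := Choice.on (pointed_copy G).
HB.instance Definition _ (G : topGroupType) :=
  isPointed.Build (pointed_copy G) (1%g : G).

Notation borel G := (g_sigma_algebraType (@open G : set (set (pointed_copy G)))).

(* Norms of complex normed spaces are valued in R[i]; this is the same norm
   seen in R. *)
Definition rnorm (R : realType) (V : normedModType R[i]) (x : V) : R :=
  complex.Re `|x|.

(* Possibly non-unital: the multiplication is a field of the mixin since the
   ring hierarchy of the library is unital. *)
HB.mixin Record isCStarAlgebra (R : realType) A
    of CompleteNormedModule R[i] A := {
  cmul : A -> A -> A;
  cstar : A -> A;
  cmulA : associative cmul;
  cmulDl : left_distributive cmul +%R;
  cmulDr : right_distributive cmul +%R;
  cmulZl : forall (c : R[i]) x y, cmul (c *: x) y = c *: cmul x y;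
  cmulZr : forall (c : R[i]) x y, cmul x (c *: y) = c *: cmul x y;
  cstarK : involutive cstar;
  cstarD : {morph cstar : x y / x + y};
  cstarZ : forall (c : R[i]) x, cstar (c *: x) = Num.conj c *: cstar x;
  cstarM : forall x y, cstar (cmul x y) = cmul (cstar y) (cstar x);
  norm_cmul : forall x y, `|cmul x y| <= `|x| * `|y|;
  norm_cstar : forall x, `|cmul (cstar x) x| = `|x| ^+ 2
}.

#[short(type="cstarAlgType")]
HB.structure Definition CStarAlgebra (R : realType) :=
  {A of CompleteNormedModule R[i] A & isCStarAlgebra R A}.

(* Each [gact s] is automatically bijective, with inverse [gact s^-1]. *)
HB.mixin Record isGCStarAlgebra (R : realType) (G : topGroupType) A
    of CStarAlgebra R A := {
  gact : G -> A -> A;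
  gact1 : forall a, gact 1%g a = a;
  gactM : forall s t a, gact (s * t)%g a = gact s (gact t a);
  gactD : forall s, {morph gact s : a b / a + b};
  gactZ : forall s (c : R[i]) a, gact s (c *: a) = c *: gact s a;
  gact_cmul : forall s a b, gact s (cmul a b) = cmul (gact s a) (gact s b);
  gact_cstar : forall s a, gact s (cstar a) = cstar (gact s a);
  gact_continuous : forall a, continuous (fun s : G => gact s a)
}.

#[short(type="gcstarAlgType")]
HB.structure Definition GCStarAlgebra (R : realType) (G : topGroupType) :=
  {A of CStarAlgebra R A & isGCStarAlgebra R G A}.

Section Maps.
Variables (R : realType) (G : topGroupType).

Definition star_hom (A B : cstarAlgType R) (phi : {linear A -> B}) : Prop :=
  (forall x y, phi (cmul x y) = cmul (phi x) (phi y)) /\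
  (forall x, phi (cstar x) = cstar (phi x)).

(* [a] is positive in the C*-algebra M_n(A), i.e. a = x^* x for some x. *)
Definition mx_positive (A : cstarAlgType R) n (a : 'M[A]_n) : Prop :=
  exists x : 'M[A]_n,
    forall i j, a i j = \sum_k cmul (cstar (x k i)) (x k j).

Definition completely_positive (A B : cstarAlgType R)
    (phi : {linear A -> B}) : Prop :=
  forall n (a : 'M[A]_n), mx_positive a -> mx_positive (map_mx phi a).

Definition ccp (A B : cstarAlgType R) (phi : {linear A -> B}) : Prop :=
  completely_positive phi /\ forall x, `|phi x| <= `|x|.

Definition equivariant (A B : gcstarAlgType R G) (phi : A -> B) : Prop :=
  forall s a, phi (gact s a) = gact s (phi a).

Definition equivariant_embedding (A B : gcstarAlgType R G)
    (iota : {linear A -> B}) : Prop :=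
  [/\ star_hom iota, equivariant iota & injective iota].

Definition G_injective_map (A B : gcstarAlgType R G)
    (phi : {linear A -> B}) : Prop :=
  forall (C : gcstarAlgType R G) (iota : {linear A -> C}),
    equivariant_embedding iota ->
    exists psi : {linear C -> B},
      [/\ ccp psi, equivariant psi & forall a, psi (iota a) = phi a].

Definition G_injective (B : gcstarAlgType R G) : Prop :=
  forall (A : gcstarAlgType R G) (phi : {linear A -> B}),
    ccp phi -> equivariant phi -> G_injective_map phi.

End Maps.

(* {dot _ for Num.conj}: positive definite hermitian forms, linear in the
   first variable. *)
Record hilbertType (R : realType) := Hilbert {
  hilbert_car :> completeNormedModType R[i];
  inner : {dot hilbert_car for Num.conj};
  inner_norm : forall x : hilbert_car, inner x x = `|x| ^+ 2
}.

Section Haar.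
Variables (R : realType) (G : topGroupType).
Variable mu : {measure set (borel G) -> \bar R}.

Definition left_haar_measure : Prop :=
  [/\ forall (s : G) (E : set (borel G)), measurable E ->
        mu [set (s * x)%g | x in E] = mu E,
      forall K : set G, compact K -> (mu K < +oo)%E,
      forall E : set (borel G), measurable E ->
        mu E = ereal_inf [set mu U | U in [set U : set G | open U /\ E `<=` U]],
      forall U : set G, open U ->
        mu U = ereal_sup [set mu K | K in [set K : set G | compact K /\ K `<=` U]]
    & mu [set: G] <> 0%E].

Definition Cc (K : numFieldType) (V : normedModType K) (f : G -> V) : Prop :=
  continuous f /\ compact (closure [set s | f s != 0]).

(* Normalisation: Delta(t) * \int h(s t) ds = \int h(s) ds, equivalently
   mu(E t) = Delta(t) mu(E). *)
Definition modular (t : G) : R :=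
  xget 1 [set c : R | 0 < c /\ forall h : G -> R^o, Cc h ->
    c * (\int[mu]_s h (s * t)%g)%R = (\int[mu]_s h s)%R].

(* Bochner integral: limit of integrals of simple functions converging to f
   in L^1-norm. *)
Definition is_bochner_integral (V : completeNormedModType R[i])
    (f : G -> V) (x : V) : Prop :=
  forall e : R, 0 < e ->
    exists n (E : 'I_n -> set (borel G)) (v : 'I_n -> V),
    [/\ forall i, measurable (E i) /\ (mu (E i) < +oo)%E,
        (\int[mu]_s (rnorm (f s - \sum_i (\1_(E i) s)%:C *: v i))%:E < e%:E)%E
      & rnorm (x - \sum_i (fine (mu (E i)))%:C *: v i) < e].

Definition bochner_integral (V : completeNormedModType R[i])
    (f : G -> V) : V :=
  xget 0 [set x | is_bochner_integral f x].

Definition L1norm (A : cstarAlgType R) (f : G -> A) : R :=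
  (\int[mu]_s rnorm (f s))%R.

Variable A : gcstarAlgType R G.

Definition convolution (f g : G -> A) : G -> A := fun s =>
  bochner_integral (fun t => cmul (f t) (gact t (g (t^-1 * s)%g))).

Definition involution (f : G -> A) : G -> A := fun s =>
  (modular s^-1%g)%:C *: gact s (cstar (f s^-1%g)).

(* *-representations of C_c(G,A) on H by bounded operators, contractive for the
   L^1-norm. Only the values of rho on C_c(G,A) are relevant. *)
Definition star_representation (H : hilbertType R)
    (rho : (G -> A) -> H -> H) : Prop :=
  [/\ forall f, Cc f -> linear (rho f) /\
        forall x, `|rho f x| <= (L1norm f)%:C * `|x|,
      forall (c : R[i]) f g, Cc f -> Cc g ->
        forall x, rho (c *: f + g) x = c *: rho f x + rho g x,
      forall f g, Cc f -> Cc g ->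
        forall x, rho (convolution f g) x = rho f (rho g x)
    & forall f, Cc f ->
        forall x y, inner H (rho f x) y = inner H x (rho (involution f) y)].

Definition operator_norm (H : hilbertType R) (T : H -> H) : R :=
  sup [set rnorm (T x) | x in [set x : H | `|x| <= 1]].

(* The universal C*-norm of the *-algebra C_c(G,A). The set is nonempty (H = 0)
   and bounded by the L^1-norm of f. *)
Definition max_norm (f : G -> A) : R :=
  sup [set r : R | exists (H : hilbertType R) (rho : (G -> A) -> H -> H),
    star_representation rho /\ r = operator_norm (rho f)].

End Haar.

(* The set is nonempty (iota = id) and bounded below by 0. *)
Definition inj_norm (R : realType) (G : topGroupType)
    (mu : {measure set (borel G) -> \bar R}) (A : gcstarAlgType R G)
    (f : G -> A) : R :=
  inf [set r : R | exists (B : gcstarAlgType R G) (iota : {linear A -> B}),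
    equivariant_embedding iota /\ r = max_norm mu (iota \o f)].

(* Main.v *)
Require Import Defs.
From HB Require Import structures.
From mathcomp Require Import all_boot all_order all_algebra.
From mathcomp Require Import complex.
From mathcomp Require Import all_classical all_reals all_analysis.
From mathcomp Require Import measurable_realfun ring lra.

(** Taking the identity of [A] as embedding shows that the injective norm is at
    most the maximal one. For the converse, let [iota : A -> B] be an equivariant
    embedding. Injectivity, applied to the identity of [A], extends it along
    [iota] to an equivariant ccp map [psi : B -> A] with [psi (iota a) = a], and
    it has to be shown that [rho f] is bounded by the maximal norm of [iota \o f]
    for every representation [rho] of C_c(G,A) ([max_norm_le_embedding]).

    The idea is to dilate [rho] along [psi]. For a vector [z = rho f y] of the
    space [H] of [rho], complete positivity of [psi] makes
    [< psi (b'^* b) u_t z, u_t' z >] a positive kernel on [B * G]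
    ([stinespring]), hence the Gram matrix of vectors [j (b, t)] spanning a
    dense subspace of a Hilbert space [K] ([kolmogorov]). On [K], the algebra
    [B] acts by left multiplication ([lop_le] bounds it) and [G] by translation,
    which is isometric because [psi] is equivariant; this covariant pair
    integrates to a representation of C_c(G,B) ([covariant_rep_star]).
    Since [psi (iota a) = a], the vectors [j (iota a, t)] have the same inner
    products as the vectors [a u_t z] of [H]. This isometry intertwines the
    operator of [iota \o f] on [K] with [rho f] on the vectors
    [rho g z], which are integrals of vectors [a u_t z]. So on them, and in
    particular on [rho f^* rho f y], the operator [rho f] is bounded by the
    maximal norm of [iota \o f]; adjointness turns this into a bound for
    [rho f y] ([rho_le_max_norm_embedding]).

    The vectors in question are Bochner integrals of continuous functions with
    compact support. They are handled as limits of Riemann sums over partitions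
    into pieces contained in prescribed neighbourhoods of their tags
    ([riem_cvg]). Uniform estimates for such sums give the exchange of the
    integral with maps bounded for the L1-norm ([L1_bounded_bochner]), of which
    Fubini's theorem is a case, and invariance of the measure gives left
    invariance of the integral. These two facts yield the modular function and
    the inversion formula ([bochner_scale_rtranslate], [modular_facts]), needed
    to see that translations are isometric in [rho] and that [covariant_rep] is
    compatible with the involution. *)

Set Implicit Arguments.
Unset Strict Implicit.
Unset Printing Implicit Defensive.

Import Order.TTheory GRing.Theory Num.Theory.
Import numFieldNormedType.Exports.

Local Open Scope classical_set_scope.
Local Open Scope ring_scope.
Local Open Scope complex_scope.

(** * The real-valued norm and the complex scalars *)

(** The scalars as a normed space over themselves; once shown complete, they
    are a possible target of the Bochner integral. *)
Definition Cplx (R : realType) : Type := R[i]^o.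
HB.instance Definition _ (R : realType) := NormedModule.copy (Cplx R) R[i]^o.

Section RealNorm.
Variable R : realType.
Implicit Types (V : normedModType R[i]) (r : R).

Lemma ge0_complexE (z : R[i]) : 0 <= z -> z = (complex.Re z)%:C.
Proof. by case: z => a b; rewrite lecE /= => /andP[/eqP h _]; rewrite h. Qed.

Lemma normE V (x : V) : `|x| = (rnorm x)%:C.
Proof. exact/ge0_complexE/normr_ge0. Qed.

Lemma ler_rnorm V (W : normedModType R[i]) (x : V) (y : W) :
  (rnorm x <= rnorm y) = (`|x| <= `|y|).
Proof. by rewrite (normE x) (normE y) lecR. Qed.

Lemma rnorm_ge0 V (x : V) : 0 <= rnorm x.
Proof. by have := normr_ge0 x; rewrite normE -[0]/(0%:C) lecR. Qed.

Lemma rnorm0 V : rnorm (0 : V) = 0.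
Proof. by rewrite /rnorm normr0. Qed.

Lemma rnorm_eq0 V (x : V) : rnorm x = 0 -> x = 0.
Proof. by move=> h; apply/eqP; rewrite -normr_eq0 normE h. Qed.

Lemma rnormN V (x : V) : rnorm (- x) = rnorm x.
Proof. by rewrite /rnorm normrN. Qed.

Lemma rnormBC V (x y : V) : rnorm (x - y) = rnorm (y - x).
Proof. by rewrite -rnormN opprB. Qed.

Lemma rnormD V (x y : V) : rnorm (x + y) <= rnorm x + rnorm y.
Proof. by rewrite -lecR rmorphD /= -!normE ler_normD. Qed.

Lemma rnormB V (x y : V) : rnorm (x - y) <= rnorm x + rnorm y.
Proof. by rewrite (le_trans (rnormD _ _))// rnormN. Qed.

Lemma rnorm_dist V (x y z : V) : rnorm (x - z) <= rnorm (x - y) + rnorm (y - z).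
Proof. by have := rnormD (x - y) (y - z); rewrite addrA subrK. Qed.

Lemma rnorm_distl V (x y : V) : `|rnorm x - rnorm y| <= rnorm (x - y).
Proof.
have := rnormD (x - y) y; have := rnormD (y - x) x.
rewrite !subrK (rnormBC y x) ler_norml => h1 h2.
by apply/andP; split; lra.
Qed.

Lemma rnormZ V (c : R[i]) (x : V) :
  rnorm (c *: x) = rnorm (c : (Cplx R)) * rnorm x.
Proof.
apply: (@complexI R); rewrite rmorphM /= -!normE; exact: normrZ.
Qed.

Lemma rnormC r : rnorm (r%:C : (Cplx R)) = `|r|.
Proof. by rewrite /rnorm normc_def /= expr0n addr0 sqrtr_sqr. Qed.

Lemma rnormCB r t : rnorm (r%:C - t%:C : Cplx R) = `|r - t|.
Proof. by rewrite -rnormC rmorphB. Qed.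

Lemma rnormZR V r (x : V) : rnorm (r%:C *: x) = `|r| * rnorm x.
Proof. by rewrite rnormZ rnormC. Qed.

Lemma rnorm_le_eps V (x : V) : (forall e : R, 0 < e -> rnorm x <= e) -> x = 0.
Proof.
move=> h; apply: rnorm_eq0; apply/eqP; rewrite eq_le rnorm_ge0 andbT.
by apply/ler_addgt0Pr => e e0; rewrite add0r h.
Qed.

Lemma posC (e : R[i]) : 0 < e -> e = (complex.Re e)%:C /\ 0 < complex.Re e.
Proof. by case: e => a b; rewrite ltcE /= => /andP[/eqP -> ->]. Qed.

(** Positive elements of [R[i]] are real, so convergence can be tested with
    the real-valued norm. *)
Lemma rcvgP V (T : Type) (F : set_system T) (FF : Filter F) (f : T -> V) (l : V) :
  f @ F --> l <->
  (forall e : R, 0 < e -> \forall x \near F, rnorm (l - f x) < e).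
Proof.
split=> [/cvgrPdist_lt h e e0|h].
  have := h e%:C; rewrite ltcR => /(_ e0); apply: filterS => x.
  by rewrite normE ltcR.
apply/cvgrPdist_lt => e /posC[-> /h]; apply: filterS => x.
by rewrite normE ltcR.
Qed.

Lemma rcontP V (T : topologicalType) (f : T -> V) (x : T) :
  {for x, continuous f} <->
  (forall e : R, 0 < e -> \forall y \near x, rnorm (f x - f y) < e).
Proof. exact: rcvgP. Qed.

Lemma near_rnorm V (x : V) (e : R) :
  0 < e -> \forall y \near x, rnorm (x - y) < e.
Proof.
have h : (fun y => y) @ x --> x by exact: cvg_id.
by have /rcvgP := h; apply.
Qed.

Lemma cvgZC V (T : Type) (F : set_system T) {FF : Filter F} (a : T -> Cplx R)
    (f : T -> V) (x : Cplx R) (y : V) : a @ F --> x -> f @ F --> y ->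
  (fun t => (a t : R[i]) *: f t) @ F --> (x : R[i]) *: y.
Proof. by move=> ax fy; exact: (@cvgZ R[i] V T F FF a f x y ax fy). Qed.

Lemma rnorm_cvg V (T : Type) (F : set_system T) {FF : Filter F} (f : T -> V) l :
  f @ F --> l -> (fun x => rnorm (f x) : R^o) @ F --> (rnorm l : R^o).
Proof.
move=> h; apply/(@cvgrPdist_lt _ R^o) => e e0.
have /rcvgP/(_ _ e0) := h.
by apply: filterS => y; apply: le_lt_trans; exact: rnorm_distl.
Qed.

Lemma rcauchy_cvg (V : completeNormedModType R[i]) (F : set_system V)
    (FF : ProperFilter F) :
  (forall e : R, 0 < e -> exists x, F [set y | rnorm (x - y) < e]) -> cvg F.
Proof.
move=> h; apply: cauchy_cvg; apply: cauchy_exP => e /posC[-> /h][x Fx].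
exists x; apply: filterS Fx => y /=.
by rewrite -ball_normE /ball_ /= normE ltcR.
Qed.

(** Extension by continuity at a single point, for data indexed by formal
    combinations instead of a map defined on a subspace. *)
Lemma lipschitz_limit V (W : completeNormedModType R[i]) (T : Type) (u : T -> V)
    (w : T -> W) (M : R) (p : V) : 0 <= M ->
  (forall l m, rnorm (w l - w m) <= M * rnorm (u l - u m)) ->
  (forall e : R, 0 < e -> exists l, rnorm (p - u l) <= e) ->
  exists q, forall l, rnorm (q - w l) <= M * rnorm (p - u l).
Proof.
move=> M0 lip dense.
pose F : set_system T :=
  [set B | exists2 e : R, 0 < e & forall l, rnorm (p - u l) <= e -> B l].
have FF : ProperFilter F.
  split; first by move=> [e e0 h]; have [l /h] := dense e e0.
  split=> [|B B' [d d0 hB] [e e0 hB']|B B' BB' [e e0 h]].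
  - by exists 1.
  - exists (Num.min d e) => [|l hl]; first by rewrite lt_min d0.
    by split; [apply: hB|apply: hB']; rewrite (le_trans hl)// ge_min lexx ?orbT.
  - by exists e => // l /h/BB'.
have near_lip (l : T) (d : R) : 0 < d ->
    F [set m | rnorm (w l - w m) <= M * (rnorm (p - u l) + d)].
  move=> d0; exists d => // m hm /=; apply: (le_trans (lip l m)).
  by rewrite ler_wpM2l// (le_trans (rnorm_dist _ p _))// (rnormBC (u l)) lerD2l.
have small (e : R) : 0 < e -> exists2 d : R, 0 < d & M * d < e.
  move=> e0; exists (e / (M + 1)); first by rewrite divr_gt0//; lra.
  by rewrite mulrA ltr_pdivrMr; [rewrite mulrC ltr_pM2l//; lra|lra].
have cv : cvg (w @ F).
  apply: rcauchy_cvg => e e0; have [d d0 hd] := small e e0.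
  have d2 : 0 < d / 2 by lra.
  have [l hl] := dense _ d2; exists (w l).
  apply: filterS (near_lip l _ d2) => m /= /le_lt_trans; apply.
  by apply: le_lt_trans hd; rewrite ler_wpM2l//; lra.
exists (lim (w @ F)) => l; apply/ler_addgt0Pr => e e0.
have e2 : 0 < e / 2 by lra.
have [d d0 hd] := small _ e2.
have /rcvgP/(_ _ e2) h := cv.
have [m [h1 h2]] := filter_ex (filterI h (near_lip l d d0)).
rewrite (le_trans (rnorm_dist _ (w m) _))// (rnormBC (w m)).
by rewrite /= mulrDr in h2; move: h1 => /=; lra.
Qed.

(** The product of an algebra and the inner product, which is not bilinear
    over the complex scalars, are both of this kind. *)
Lemma cvg_bilinear V (W U : normedModType R[i]) (b : V -> W -> U)
    (T : Type) (F : set_system T) {FF : Filter F} (f : T -> V) (g : T -> W) x y :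
  (forall x x' y, b (x - x') y = b x y - b x' y) ->
  (forall x y y', b x (y - y') = b x y - b x y') ->
  (forall x y, rnorm (b x y) <= rnorm x * rnorm y) ->
  f @ F --> x -> g @ F --> y -> (fun t => b (f t) (g t)) @ F --> b x y.
Proof.
move=> bBl bBr b_le /rcvgP fx /rcvgP gy; apply/rcvgP => e e0.
pose M := rnorm x + rnorm y + 1.
have x0 := rnorm_ge0 x; have y0 := rnorm_ge0 y.
have M0 : 0 < M by rewrite /M; lra.
have eM : 0 < e / (2 * M) by rewrite divr_gt0// mulr_gt0.
near=> t.
have -> : b x y - b (f t) (g t) = b (x - f t) y + b (f t) (y - g t).
  by rewrite bBl bBr addrA subrK.
apply: (le_lt_trans (rnormD _ _)).
have h1 : rnorm (x - f t) < e / (2 * M) by near: t; exact: fx.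
have h2 : rnorm (y - g t) < e / (2 * M) by near: t; exact: gy.
have h3 : rnorm (x - f t) < 1 by near: t; exact: fx.
have h4 : rnorm (f t) < M.
  have := rnormB x (x - f t); rewrite opprB addrC subrK /M; lra.
have h5 : rnorm (b (x - f t) y) <= e / (2 * M) * M.
  apply: (le_trans (b_le _ _)).
  by apply: ler_pM; rewrite ?rnorm_ge0// ?ltW// /M; lra.
have h6 : rnorm (b (f t) (y - g t)) <= rnorm (f t) * (e / (2 * M)).
  apply: (le_trans (b_le _ _)).
  by apply: ler_pM; rewrite ?rnorm_ge0// ltW.
have h7 : rnorm (f t) * (e / (2 * M)) < M * (e / (2 * M)) by rewrite ltr_pM2r.
have h8 : e = e / (2 * M) * M + M * (e / (2 * M)) by field; lra.
lra.
Unshelve. all: by end_near. Qed.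

End RealNorm.

Section ComplexComplete.
Variable R : realType.

Lemma normC_le (z : (Cplx R)) : rnorm z <= `|complex.Re z| + `|complex.Im z|.
Proof.
have E : z = ((complex.Re z)%:C : (Cplx R)) + 'i%C *: ((complex.Im z)%:C : (Cplx R)).
  by rewrite {1}(complexE z).
rewrite {1}E (le_trans (rnormD _ _))// rnormZ !rnormC.
have -> : rnorm ('i%C : (Cplx R)) = 1.
  by rewrite /rnorm normc_def /= expr0n expr1n add0r sqrtr1.
by rewrite mul1r.
Qed.

(** Taking real and imaginary parts reduces completeness to that of [R]. *)
Lemma complex_complete (F : set_system (Cplx R)) :
  ProperFilter F -> cauchy F -> cvg F.
Proof.
move=> FF /cauchyP cF.
have part (p : R[i] -> R) : (forall x y, `|p x - p y| <= rnorm (x - y : (Cplx R))) ->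
    exists l : R^o, (fun z => p z : R^o) @ F --> l.
  move=> hp; exists (lim ((fun z => p z : R^o) @ F)).
  apply: (@cauchy_cvg R^o); apply/cauchyP => e e0.
  have [x Fx] := cF e%:C ltac:(by rewrite ltcR).
  exists (p x); apply: (@filterS _ F _ (ball x e%:C)) Fx => y.
  rewrite -!ball_normE /ball_ /= normE ltcR; exact: le_lt_trans.
have [|a ha] := part (@complex.Re R).
  move=> x y; rewrite -raddfB -lecR -normE; exact: normc_ge_Re.
have [|b hb] := part (@complex.Im R).
  move=> x y; rewrite -raddfB /= /rnorm normc_def /= -sqrtr_sqr ler_wsqrtr//.
  by rewrite lerDr sqr_ge0.
apply/cvg_ex; exists ((a +i* b)%C : (Cplx R)).
have : (fun z : (Cplx R) => z) @ F --> ((a +i* b)%C : (Cplx R)); last by [].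
apply/rcvgP => e e0; have e2 : 0 < e / 2 by lra.
have := @cvgrPdist_lt _ R^o _ _ _ _ _; move=> H.
have := (H _ F FF (fun z => complex.Re z : R^o) a).1 ha _ e2.
have := (H _ F FF (fun z => complex.Im z : R^o) b).1 hb _ e2.
apply: filterS2 => -[x y] /= h1 h2; apply: (le_lt_trans (normC_le _)) => /=.
lra.
Qed.

HB.instance Definition _ := Uniform_isComplete.Build (Cplx R) complex_complete.
End ComplexComplete.

(** * Contractivity of star-homomorphisms *)

Section CStar.
Variable R : realType.
Implicit Types A B : cstarAlgType R.

Lemma rcvg_unique (V : normedModType R[i]) (T : Type) (F : set_system T)
    {FF : ProperFilter F} (f : T -> V) (l l' : V) :
  f @ F --> l -> f @ F --> l' -> l = l'.
Proof. by apply: cvg_unique; exact: norm_hausdorff. Qed.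

Lemma cmul0r A (x : A) : cmul 0 x = 0.
Proof. by apply: (addrI (cmul 0 x)); rewrite -cmulDl !addr0. Qed.

Lemma cmulr0 A (x : A) : cmul x 0 = 0.
Proof. by apply: (addrI (cmul x 0)); rewrite -cmulDr !addr0. Qed.

Lemma cmulNl A (x y : A) : cmul (- x) y = - cmul x y.
Proof. by rewrite -scaleN1r cmulZl scaleN1r. Qed.

Lemma cmulNr A (x y : A) : cmul x (- y) = - cmul x y.
Proof. by rewrite -scaleN1r cmulZr scaleN1r. Qed.

Lemma cmulBl A (x y z : A) : cmul (x - y) z = cmul x z - cmul y z.
Proof. by rewrite cmulDl cmulNl. Qed.

Lemma cmulBr A (x y z : A) : cmul x (y - z) = cmul x y - cmul x z.
Proof. by rewrite cmulDr cmulNr. Qed.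

Lemma cstar0 A : cstar (0 : A) = 0.
Proof. by apply: (addrI (cstar 0)); rewrite -cstarD !addr0. Qed.

Lemma conj_real (r : R) : Num.conj (r%:C) = r%:C.
Proof. by apply/CrealP; rewrite complex_real. Qed.

Lemma cstarZR A (r : R) (x : A) : cstar (r%:C *: x) = r%:C *: cstar x.
Proof. by rewrite cstarZ conj_real. Qed.

Lemma cstarN A (x : A) : cstar (- x) = - cstar x.
Proof. by apply: (addrI (cstar x)); rewrite -cstarD !subrr cstar0. Qed.

Lemma cstarB A (x y : A) : cstar (x - y) = cstar x - cstar y.
Proof. by rewrite cstarD cstarN. Qed.

Lemma rnorm_cmul A (x y : A) : rnorm (cmul x y) <= rnorm x * rnorm y.
Proof. by rewrite -lecR rmorphM /= -!normE norm_cmul. Qed.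

Lemma rnorm_cstar2 A (x : A) : rnorm (cmul (cstar x) x) = rnorm x ^+ 2.
Proof. by apply: (@complexI R); rewrite rmorphXn /= -!normE norm_cstar. Qed.

Lemma rnorm_cstar A (x : A) : rnorm (cstar x) = rnorm x.
Proof.
have h (y : A) : rnorm y <= rnorm (cstar y).
  have [y0|y0] := eqVneq (rnorm y) 0; first by rewrite y0 rnorm_ge0.
  have yp : 0 < rnorm y by rewrite lt_neqAle eq_sym y0 rnorm_ge0.
  rewrite -(ler_pM2r yp) -expr2 -rnorm_cstar2; exact: rnorm_cmul.
by apply/eqP; rewrite eq_le h -{2}(cstarK x) h.
Qed.

Lemma rnorm_selfadj2 A (h : A) : cstar h = h ->
  rnorm (cmul h h) = rnorm h ^+ 2.
Proof. by move=> hh; rewrite -rnorm_cstar2 hh. Qed.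

Lemma cvg_cmul A (T : Type) (F : set_system T) {FF : Filter F} (f g : T -> A)
    (a b : A) :
  f @ F --> a -> g @ F --> b -> (fun t => cmul (f t) (g t)) @ F --> cmul a b.
Proof.
by apply: cvg_bilinear; [exact: cmulBl|exact: cmulBr|exact: rnorm_cmul].
Qed.

Lemma cvg_cstar A (T : Type) (F : set_system T) {FF : Filter F} (f : T -> A)
    (a : A) :
  f @ F --> a -> (fun t => cstar (f t)) @ F --> cstar a.
Proof.
move=> /rcvgP fa; apply/rcvgP => e /fa; apply: filterS => t.
by rewrite -cstarB rnorm_cstar.
Qed.

(** [g] plays the role of [1 - sqrt (1 - h)] in an algebra without unit. It is
    the limit of the iteration [g |-> (h + g^2) / 2] started at 0: the
    iterates stay in the ball of radius [a = rnorm h], on which a step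
    contracts distances by the factor [a]. What commutes with [h] commutes
    with all iterates. *)
Lemma sqrt_one_minus A (h : A) : cstar h = h -> rnorm h < 1 ->
  exists g, [/\ cstar g = g,
    forall x, cmul x h = cmul h x -> cmul x g = cmul g x & h = g + g - cmul g g].
Proof.
move=> hs h1; set a := rnorm h in h1.
have a0 : 0 <= a := rnorm_ge0 _.
pose s (g : A) : A := (2^-1)%:C *: (h + cmul g g).
pose u n := iter n s 0.
have us n : cstar (u n) = u n.
  by elim: n => [|n IH]; rewrite ?cstar0//= cstarZR cstarD hs cstarM IH.
have uc x n : cmul x h = cmul h x -> cmul x (u n) = cmul (u n) x.
  move=> xh; elim: n => [|n IH]; first by rewrite cmul0r cmulr0.
  by rewrite /= cmulZl cmulZr cmulDl cmulDr xh -cmulA -IH !cmulA IH.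
have un n : rnorm (u n) <= a.
  elim: n => [|n IH]; first by rewrite rnorm0.
  rewrite /= rnormZR ger0_norm ?invr_ge0//.
  have := rnormD h (cmul (u n) (u n)); have := rnorm_cmul (u n) (u n).
  have : rnorm (u n) * rnorm (u n) <= a * a by apply: ler_pM; rewrite ?rnorm_ge0.
  have : a * a <= a * 1 by apply: ler_wpM2l => //; exact: ltW.
  rewrite -/a; lra.
have ud n k : rnorm (u (n + k)%N - u n) <= a ^+ n.
  elim: n => [|n IH]; first by rewrite subr0 expr0 (le_trans (un _))// ltW.
  rewrite addSn /= -scalerBr opprD addrACA subrr add0r.
  rewrite rnormZR ger0_norm ?invr_ge0//.
  set x := u (n + k)%N; set y := u n.
  have -> : cmul x x - cmul y y = cmul (x - y) x + cmul y (x - y).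
    by rewrite cmulBl cmulBr addrA subrK.
  have e1 := rnormD (cmul (x - y) x) (cmul y (x - y)).
  have e2 := rnorm_cmul (x - y) x; have e3 := rnorm_cmul y (x - y).
  have e4 : rnorm (x - y) * rnorm x <= a ^+ n * a.
    by apply: ler_pM; rewrite ?rnorm_ge0// un.
  have e5 : rnorm y * rnorm (x - y) <= a * a ^+ n.
    by apply: ler_pM; rewrite ?rnorm_ge0// un.
  rewrite exprS; lra.
have an0 : (fun n => a ^+ n) @ \oo --> (0 : R).
  by apply: cvg_expr; rewrite ger0_norm.
have /rcauchy_cvg/cvg_ex[g ug] : forall e : R, 0 < e -> exists x : A,
    (u @ \oo) [set y | rnorm (x - y) < e].
  move=> e e0; have /cvgrPdist_lt/(_ _ e0)[N _ hN] := an0.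
  exists (u N); exists N => //= n Nn.
  rewrite /= rnormBC -(subnKC Nn) (le_lt_trans (ud _ _))//.
  by have := hN N (leqnn N); rewrite /= sub0r normrN ger0_norm// exprn_ge0.
exists g; split.
- apply: (rcvg_unique _ ug).
  have -> : u = (fun n => cstar (u n)) by apply/funext => n; rewrite us.
  exact: cvg_cstar.
- move=> x xh; apply: (@rcvg_unique _ _ \oo _ (fun n => cmul x (u n))).
    exact: (cvg_cmul (cvg_cst x) ug).
  rewrite (_ : (fun n => _) = fun n => cmul (u n) x); last first.
    by apply/funext => n; exact: uc.
  exact: (cvg_cmul ug (cvg_cst x)).
- have e : g = s g.
    apply: (@rcvg_unique _ _ \oo _ (fun n => u n.+1)); first by rewrite cvg_shiftS.
    apply: cvgZl_tmp; apply: cvgD; first exact: cvg_cst.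
    exact: (cvg_cmul ug ug).
  have -> : g + g = h + cmul g g.
    rewrite [in LHS]e /s -scalerDl -rmorphD /= (_ : 2^-1 + 2^-1 = 1 :> R).
      by rewrite scale1r.
    by lra.
  by rewrite addrK.
Qed.

(** For selfadjoint [h] of norm less than 1, write [h^2 = 2g - g^2]. In the
    unitization of [B], the elements [phi h + i (1 - phi g)] and [phi h - i (1
    - phi g)] are unitary, hence multiply [B] isometrically from the left, and
    [phi h] is their average. Thus left multiplication by [phi h] is a
    contraction, and the C*-identity bounds its norm by 1. The general case
    follows through [x^* x]. *)
Lemma star_hom_rnorm A B (phi : {linear A -> B}) : star_hom phi ->
  forall x, rnorm (phi x) <= rnorm x.
Proof.
move=> [phiM phiS].
have small h : cstar h = h -> rnorm h < 1 -> rnorm (phi h) <= 1.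
  move=> hs h1.
  have [||g [gs gc gE]] := @sqrt_one_minus A (cmul h h).
  - by rewrite cstarM hs.
  - by rewrite rnorm_selfadj2// expr_lt1// rnorm_ge0.
  set k := phi h; set c := phi g.
  have ks : cstar k = k by rewrite /k -phiS hs.
  have cs : cstar c = c by rewrite /c -phiS gs.
  have kc : cmul k c = cmul c k by rewrite /k /c -!phiM gc// cmulA.
  have kk : cmul k k = c + c - cmul c c.
    by rewrite /k /c -!phiM gE linearB /= linearD.
  have isom (v : R[i]) b : Num.conj v = - v -> v * v = -1 ->
      rnorm (cmul k b + v *: (b - cmul c b)) = rnorm b.
    move=> vc vv; apply/eqP.
    rewrite -(@eqrXn2 _ 2%N) ?rnorm_ge0// -!rnorm_cstar2; apply/eqP; congr rnorm.
    set p := cmul k b; set q := b - cmul c b.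
    rewrite cstarD cstarZ vc cmulDl !cmulDr !cmulZl !cmulZr.
    have -> : cmul (cstar q) p = cmul (cstar p) q.
      rewrite /p /q cstarB !cstarM ks cs cmulBl cmulBr -!cmulA.
      by congr (_ - cmul _ _); rewrite !cmulA kc.
    rewrite scaleNr scalerA mulNr vv opprK scale1r addrA addrK.
    rewrite /p /q cstarB !cstarM ks cs -(cmulA (cstar b)) (cmulA k) kk.
    rewrite !(cmulBl, cmulBr, cmulDl, cmulDr) -!cmulA.
    set x := cmul (cstar b) b; set y := cmul (cstar b) (cmul c b).
    set w := cmul (cstar b) (cmul c (cmul c b)).
    by rewrite -(addrA x) -opprD (addrA y) addrC subrK.
  have kb b : rnorm (cmul k b) <= rnorm b.
    have h1b := isom 'i b (conjCi _) (mulCii _).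
    have h2b := isom (- 'i) b.
    rewrite rmorphN /= conjCi mulrNN mulCii in h2b.
    have {}h2b := h2b erefl erefl.
    have := rnormD (cmul k b + 'i *: (b - cmul c b))
                   (cmul k b + - 'i *: (b - cmul c b)).
    rewrite h1b h2b addrACA -scalerDl subrr scale0r addr0.
    have -> : cmul k b + cmul k b = 2%:C *: cmul k b.
      by rewrite -[LHS]mulr2n -scaler_nat rmorph_nat.
    by rewrite rnormZR ger0_norm//; lra.
  have := kb k; rewrite rnorm_selfadj2// => kk2.
  have k0 := rnorm_ge0 k.
  rewrite leNgt; apply/negP => k1.
  have : rnorm k * 1 < rnorm k * rnorm k by rewrite ltr_pM2l//; lra.
  by rewrite mulr1; lra.
move=> x; apply/ler_addgt0Pr => e e0.
set r := rnorm x + e; have r0 : 0 < r by have := rnorm_ge0 x; rewrite /r; lra.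
(* [r] exceeds the norm of [x], so [y^* y] is in the range of [small]. *)
pose y := (r^-1)%:C *: x.
have y1 : rnorm y < 1.
  rewrite rnormZR ger0_norm ?invr_ge0 ?ltW// mulrC ltr_pdivrMr// mul1r /r; lra.
have h1 : rnorm (cmul (cstar y) y) < 1.
  by rewrite rnorm_cstar2 expr_lt1// rnorm_ge0.
have h2 : rnorm (phi (cmul (cstar y) y)) <= 1.
  by apply: small => //; rewrite cstarM cstarK.
have : rnorm (phi y) <= 1.
  by rewrite -(@expr_le1 _ 2%N) ?rnorm_ge0// -rnorm_cstar2 -phiS -phiM.
rewrite /y linearZ /= rnormZR ger0_norm; last by rewrite invr_ge0 ltW.
by rewrite mulrC ler_pdivrMr// mul1r.
Qed.

End CStar.

(** * Simple functions *)

Section Bochner.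
Variables (R : realType) (G : topGroupType).
Variable mu : {measure set (borel G) -> \bar R}.
Variable V : completeNormedModType R[i].
Implicit Types (E D K : set (borel G)) (l : seq (set (borel G) * V)).

Lemma open_measurableG (U : set G) : open U -> measurable (U : set (borel G)).
Proof. by move=> oU; apply: sub_sigma_algebra. Qed.

Lemma measurable_rcont (h : G -> R^o) : continuous h ->
  measurable_fun [set: borel G] (h : borel G -> R).
Proof.
move=> ch; apply: (measurability _ (measurable_realfun.RGenOpens.measurableE R)).
move=> _ [_ [a [b ->] <-]]; rewrite setTI; apply: (@open_measurableG (h @^-1` _)).
by move/continuousP : ch; apply; exact: interval_open.
Qed.

(** A list of pairs [(E, v)] stands for the simple function obtained by adding
    up the [1_E v]; the sets may overlap. *)
Definition svalue l (s : borel G) : V := \sum_(p <- l) (\1_(p.1) s : R)%:C *: p.2.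
Definition ssum l : V := \sum_(p <- l) (fine (mu p.1))%:C *: p.2.
Definition sfin l := forall p, p \in l -> measurable p.1 /\ (mu p.1 < +oo)%E.

Lemma sfin_cons E v l :
  sfin ((E, v) :: l) -> [/\ measurable E, (mu E < +oo)%E & sfin l].
Proof.
move=> h; have [] := h (E, v) (mem_head _ _); split=> // p pl.
by apply: h; rewrite inE pl orbT.
Qed.

Lemma svalue_cons E v l s : svalue ((E, v) :: l) s =
  (if s \in E then v else 0) + svalue l s.
Proof.
rewrite /svalue big_cons /= indicE; case: (s \in E); first by rewrite scale1r.
by rewrite scale0r.
Qed.

Lemma svalue_cat k l s : svalue (k ++ l) s = svalue k s + svalue l s.
Proof. by rewrite /svalue big_cat. Qed.

Definition sopp l := [seq (p.1, - p.2) | p <- l].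

Lemma svalueN l s : svalue (sopp l) s = - svalue l s.
Proof. by rewrite /svalue big_map -sumrN; apply: eq_bigr => p _; rewrite scalerN. Qed.

Lemma ssumN l : ssum (sopp l) = - ssum l.
Proof. by rewrite /ssum big_map -sumrN; apply: eq_bigr => p _; rewrite scalerN. Qed.

Lemma sfinN l : sfin l -> sfin (sopp l).
Proof. by move=> fl p /mapP[q ql ->]; exact: (fl _ ql). Qed.

Lemma sfin_cat k l : sfin k -> sfin l -> sfin (k ++ l).
Proof. by move=> fk fl p; rewrite mem_cat => /orP[/fk|/fl]. Qed.

Lemma ssum_cat k l : ssum (k ++ l) = ssum k + ssum l.
Proof. by rewrite /ssum big_cat. Qed.

Lemma measurable_rnorm_svalue l (F : G -> V) : sfin l -> continuous F ->
  measurable_fun [set: borel G] (fun s => rnorm (F s + svalue l s)).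
Proof.
elim: l F => [|[E v] l IH] F.
  move=> _ cF; apply: measurable_rcont => s.
  under eq_fun do rewrite /svalue big_nil addr0.
  exact: (rnorm_cvg (cF s)).
move=> /sfin_cons[mE _ fl] cF.
rewrite (_ : (fun s => _) = fun s => if s \in E then rnorm (F s + v + svalue l s)
   else rnorm (F s + svalue l s)).
  apply: measurable_fun_ifT; last exact: IH.
    apply: (@measurable_fun_bool _ _ _ _ true).
    rewrite setTI (_ : _ @^-1` _ = E)//.
    by apply/seteqP; split=> x /=; [move/set_mem|move/mem_set].
  apply: (IH (fun s => F s + v)) => // s; apply: cvgD; [exact: cF|exact: cvg_cst].
apply/funext => s; rewrite svalue_cons; case: ifP => _; first by rewrite addrA.
by rewrite add0r.
Qed.

Lemma emeasurable_rnorm_svalue l (F : G -> V) D : sfin l -> continuous F ->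
  measurable D ->
  measurable_fun D (fun s => (rnorm (F s + svalue l s))%:E).
Proof.
move=> fl cF mD; apply/measurable_EFinP.
by apply: measurable_funTS; exact: measurable_rnorm_svalue.
Qed.

Lemma emeasurable_rnorm_svalueB l (F : G -> V) : sfin l -> continuous F ->
  measurable_fun [set: borel G] (fun s => (rnorm (F s - svalue l s))%:E).
Proof.
move=> fl cF; under eq_fun do rewrite -svalueN.
by apply: emeasurable_rnorm_svalue => //; exact: sfinN.
Qed.

Lemma emeasurable_svalue l : sfin l ->
  measurable_fun [set: borel G] (fun s => (rnorm (svalue l s))%:E).
Proof.
move=> fl; rewrite (_ : (fun s => _) = fun s => (rnorm (0 + svalue l s))%:E).
  apply: (emeasurable_rnorm_svalue (F := fun=> 0) fl _ measurableT).
  by move=> s; exact: cvg_cst.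
by apply/funext => s; rewrite add0r.
Qed.

Let m E : R := fine (mu E).

(** Induction on [l]: the first set cuts the domain [D] in two parts, and on
    the part inside [E] the vector [v] joins the constant [w]. The alternative
    on [D] and [w] is what holds at the start, where [D] is the whole space,
    possibly of infinite measure, and [w = 0]. *)
Lemma rnorm_ssum_aux l D w : sfin l -> measurable D ->
  (mu D < +oo)%E \/ w = 0 ->
  ((rnorm ((m D)%:C *: w + \sum_(p <- l) (m (D `&` p.1))%:C *: p.2))%:E <=
  \int[mu]_(s in D) (rnorm (w + svalue l s))%:E)%E.
Proof.
elim: l D w => [|[E v] l IH] D w fl mD Dw.
  rewrite big_nil addr0 rnormZR ger0_norm ?fine_ge0//.
  under eq_integral do rewrite /svalue big_nil addr0.
  case: Dw => [Dfin|->]; last by rewrite rnorm0 mulr0 integral_ge0.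
  rewrite integral_cst// muleC EFinM /m fineK// ge0_fin_numE//.
have [mE Efin {}fl] := sfin_cons fl.
have mDE : measurable (D `&` E) by exact: measurableI.
have mDnE : measurable (D `\` E) by exact: measurableD.
have finDE X : measurable X -> (mu X < +oo)%E ->
    m (D `&` X) = m (D `&` E `&` X) + m ((D `\` E) `&` X).
  move=> mX fX; rewrite /m -fineD.
  - congr fine; rewrite -measureU//.
    + by rewrite -setIUl setUIDK.
    + exact: measurableI.
    + exact: measurableI.
    + by apply/seteqP; split=> // x [[[_ Ex] _] [[_ nE] _]]; exact: nE.
  - rewrite ge0_fin_numE//; apply: le_lt_trans fX; apply: le_measure; rewrite ?inE//.
    exact: measurableI.
  - rewrite ge0_fin_numE//; apply: le_lt_trans fX; apply: le_measure; rewrite ?inE//.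
    exact: measurableI.
pose g s := (rnorm (w + svalue ((E, v) :: l) s))%:E.
have fl' : sfin ((E, v) :: l).
  by move=> p; rewrite inE => /orP[/eqP ->//|]; exact: fl.
have mg X : measurable X -> measurable_fun X g.
  move=> mX; apply: (@emeasurable_rnorm_svalue _ (fun=> w)) => //.
  by move=> s; exact: cvg_cst.
have gD : (\int[mu]_(s in D) g s =
   \int[mu]_(s in D `&` E) (rnorm (w + v + svalue l s))%:E +
   \int[mu]_(s in D `\` E) (rnorm (w + svalue l s))%:E)%E.
  rewrite -{1}(setUIDK D E) ge0_integral_setU//; last 3 first.
  - by apply: mg; rewrite setUIDK.
  - by move=> s _; rewrite lee_fin rnorm_ge0.
  - by apply/disj_setPS => x [[_ Ex] [_]].
  congr (_ + _)%E; apply: eq_integral => s /set_mem [Ds Es]; rewrite /g svalue_cons.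
    by rewrite mem_set// addrA.
  by rewrite memNset// add0r.
rewrite gD.
have finE X : measurable X -> X `<=` E -> (mu X < +oo)%E.
  by move=> mX XE; apply: le_lt_trans Efin; apply: le_measure; rewrite ?inE.
have h1 := IH (D `&` E) (w + v) fl mDE (or_introl (finE _ mDE (@subIsetr _ _ _))).
have h2 : (mu (D `\` E) < +oo)%E \/ w = 0.
  case: Dw => [Df|->]; [left|by right].
  by apply: le_lt_trans Df; apply: le_measure; rewrite ?inE.
have {}h2 := IH (D `\` E) w fl mDnE h2.
apply: le_trans (leeD h1 h2); rewrite lee_fin.
apply: le_trans (rnormD _ _); rewrite le_eqVlt; apply/orP; left; apply/eqP.
congr rnorm; rewrite big_cons scalerDr.
have -> : (m D)%:C *: w = (m (D `&` E))%:C *: w + (m (D `\` E))%:C *: w.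
  case: Dw => [Df|->]; last by rewrite !scaler0 addr0.
  rewrite -scalerDl -rmorphD /=; have := finDE D mD Df.
  rewrite setIid setIAC setIid (_ : (D `\` E) `&` D = D `\` E); first by move->.
  by apply/seteqP; split=> [x []|x [Dx nEx]].
have -> : \sum_(p <- l) (m (D `&` p.1))%:C *: p.2 =
    \sum_(p <- l) (m (D `&` E `&` p.1))%:C *: p.2 +
    \sum_(p <- l) (m ((D `\` E) `&` p.1))%:C *: p.2.
  rewrite -big_split /=; apply: eq_big_seq => p /fl[mp fp].
  by rewrite (finDE _ mp fp) rmorphD /= scalerDl.
by rewrite (addrA (_ *: v)) addrACA (addrA (_ *: w) (_ *: v)).
Qed.

Lemma rnorm_ssum l : sfin l ->
  ((rnorm (ssum l))%:E <= \int[mu]_s (rnorm (svalue l s))%:E)%E.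
Proof.
move=> fl; have := rnorm_ssum_aux fl measurableT (or_intror erefl).
rewrite scaler0 add0r; under eq_integral do rewrite add0r.
by under eq_bigr do rewrite setTI.
Qed.

(** The simple functions approximating [F] in L1-norm satisfy the estimate by
    [rnorm_ssum], and it passes to the limit. *)
Lemma rnorm_integral_le (F : G -> V) x l : continuous F -> sfin l ->
  is_bochner_integral mu F x ->
  ((rnorm (x - ssum l))%:E <= \int[mu]_s (rnorm (F s - svalue l s))%:E)%E.
Proof.
move=> cF fl Fx; apply/lee_addgt0Pr => e e0.
have e2 : 0 < e / 2 :> R by lra.
have [n [E [v [mE hF hx]]]] := Fx _ e2.
pose k := [seq (E i, v i) | i <- enum 'I_n].
have fk : sfin k by move=> p /mapP[i _ ->]; exact: mE.
have sk : ssum k = \sum_i (fine (mu (E i)))%:C *: v i.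
  by rewrite /ssum big_map big_enum.
have vk s : svalue k s = \sum_i (\1_(E i) s)%:C *: v i.
  by rewrite /svalue big_map big_enum.
have fkl : sfin (k ++ sopp l) by apply: sfin_cat => //; exact: sfinN.
have vkl s : svalue k s - svalue l s = svalue (k ++ sopp l) s.
  by rewrite svalue_cat svalueN.
have h1 : ((rnorm (ssum k - ssum l))%:E <=
    \int[mu]_s (rnorm (svalue k s - svalue l s))%:E)%E.
  rewrite -ssumN -ssum_cat; under eq_integral do rewrite vkl.
  exact: rnorm_ssum.
have mF1 := emeasurable_rnorm_svalueB fl cF.
have mF2 := emeasurable_rnorm_svalueB fk cF.
have h2 : (\int[mu]_s (rnorm (svalue k s - svalue l s))%:E <=
   \int[mu]_s (rnorm (F s - svalue l s))%:E +
   \int[mu]_s (rnorm (F s - svalue k s))%:E)%E.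
  rewrite -ge0_integralD//; [|by move=> *; rewrite lee_fin rnorm_ge0..].
  apply: ge0_le_integral => //.
  - by move=> *; rewrite lee_fin rnorm_ge0.
  - by under eq_fun do rewrite vkl; exact: emeasurable_svalue.
  - exact: emeasurable_funD.
  - move=> s _; rewrite lee_fin addrC.
    by rewrite (rnormBC (F s) (svalue k s)); exact: rnorm_dist.
have h3 : (rnorm (x - ssum l) <= rnorm (x - ssum k) + rnorm (ssum k - ssum l))%R.
  exact: rnorm_dist.
rewrite (@le_trans _ _ ((rnorm (x - ssum k))%:E + (rnorm (ssum k - ssum l))%:E)%E)//.
rewrite (@le_trans _ _ ((e / 2)%:E + (\int[mu]_s (rnorm (F s - svalue l s))%:E
   + (e / 2)%:E))%E)//.
  apply: leeD; first by rewrite lee_fin sk ltW.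
  apply: (le_trans h1); apply: (le_trans h2); apply: leeD => //.
  by under eq_integral do rewrite vk; exact: ltW.
by rewrite addeCA -EFinD -splitr.
Qed.

Lemma integral_svalue_le l : sfin l ->
  (\int[mu]_s (rnorm (svalue l s))%:E <=
   (\sum_(p <- l) fine (mu p.1) * rnorm p.2)%:E)%E.
Proof.
elim: l => [|[E v] l IH] fl.
  rewrite big_nil; under eq_integral do rewrite /svalue big_nil rnorm0.
  by rewrite integral0.
have [mE Efin fl'] := sfin_cons fl.
rewrite big_cons EFinD; apply: le_trans (leeD (lexx _) (IH fl')).
have -> : (fine (mu E) * rnorm v)%:E = (\int[mu]_s (rnorm v * (\1_E s))%:E)%E.
  under eq_integral do rewrite EFinM.
  rewrite ge0_integralZl_EFin ?rnorm_ge0//; last first.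
    by apply/measurable_EFinP; exact: measurable_indic.
  by rewrite integral_indic// setIT EFinM fineK 1?muleC// ge0_fin_numE.
have m1 : measurable_fun [set: borel G] (fun s => (rnorm v * (\1_E s))%:E).
  by apply/measurable_EFinP; apply: measurable_funM => //; exact: measurable_indic.
rewrite -ge0_integralD//; last 3 first.
- by move=> s _; rewrite lee_fin mulr_ge0 ?rnorm_ge0// indicE.
- by move=> s _; rewrite lee_fin rnorm_ge0.
- exact: emeasurable_svalue.
apply: ge0_le_integral => //.
- by move=> s _; rewrite lee_fin rnorm_ge0.
- exact: emeasurable_svalue.
- by apply: emeasurable_funD => //; exact: emeasurable_svalue.
- move=> s _; rewrite lee_fin svalue_cons indicE (le_trans (rnormD _ _))// lerD2r.
  by case: (s \in E); rewrite ?mulr1// mulr0 rnorm0.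
Qed.

End Bochner.

(** * Riemann sums over fine partitions *)

Section Gauge.
Variables (R : realType) (G : topGroupType).
Hypothesis hausdorffG : hausdorff_space G.
Variable mu : {measure set (borel G) -> \bar R}.
Hypothesis mu_compact : forall K : set G, compact K -> (mu K < +oo)%E.
Implicit Types (D E K : set (borel G)) (U : G -> set G)
  (P : seq (set (borel G) * G)).

Definition gauge U := forall s, nbhs s (U s).

(** Tagged partitions of [D] subordinate to [U]. Splitting off one piece after
    the other makes the pieces disjoint by construction; a tag may lie outside
    its piece. *)
Fixpoint gpart U D P : Prop :=
  if P is (E, s) :: P' then
    [/\ measurable E, E `<=` D, E `<=` U s & gpart U (D `\` E) P']
  else D = set0.

Lemma gpart_sub U U' D P : (forall s, U s `<=` U' s) ->
  gpart U D P -> gpart U' D P.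
Proof.
move=> UU'; elim: P D => //= -[E s] P IH D [mE ED EU h]; split=> //; last exact: IH.
exact: subset_trans EU (UU' s).
Qed.

Lemma compact_measurableG (K : set G) : compact K -> measurable (K : set (borel G)).
Proof.
move=> cK; rewrite -(setCK K); apply: measurableC; apply: open_measurableG.
by rewrite openC; exact: compact_closed.
Qed.

(** By compactness finitely many of the neighbourhoods cover [K], and cutting
    them out successively makes them disjoint. Interiors are used because the
    [U s] need not be measurable. *)
Lemma gpart_exists U (K : set G) : gauge U -> compact K -> exists P, gpart U K P.
Proof.
move=> gU cK.
pose F : set_system (seq G) :=
  [set A | exists l0 : seq G, forall l : seq G, {subset l0 <= l} -> A l].
have FF : Filter F.
  split=> [|A B [l hl] [k hk]|A B AB [l hl]].
  - by exists [::].
  - exists (l ++ k) => j lkj; split; [apply: hl|apply: hk] => x xl;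
      by apply: lkj; rewrite mem_cat xl ?orbT.
  - by exists l => j /hl/AB.
have [] := (compact_near_coveringP K).1 cK _ F
  (fun (l : seq G) x => exists2 s, s \in l & (U s)° x) FF.
  move=> x Kx; exists ((U x)°, [set l : seq G | x \in l]).
    split; first by rewrite /= -/(nbhs x _); apply: open_nbhs_nbhs;
      split; [exact: open_interior | exact: gU].
    by exists [:: x] => l; apply; rewrite inE.
  by move=> [y l] /= [Uxy xl]; exists x.
move=> l /(_ l (fun _ => id)) Kl.
have : K `<=` [set x | exists2 s, s \in l & (U s)° x] by [].
have : measurable (K : set (borel G)) by exact: compact_measurableG.
move: (K : set (borel G)) => D; elim: (l) D => [|s k IH] D mD Dl.
  by exists [::]; apply/seteqP; split=> // x /Dl[].
have mE : measurable (D `&` (U s)°).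
  by apply: measurableI => //; apply: open_measurableG; exact: open_interior.
have [||P hP] := IH (D `\` (D `&` (U s)°)).
- exact: measurableD.
- move=> x [Dx nx]; have [t] := Dl _ Dx; rewrite inE => /orP[/eqP ->|tk Ut].
    by move=> Us; case: nx.
  by exists t.
exists ((D `&` (U s)°, s) :: P); split=> //.
by move=> x [_ /interior_subset].
Qed.

(** Convergence along this filter is the convergence of Riemann sums: gauges
    play the role of the mesh. *)
Definition fineF K : set_system (seq (set (borel G) * G)) :=
  [set A | exists2 U, gauge U & forall P, gpart U K P -> A P].

#[local] Instance fineF_filter K : Filter (fineF K).
Proof.
split=> [|A B [U gU hU] [W gW hW]|A B AB [U gU hU]].
- by exists (fun=> setT) => // s; exact: filterT.
- exists (fun s => U s `&` W s); first by move=> s; exact: filterI.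
  by move=> P h; split; [apply: hU|apply: hW]; apply: gpart_sub h => s x [].
- by exists U => // P /hU/AB.
Qed.

Lemma fineF_proper (K : set G) : compact K -> ProperFilter (fineF K).
Proof.
move=> cK; split; last exact: fineF_filter.
by move=> [U gU h]; have [P /h] := gpart_exists gU cK.
Qed.

Lemma gpart_mu U D P : measurable D -> (mu D < +oo)%E -> gpart U D P ->
  \sum_(p <- P) fine (mu p.1) = fine (mu D).
Proof.
elim: P D => [|[E s] P IH] D mD fD /=.
  by move->; rewrite big_nil measure0.
move=> [mE ED EU h]; have fE : (mu E < +oo)%E.
  by apply: le_lt_trans fD; apply: le_measure; rewrite ?inE.
have mDE : measurable (D `\` E) by exact: measurableD.
have fDE : (mu (D `\` E) < +oo)%E.
  by apply: le_lt_trans fD; apply: le_measure; rewrite ?inE.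
rewrite big_cons /= (IH _ mDE fDE h) -fineD ?ge0_fin_numE//.
by rewrite -measureU//; [rewrite setDUK|rewrite setDIK].
Qed.

Section Vector.
Variable V : completeNormedModType R[i].
Implicit Types F : G -> V.

Definition tagv F P := [seq (p.1, F p.2) | p <- P].
Definition riem F P : V := \sum_(p <- P) (fine (mu p.1))%:C *: F p.2.

Lemma riemE F P : riem F P = ssum mu (tagv F P).
Proof. by rewrite /ssum big_map. Qed.

Lemma gpart_sfin F U D P : (mu D < +oo)%E -> measurable D -> gpart U D P ->
  sfin mu (tagv F P).
Proof.
elim: P D => [|[E s] P IH] D fD mD //= [mE ED EU h] p.
rewrite inE => /orP[/eqP ->/=|].
  by split=> //; apply: le_lt_trans fD; apply: le_measure; rewrite ?inE.
have mDE : measurable (D `\` E) by exact: measurableD.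
apply: (IH (D `\` E) _ mDE h).
by apply: le_lt_trans fD; apply: le_measure; rewrite ?inE.
Qed.

Lemma gpart_svalue F U D P x : gpart U D P ->
  (D x /\ exists2 s, U s x & svalue (tagv F P) x = F s) \/
  (~ D x /\ svalue (tagv F P) x = 0).
Proof.
elim: P D => [|[E s] P IH] D /=.
  by move=> ->; right; split=> //; rewrite /svalue big_nil.
move=> [mE ED EU /IH[]].
  move=> [[Dx nEx] [t Ut e]]; left; split=> //; exists t => //.
  by rewrite svalue_cons memNset// add0r.
have [Ex|nEx] := pselect (E x).
  move=> [_ e]; left; split; first exact: ED.
  by exists s; [exact: EU|rewrite svalue_cons mem_set// e addr0].
move=> [nD e]; right; split; first by move=> Dx; exact: nD.
by rewrite svalue_cons memNset// add0r.
Qed.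

(** Unlike [Cc], this keeps track of a compact set carrying the function,
    which is the set to be partitioned. *)
Definition Ck (K : set G) F := continuous F /\ forall s, ~ K s -> F s = 0.

Definition osc_le F (K : set G) (e : R) U :=
  forall s t, U s t -> K t -> rnorm (F s - F t) <= e.

Lemma osc_gauge F (e : R) : continuous F -> 0 < e ->
  gauge (fun s => [set t | rnorm (F s - F t) <= e]).
Proof.
move=> cF e0 s; have /rcontP/(_ _ e0) := cF s.
by apply: filterS => t /ltW.
Qed.

(** The simple function taking the value [F s] on the piece tagged [s] is
    uniformly close to [F] on [K], and vanishes with [F] off [K]. *)
Lemma integral_osc F U (K : set G) P (e : R) : compact K -> Ck K F -> 0 <= e ->
  gpart U K P -> osc_le F K e U ->
  (\int[mu]_s (rnorm (F s - svalue (tagv F P) s))%:E <= (e * fine (mu K))%:E)%E.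
Proof.
move=> cK [cF F0] e0 hP hU.
have mK := compact_measurableG cK; have fK := mu_compact cK.
have fl := gpart_sfin (F := F) fK mK hP.
have -> : (e * fine (mu K))%:E = (\int[mu]_s (e * (\1_K s))%:E)%E.
  under eq_integral do rewrite EFinM.
  rewrite ge0_integralZl_EFin//; last first.
    by apply/measurable_EFinP; exact: measurable_indic.
  by rewrite integral_indic// setIT EFinM fineK// ge0_fin_numE.
apply: ge0_le_integral => //.
- by move=> s _; rewrite lee_fin rnorm_ge0.
- exact: (emeasurable_rnorm_svalueB fl cF).
- apply/measurable_EFinP; apply: measurable_funM => //; exact: measurable_indic.
- move=> s _; rewrite lee_fin indicE.
  have [[Ks [t Ut ->]]|[nKs ->]] := gpart_svalue F s hP.
    by rewrite mem_set// mulr1 rnormBC; exact: hU.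
  by rewrite F0// subr0 rnorm0 memNset// mulr0.
Qed.

Lemma riem_dist F U W (K : set G) P Q (e : R) : compact K -> Ck K F -> 0 <= e ->
  gpart U K P -> osc_le F K e U -> gpart W K Q -> osc_le F K e W ->
  rnorm (riem F P - riem F Q) <= e * fine (mu K) + e * fine (mu K).
Proof.
move=> cK CF e0 hP hU hQ hW; have [cF F0] := CF.
have mK := compact_measurableG cK; have fK := mu_compact cK.
have fP := gpart_sfin (F := F) fK mK hP; have fQ := gpart_sfin (F := F) fK mK hQ.
have fPQ : sfin mu (tagv F P ++ sopp (tagv F Q)).
  by apply: sfin_cat => //; exact: sfinN.
have h := rnorm_ssum fPQ.
rewrite -lee_fin EFinD !riemE -ssumN -ssum_cat; apply: (le_trans h).
apply: le_trans (leeD (integral_osc cK CF e0 hP hU) (integral_osc cK CF e0 hQ hW)).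
have mP := emeasurable_rnorm_svalueB fP cF.
have mQ := emeasurable_rnorm_svalueB fQ cF.
rewrite -ge0_integralD//; [|by move=> *; rewrite lee_fin rnorm_ge0..].
apply: ge0_le_integral => //.
- by move=> *; rewrite lee_fin rnorm_ge0.
- exact: (emeasurable_svalue fPQ).
- exact: emeasurable_funD.
- move=> s _; rewrite lee_fin svalue_cat svalueN (rnormBC (F s)).
  exact: rnorm_dist.
Qed.

Lemma riem_small (K : set G) (e : R) : 0 < e ->
  exists2 d : R, 0 < d & d * fine (mu K) + d * fine (mu K) < e.
Proof.
move=> e0; have m0 : 0 <= fine (mu K) by rewrite fine_ge0.
exists (e / (2 * (fine (mu K) + 1))); first by rewrite divr_gt0//; lra.
have -> : forall x y : R, x * y + x * y = x * (2 * y) by move=> *; ring.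
rewrite mulrAC ltr_pdivrMr; last by lra.
by rewrite ltr_pM2l//; lra.
Qed.

Lemma riem_cvg_ex F (K : set G) : compact K -> Ck K F ->
  exists x : V, riem F @ fineF K --> x.
Proof.
move=> cK CF; have PF := fineF_proper cK.
exists (lim (riem F @ fineF K)); apply: rcauchy_cvg => e e0.
have [d d0 hd] := riem_small K e0.
have gU := osc_gauge CF.1 d0.
have [P hP] := gpart_exists gU cK.
exists (riem F P); exists (fun s => [set t | rnorm (F s - F t) <= d]) => // Q hQ.
by apply: le_lt_trans hd; apply: (riem_dist cK CF (ltW d0) hP _ hQ).
Qed.

Lemma riem_bochner F (K : set G) (x : V) : compact K -> Ck K F ->
  riem F @ fineF K --> x -> is_bochner_integral mu F x.
Proof.
move=> cK CF hx e e0; have PF := fineF_proper cK.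
have [d d0 hd] := riem_small K e0.
have gU := osc_gauge CF.1 d0.
have [W gW hW] := (rcvgP _ _ _).1 hx e e0.
have gUW : gauge (fun s => [set t | rnorm (F s - F t) <= d] `&` W s).
  by move=> s; exact: filterI.
have [P hP] := gpart_exists gUW cK.
have hP1 : gpart (fun s => [set t | rnorm (F s - F t) <= d]) K P.
  by apply: gpart_sub hP => s t [].
have hP2 : gpart W K P by apply: gpart_sub hP => s t [].
have mK := compact_measurableG cK; have fK := mu_compact cK.
have fl := gpart_sfin (F := F) fK mK hP.
have m0 : 0 <= fine (mu K) by rewrite fine_ge0.
exists (size P), (fun i => (tnth (in_tuple P) i).1),
  (fun i => F (tnth (in_tuple P) i).2); split.
- move=> i; have := fl ((tnth (in_tuple P) i).1, F (tnth (in_tuple P) i).2).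
  by apply; apply/mapP; exists (tnth (in_tuple P) i) => //; exact: mem_tnth.
- have E s : \sum_(i < size P) (\1_((tnth (in_tuple P) i).1) s : R)%:C *:
      F (tnth (in_tuple P) i).2 = svalue (tagv F P) s.
    rewrite -(big_tnth _ _ P xpredT (fun p => (\1_(p.1) s : R)%:C *: F p.2)).
    by rewrite /svalue big_map.
  under eq_integral do rewrite E.
  have := integral_osc cK CF (ltW d0) hP1 (fun _ _ h _ => h).
  move=> h; apply: (le_lt_trans h); rewrite lte_fin.
  have : 0 <= d * fine (mu K) by rewrite mulr_ge0// ltW.
  lra.
- rewrite -(big_tnth _ _ P xpredT (fun p => (fine (mu p.1))%:C *: F p.2)).
  exact: hW.
Qed.

Lemma bochner_is F (K : set G) : compact K -> Ck K F ->
  is_bochner_integral mu F (bochner_integral mu F).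
Proof.
move=> cK CF; have [x hx] := riem_cvg_ex cK CF.
exact: (@xgetPex _ 0 [set x | is_bochner_integral mu F x])
  (ex_intro _ x (riem_bochner cK CF hx)).
Qed.

(** An error bound for an individual partition, so that one partition can
    serve a whole family of functions. *)
Lemma riem_estimate F U (K : set G) P (e : R) : compact K -> Ck K F -> 0 <= e ->
  gpart U K P -> osc_le F K e U ->
  rnorm (bochner_integral mu F - riem F P) <= e * fine (mu K).
Proof.
move=> cK CF e0 hP hU; rewrite -lee_fin riemE.
have fl := gpart_sfin (F := F) (mu_compact cK) (compact_measurableG cK) hP.
apply: le_trans (integral_osc cK CF e0 hP hU).
exact: (rnorm_integral_le CF.1 fl (bochner_is cK CF)).
Qed.

Lemma riem_cvg F (K : set G) : compact K -> Ck K F ->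
  riem F @ fineF K --> bochner_integral mu F.
Proof.
move=> cK CF; have [x hx] := riem_cvg_ex cK CF.
have PF := fineF_proper cK.
apply/rcvgP => e e0; have [d d0 hd] := riem_small K e0.
exists (fun s => [set t | rnorm (F s - F t) <= d]).
  exact: (osc_gauge CF.1 d0).
move=> P hP; have := riem_estimate cK CF (ltW d0) hP (fun _ _ h _ => h).
move/le_lt_trans; apply; apply: le_lt_trans hd.
by rewrite lerDl mulr_ge0// ?fine_ge0// ltW.
Qed.

Lemma rnorm_bochner_le F (K : set G) : compact K -> Ck K F ->
  ((rnorm (bochner_integral mu F))%:E <= \int[mu]_s (rnorm (F s))%:E)%E.
Proof.
move=> cK CF.
have fl : sfin mu ([::] : seq (set (borel G) * V)) by [].
have := rnorm_integral_le CF.1 fl (bochner_is cK CF).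
rewrite /ssum big_nil subr0; under eq_integral do rewrite /svalue big_nil subr0.
by [].
Qed.

End Vector.
End Gauge.

(** * The Bochner integral of compactly supported continuous functions *)

Section Integral.
Variables (R : realType) (G : topGroupType).
Hypothesis hausdorffG : hausdorff_space G.
Variable mu : {measure set (borel G) -> \bar R}.
Hypothesis mu_compact : forall K : set G, compact K -> (mu K < +oo)%E.
Implicit Types K L : set G.

Let riem_cvg := (riem_cvg hausdorffG mu_compact).
Local Notation I := (bochner_integral mu).

Lemma Ck_Cc (V : normedModType R[i]) (F : G -> V) :
  Cc F <-> exists2 K : set G, compact K & (continuous F /\ forall s, ~ K s -> F s = 0).
Proof.
split=> [[cF cK]|[K cK [cF F0]]].
  exists (closure [set s | F s != 0]) => //; split=> // s nKs.
  apply/eqP/negPn/negP => Fs; apply: nKs; exact: subset_closure.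
split=> //; apply: (subclosed_compact _ cK); first exact: closed_closure.
have : closed K by exact: compact_closed.
move=> /closure_id ->; apply: closureS => s /= Fs; apply/not_notP => nK.
by move/eqP: Fs; apply; exact: F0.
Qed.

Lemma Ck_sub (V : completeNormedModType R[i]) K L (F : G -> V) :
  K `<=` L -> Ck K F -> Ck L F.
Proof. by move=> KL [cF F0]; split=> // s nL; apply: F0 => /KL. Qed.

Lemma Ck_ex (V : completeNormedModType R[i]) (F : G -> V) : Cc F ->
  exists2 K, compact K & Ck K F.
Proof. by move/Ck_Cc. Qed.

Lemma CkCc (V : completeNormedModType R[i]) K (F : G -> V) : compact K -> Ck K F -> Cc F.
Proof. by move=> cK CF; apply/Ck_Cc; exists K. Qed.

Lemma Ck2 (V W : completeNormedModType R[i]) (F : G -> V) (H : G -> W) :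
  Cc F -> Cc H -> exists2 K, compact K & Ck K F /\ Ck K H.
Proof.
move=> /Ck_ex[K cK CF] /Ck_ex[L cL CH]; exists (K `|` L); first exact: compactU.
by split; [apply: Ck_sub CF => x; left|apply: Ck_sub CH => x; right].
Qed.

(** Riemann sums have real coefficients, so additivity and real homogeneity
    suffice; conjugate-linear maps are thereby included. *)
Lemma bochner_comm (V W : completeNormedModType R[i]) (T : V -> W) (F : G -> V) :
  {morph T : x y / x + y} -> (forall (r : R) x, T (r%:C *: x) = r%:C *: T x) ->
  continuous T -> Cc F -> I (T \o F) = T (I F) /\ Cc (T \o F).
Proof.
move=> TD TZ cT /Ck_ex[K cK CF].
have T0 : T 0 = 0 by apply: (addrI (T 0)); rewrite -TD !addr0.
have CTF : Ck K (T \o F).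
  split=> [s|s nK /=]; last by rewrite (CF.2 _ nK).
  by apply: continuous_comp; [exact: CF.1|exact: cT].
split; last exact: CkCc CTF.
have PF := fineF_proper hausdorffG cK.
apply: (@rcvg_unique _ _ _ (fineF K) _ (riem mu (T \o F))); first exact: riem_cvg.
have -> : riem mu (T \o F) = T \o riem mu F.
  apply/funext => P /=; rewrite /riem; elim: P => [|p P IH].
    by rewrite !big_nil T0.
  by rewrite !big_cons TD TZ IH.
by apply: (cvg_comp _ _ (riem_cvg cK CF)); exact: cT.
Qed.

Lemma bochnerD (V : completeNormedModType R[i]) (F H : G -> V) : Cc F -> Cc H ->
  I (fun s => F s + H s) = I F + I H /\ Cc (fun s => F s + H s).
Proof.
move=> cF cH; have [K cK [CF CH]] := Ck2 cF cH.
have CFH : Ck K (fun s => F s + H s).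
  split=> [s|s nK]; first by apply: cvgD; [exact: CF.1|exact: CH.1].
  by rewrite CF.2// CH.2// addr0.
split; last exact: CkCc CFH.
have PF := fineF_proper hausdorffG cK.
apply: (@rcvg_unique _ _ _ (fineF K) _ _ _ _ (riem_cvg cK CFH)).
have -> : riem mu (fun s => F s + H s) = fun P => riem mu F P + riem mu H P.
  apply/funext => P; rewrite /riem -big_split /=.
  by apply: eq_bigr => p _; rewrite scalerDr.
by apply: cvgD; exact: riem_cvg.
Qed.

Lemma scale_continuousr (V : normedModType R[i]) (c : R[i]) :
  continuous (fun v : V => c *: v).
Proof. by move=> v; apply: cvgZ; [exact: cvg_cst|exact: cvg_id]. Qed.

Lemma bochnerZ (V : completeNormedModType R[i]) (c : R[i]) (F : G -> V) : Cc F ->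
  I (fun s => c *: F s) = c *: I F /\ Cc (fun s => c *: F s).
Proof.
move=> cF; apply: (@bochner_comm _ _ (fun v => c *: v)) => //.
- by move=> x y; rewrite scalerDr.
- by move=> r x; rewrite !scalerA mulrC.
- exact: scale_continuousr.
Qed.

Lemma bochner_sum (V : completeNormedModType R[i]) (J : Type) (l : seq J)
    (F : J -> G -> V) : (forall j, Cc (F j)) ->
  I (fun s => \sum_(j <- l) F j s) = \sum_(j <- l) I (F j) /\
  Cc (fun s => \sum_(j <- l) F j s).
Proof.
move=> cF; elim: l => [|j l [IH1 IH2]].
  rewrite big_nil; have -> : (fun s => \sum_(j <- [::]) F j s) = (fun _ : G => 0 : V).
    by apply/funext => s; rewrite big_nil.
  have c0 : Cc (fun _ : G => 0 : V).
    apply/Ck_Cc; exists set0; first exact: compact0.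
    by split=> // s; exact: cvg_cst.
  split=> //; have [h _] := bochnerZ 0 c0.
  by rewrite scaler0 scale0r in h.
have -> : (fun s => \sum_(i <- j :: l) F i s) =
    fun s => F j s + \sum_(i <- l) F i s.
  by apply/funext => s; rewrite big_cons.
by have [h1 h2] := bochnerD (cF j) IH2; split=> //; rewrite h1 IH1 big_cons.
Qed.

(** [L1norm] for values in an arbitrary normed space. *)
Definition N1 (V : normedModType R[i]) (F : G -> V) : R := (\int[mu]_s rnorm (F s))%R.

Lemma measurable_rnormG (V : normedModType R[i]) (F : G -> V) : continuous F ->
  measurable_fun [set: borel G] (fun s => (rnorm (F s))%:E).
Proof.
move=> cF; apply/measurable_EFinP; apply: measurable_rcont => s.
exact: (rnorm_cvg (cF s)).
Qed.

Lemma integral_rnorm_le (V : completeNormedModType R[i]) K (F : G -> V) (c : R) :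
  compact K -> Ck K F -> 0 <= c -> (forall s, rnorm (F s) <= c) ->
  (\int[mu]_s (rnorm (F s))%:E <= (c * fine (mu K))%:E)%E.
Proof.
move=> cK CF c0 hc; have mK := compact_measurableG hausdorffG cK.
have -> : (c * fine (mu K))%:E = (\int[mu]_s (c * (\1_K s))%:E)%E.
  under eq_integral do rewrite EFinM.
  rewrite ge0_integralZl_EFin//; last first.
    by apply/measurable_EFinP; exact: measurable_indic.
  by rewrite integral_indic// setIT EFinM fineK// ge0_fin_numE// mu_compact.
apply: ge0_le_integral => //.
- by move=> s _; rewrite lee_fin rnorm_ge0.
- exact: measurable_rnormG CF.1.
- apply/measurable_EFinP; apply: measurable_funM => //; exact: measurable_indic.
- move=> s _; rewrite lee_fin indicE; have [Ks|nK] := pselect (K s).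
    by rewrite mem_set// mulr1.
  by rewrite memNset// mulr0 CF.2// rnorm0.
Qed.

Lemma Cc_bounded (V : completeNormedModType R[i]) (F : G -> V) : Cc F ->
  exists2 c : R, 0 <= c & forall s, rnorm (F s) <= c.
Proof.
move=> /Ck_ex[K cK [cF F0]].
have : compact [set (rnorm (F s) : R^o) | s in K].
  apply: (@continuous_compact _ _ (fun s => rnorm (F s) : R^o)) => //.
  by apply: continuous_subspaceT => s; exact: (rnorm_cvg (cF s)).
move=> /compact_bounded[M [_ hM]].
exists (`|M| + 1); first by rewrite addr_ge0.
move=> s; have [Ks|nK] := pselect (K s); last by rewrite F0// rnorm0 addr_ge0.
have h1 : M < `|M| + 1 by rewrite (le_lt_trans (ler_norm _))// ltrDl.
have := hM _ h1 (rnorm (F s)) (ex_intro2 _ _ s Ks erefl).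
by rewrite /= ger0_norm// rnorm_ge0.
Qed.

Lemma N1_fin (V : completeNormedModType R[i]) (F : G -> V) : Cc F ->
  (\int[mu]_s (rnorm (F s))%:E = (N1 F)%:E)%E.
Proof.
move=> cF; have [c c0 hc] := Cc_bounded cF; have [K cK CF] := Ck_ex cF.
rewrite /N1 /Rintegral fineK// ge0_fin_numE; last first.
  by apply: integral_ge0 => s _; rewrite lee_fin rnorm_ge0.
by apply: le_lt_trans (integral_rnorm_le cK CF c0 hc) _; rewrite ltry.
Qed.

Lemma N1_ge0 (V : normedModType R[i]) (F : G -> V) : 0 <= N1 F.
Proof. by apply: Rintegral_ge0 => s _; exact: rnorm_ge0. Qed.

Lemma N1_le (V : completeNormedModType R[i]) K (F : G -> V) (c : R) :
  compact K -> Ck K F -> 0 <= c -> (forall s, rnorm (F s) <= c) ->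
  N1 F <= c * fine (mu K).
Proof.
move=> cK CF c0 hc; rewrite -lee_fin -N1_fin; last exact: CkCc CF.
exact: integral_rnorm_le.
Qed.

Lemma N1_mono (V W : completeNormedModType R[i]) (F : G -> V) (H : G -> W) (c : R) :
  Cc F -> Cc H -> 0 <= c -> (forall s, rnorm (F s) <= c * rnorm (H s)) ->
  N1 F <= c * N1 H.
Proof.
move=> cF cH c0 hc; rewrite -lee_fin EFinM -!N1_fin//.
have mH := measurable_rnormG cH.1.
rewrite -ge0_integralZl_EFin//; last by move=> s _; rewrite lee_fin rnorm_ge0.
apply: ge0_le_integral => //.
- by move=> s _; rewrite lee_fin rnorm_ge0.
- exact: measurable_rnormG cF.1.
- exact: measurable_funeM.
- by move=> s _; rewrite -EFinM lee_fin.
Qed.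

Lemma rnorm_bochner (V : completeNormedModType R[i]) (F : G -> V) : Cc F ->
  rnorm (I F) <= N1 F.
Proof.
move=> cF; have [K cK CF] := Ck_ex cF; rewrite -lee_fin -N1_fin//.
exact: (rnorm_bochner_le hausdorffG mu_compact cK CF).
Qed.

Lemma Cc_rnorm (V : completeNormedModType R[i]) (F : G -> V) : Cc F ->
  Cc (fun s => (rnorm (F s))%:C : Cplx R).
Proof.
move=> /Ck_ex[K cK [cF F0]]; apply: (CkCc cK); split=> [s|s nK]; last first.
  by rewrite F0// rnorm0.
apply/rcontP => e e0; have /rcontP/(_ _ e0) := cF s; apply: filterS => t.
rewrite rnormCB; apply: le_lt_trans.
exact: rnorm_distl.
Qed.

(** Both integrals are close to the Riemann sum of the norms over a fine
    partition of [K]. *)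
Lemma bochner_rnorm (V : completeNormedModType R[i]) (F : G -> V) : Cc F ->
  I (fun s => (rnorm (F s))%:C : Cplx R) = (N1 F)%:C.
Proof.
move=> cF; have [K cK CF] := Ck_ex cF.
pose H s : Cplx R := (rnorm (F s))%:C.
have rH s : rnorm (H s) = rnorm (F s) by rewrite rnormC ger0_norm// rnorm_ge0.
have cH : Cc H := Cc_rnorm cF.
have CH : Ck K H by split; [exact: cH.1|move=> s nK; rewrite /H CF.2// rnorm0].
have AN : rnorm (I H) <= N1 F.
  by rewrite (le_trans (rnorm_bochner cH))// /N1; under eq_Rintegral do rewrite rH.
apply/eqP; rewrite -subr_eq0; apply/eqP; apply: (@rnorm_le_eps R (Cplx R)) => e e0.
have [d d0 hd] := riem_small mu K e0; apply: le_trans (ltW hd).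
have gU := osc_gauge CF.1 d0.
have [P hP] := gpart_exists hausdorffG gU cK.
have fK := mu_compact cK; have mK := compact_measurableG hausdorffG cK.
have fl := gpart_sfin (F := F) fK mK hP.
have oF := integral_osc hausdorffG mu_compact cK CF (ltW d0) hP (fun _ _ h _ => h).
have oH : osc_le H K d (fun s => [set t | rnorm (F s - F t) <= d]).
  move=> s t h _; rewrite rnormCB.
  by apply: le_trans h; exact: rnorm_distl.
have eH := riem_estimate hausdorffG mu_compact cK CH (ltW d0) hP oH.
pose r := \sum_(p <- P) fine (mu p.1) * rnorm (F p.2).
have rE : riem mu H P = r%:C.
  by rewrite /riem /r rmorph_sum; apply: eq_bigr => p _; rewrite rmorphM.
have r0 : 0 <= r.
  by apply: sumr_ge0 => p _; rewrite mulr_ge0 ?rnorm_ge0// fine_ge0.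
have h1 : N1 F <= d * fine (mu K) + r.
  rewrite -lee_fin EFinD -(N1_fin cF).
  have := integral_svalue_le fl; rewrite big_map => oS.
  apply: le_trans (leeD oF oS).
  have m1 := emeasurable_rnorm_svalueB fl CF.1.
  have m2 := emeasurable_svalue fl.
  rewrite -ge0_integralD//; last 2 first.
  - by move=> *; rewrite lee_fin rnorm_ge0.
  - by move=> *; rewrite lee_fin rnorm_ge0.
  apply: ge0_le_integral => //.
  - by move=> s _; rewrite lee_fin rnorm_ge0.
  - exact: measurable_rnormG CF.1.
  - exact: emeasurable_funD.
  - by move=> s _; rewrite lee_fin -{1}(subrK (svalue (tagv F P) s) (F s)) rnormD.
have h2 : r <= N1 F + d * fine (mu K).
  have : rnorm (riem mu H P) <= rnorm (I H) + rnorm (I H - riem mu H P).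
    by rewrite -{1}(subKr (I H) (riem mu H P)); exact: rnormB.
  by rewrite {1}rE rnormC ger0_norm//; lra.
have h3 : rnorm (r%:C - (N1 F)%:C : Cplx R) <= d * fine (mu K).
  by rewrite rnormCB ler_norml; lra.
rewrite rE in eH.
by rewrite (le_trans (rnorm_dist _ (r%:C : Cplx R) _))// lerD.
Qed.

End Integral.

(** * Parameter integrals and L1-bounded maps *)

Section Tube.
Variables (R : realType) (G : topGroupType) (X : topologicalType).
Variable V : normedModType R[i].

(** The tube lemma: continuity at the points [(x0, r)] becomes uniform in [r]
    because [L] is compact. *)
Lemma tube (h : X * G -> V) (x0 : X) (L : set G) (e : R) :
  continuous h -> compact L ->
  (\forall x \near x0, forall r, ~ L r -> h (x, r) = 0) -> 0 < e ->
  \forall x \near x0, forall r, rnorm (h (x0, r) - h (x, r)) < e.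
Proof.
move=> ch cL h0 e0.
have e2 : 0 < e / 2 by lra.
have := (compact_near_coveringP L).1 cL X (nbhs x0)
  (fun x r => rnorm (h (x0, r) - h (x, r)) < e) _.
have {}ch : forall r, L r -> \forall r' \near r & x \near x0,
    rnorm (h (x0, r') - h (x, r')) < e.
  move=> r _; have /rcontP/(_ _ e2)[[A B] /= [Ax0 Br] AB] := ch (x0, r).
  exists (B, A) => //= -[r' x] /= [Br' Ax].
  rewrite (le_lt_trans (rnorm_dist _ (h (x0, r)) _))//.
  have := AB (x, r') (conj Ax Br'); have := AB (x0, r') (conj (nbhs_singleton Ax0) Br').
  by rewrite /= (rnormBC (h (x0, r'))) => ? ?; lra.
move=> /(_ _ ch) H.
have h00 := nbhs_singleton h0.
near=> x => r.
have [Lr|nL] := pselect (L r).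
  by move: r Lr; near: x; exact: H.
have -> : h (x, r) = 0 by move: r nL; near: x; exact: h0.
by rewrite h00// subr0 rnorm0.
Unshelve. all: by end_near. Qed.
End Tube.

Section Integral.
Variables (R : realType) (G : topGroupType).
Hypothesis hausdorffG : hausdorff_space G.
Variable mu : {measure set (borel G) -> \bar R}.
Hypothesis mu_compact : forall K : set G, compact K -> (mu K < +oo)%E.
Implicit Types K L : set G.
Local Notation I := (bochner_integral mu).

(** The positive and negative parts of [h] are the norms of the functions they
    define, so [bochner_rnorm] applies to each of them. *)
Lemma bochner_real (h : G -> R^o) : Cc h ->
  I (fun s => (h s)%:C : Cplx R) = ((\int[mu]_s h s)%R)%:C /\
  Cc (fun s => (h s)%:C : Cplx R).
Proof.
move=> ch; have [cF cK] := ch.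
have h0 s : ~ closure [set s | h s != 0] s -> h s = 0.
  move=> n; apply/eqP/negPn/negP => H; apply: n; exact: subset_closure.
have part (p : R -> R) : p 0 = 0 -> (forall x, 0 <= p x) ->
   (forall x y, `|p x - p y| <= `|x - y|) ->
   I (fun s => (p (h s))%:C : Cplx R) = (fine (\int[mu]_s (p (h s))%:E))%:C /\
   Cc (fun s => (p (h s))%:C : Cplx R) /\
   (\int[mu]_s (p (h s))%:E < +oo)%E.
  move=> p0 pp pl.
  have C : Cc (fun s => (p (h s))%:C : Cplx R).
    apply: (CkCc hausdorffG cK); split=> [s|s /h0 ->]; last by rewrite p0.
    apply/rcontP => e e0; have /cvgrPdist_lt/(_ _ e0) := cF s.
    by apply: filterS => t; rewrite rnormCB; exact: le_lt_trans.
  have E s : rnorm ((p (h s))%:C : Cplx R) = p (h s) by rewrite rnormC ger0_norm.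
  have fE : (\int[mu]_s (p (h s))%:E =
      (N1 mu (fun s => (p (h s))%:C : Cplx R))%:E)%E.
    rewrite -(N1_fin hausdorffG mu_compact C).
    by apply: eq_integral => s _; rewrite E.
  rewrite fE ltry; split; last by [].
  rewrite -(bochner_rnorm hausdorffG mu_compact C).
  by congr bochner_integral; apply/funext => s; rewrite E.
have lip (x y : R) : `|Num.max x 0 - Num.max y 0| <= `|x - y|.
  have h1 := ler_norm (x - y); have h2 := ler_norm (y - x); rewrite distrC in h2.
  by rewrite ler_norml; case: (leP x 0) => ?; case: (leP y 0) => ?;
    apply/andP; split; lra.
have [|||Ep [Cp fp]] := part (fun x => Num.max x 0).
- by rewrite maxxx.
- by move=> x; rewrite le_max lexx orbT.
- exact: lip.
have [|||En [Cn fn]] := part (fun x => Num.max (- x) 0).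
- by rewrite oppr0 maxxx.
- by move=> x; rewrite le_max lexx orbT.
- by move=> x y; rewrite (le_trans (lip _ _))// -opprD normrN.
have [Em Cm] := bochnerZ hausdorffG mu_compact (- 1) Cn.
have [Ed Cd] := bochnerD hausdorffG mu_compact Cp Cm.
have E : (fun s => (h s)%:C : Cplx R) = fun s => ((Num.max (h s) 0)%:C : Cplx R)
    + (- 1) *: ((Num.max (- h s) 0)%:C : Cplx R).
  apply/funext => s; rewrite scaleN1r.
  have {1}-> : h s = Num.max (h s) 0 - Num.max (- h s) 0.
    by case: (leP (h s) 0) => ?; case: (leP (- h s) 0) => ?; lra.
  exact: rmorphB.
rewrite E; split; last exact: Cd.
rewrite Ed Em Ep En /Rintegral (lebesgue_integral_definition.integralE mu setT (fun s => (h s)%:E)).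
rewrite (_ : (fun s => (h s)%:E)^\+%E = fun s => (Num.max (h s) 0)%:E); last first.
  by apply/funext => s; rewrite funeposE -EFin_max.
rewrite (_ : (fun s => (h s)%:E)^\-%E = fun s => (Num.max (- h s) 0)%:E); last first.
  by apply/funext => s; rewrite funenegE -EFin_max.
have fin (g : G -> R) : (forall s, 0 <= g s) ->
    (\int[mu]_s (g s)%:E < +oo)%E -> (\int[mu]_s (g s)%:E)%E \is a fin_num.
  move=> g0 gf; rewrite ge0_fin_numE//.
  by apply: integral_ge0 => s _; rewrite lee_fin.
have max0 (x : R) : 0 <= Num.max x 0 by rewrite le_max lexx orbT.
have -> := fineB (fin (fun s => Num.max (h s) 0) (fun s => max0 _) fp)
                 (fin (fun s => Num.max (- h s) 0) (fun s => max0 _) fn).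
by rewrite scaleN1r; exact/esym/rmorphB.
Qed.

(** Representations of the convolution algebra, at a fixed vector, are of this
    kind, and so is the integral itself. *)
Definition L1_bounded (V W : completeNormedModType R[i]) (Lam : (G -> V) -> W)
    (c : R) : Prop :=
  [/\ 0 <= c,
      forall (a : R[i]) f g, Cc f -> Cc g ->
        Lam (fun s => a *: f s + g s) = a *: Lam f + Lam g
    & forall f, Cc f -> rnorm (Lam f) <= c * N1 mu f].

Lemma L1_bounded_integral (V : completeNormedModType R[i]) :
  L1_bounded (fun f : G -> V => I f) 1.
Proof.
split=> // [a f g cf cg|f cf].
  have [E C] := bochnerZ hausdorffG mu_compact a cf.
  by rewrite (bochnerD hausdorffG mu_compact C cg).1 E.
by rewrite mul1r; exact: (rnorm_bochner hausdorffG mu_compact).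
Qed.

Section Bounded.
Variables (V W : completeNormedModType R[i]) (Lam : (G -> V) -> W) (c : R).
Hypothesis LamL1 : L1_bounded Lam c.

Lemma L1_boundedB f g : Cc f -> Cc g -> Lam (fun s => f s - g s) = Lam f - Lam g.
Proof.
move=> cf cg; case: LamL1 => _ LamD _.
rewrite (_ : (fun s => _) = fun s => (- 1) *: g s + f s); last first.
  by apply/funext => s; rewrite scaleN1r addrC.
by rewrite LamD// scaleN1r addrC.
Qed.

Lemma L1_bounded_unif (M : set G) f g (d : R) : compact M -> Ck M f -> Ck M g ->
  0 <= d -> (forall r, rnorm (f r - g r) <= d) ->
  rnorm (Lam f - Lam g) <= c * (d * fine (mu M)).
Proof.
move=> cM Cf Cg d0 hd; case: LamL1 => c0 _ Lam_le.
rewrite -L1_boundedB; [|exact: (CkCc hausdorffG cM Cf)|exact: (CkCc hausdorffG cM Cg)].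
have C : Ck M (fun s => f s - g s).
  split=> [s|s nM]; last by rewrite Cf.2// Cg.2// subr0.
  by apply: cvgB; [exact: Cf.1|exact: Cg.1].
rewrite (le_trans (Lam_le _ (CkCc hausdorffG cM C)))// ler_wpM2l//.
exact: (N1_le hausdorffG mu_compact cM).
Qed.

(** By [tube] the family is continuous for the L1-norm. *)
Lemma L1_bounded_family (X : topologicalType) (h : X * G -> V) (x0 : X) (M : set G) :
  continuous h -> compact M ->
  (\forall x \near x0, forall r, ~ M r -> h (x, r) = 0) ->
  {for x0, continuous (fun x => Lam (fun r => h (x, r)))}.
Proof.
move=> ch cM hn; case: (LamL1) => c0 _ _; apply/rcontP => e e0.
have cr x : continuous (fun r => h (x, r)).
  by move=> r; apply: (@continuous_comp _ _ _ (fun r => (x, r)) h); [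
    apply: cvg_pair; [exact: cvg_cst|exact: cvg_id]|exact: ch].
pose k := c * fine (mu M); have k0 : 0 <= k by rewrite mulr_ge0// fine_ge0.
pose d := e / (k + 1); have d0 : 0 < d by rewrite divr_gt0//; lra.
have ht := tube ch cM hn d0; have hns := nbhs_singleton hn.
move: hn ht; apply: filterS2 => x hM hd.
have := L1_bounded_unif cM (conj (cr x0) hns) (conj (cr x) hM) (ltW d0)
  (fun r => ltW (hd r)).
move=> /le_lt_trans; apply; rewrite mulrCA -/k /d mulrAC ltr_pdivrMr; last by lra.
by rewrite ltr_pM2l//; lra.
Qed.
End Bounded.

Section Param.
Variables (V W : completeNormedModType R[i]).
Variables (h : G * G -> V) (K L : set G).
Hypotheses (ch : continuous h) (cK : compact K) (cL : compact L).
Hypothesis h0 : forall t r, ~ K t \/ ~ L r -> h (t, r) = 0.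

Let ct r : Ck K (fun t => h (t, r)).
Proof.
split=> [t|t nK]; last by apply: h0; left.
by apply: (@continuous_comp _ _ _ (fun t => (t, r)) h); [
   apply: cvg_pair; [exact: cvg_id|exact: cvg_cst]|exact: ch].
Qed.

Let cr t : Ck L (fun r => h (t, r)).
Proof.
split=> [r|r nL]; last by apply: h0; right.
by apply: (@continuous_comp _ _ _ (fun r => (t, r)) h); [
   apply: cvg_pair; [exact: cvg_cst|exact: cvg_id]|exact: ch].
Qed.

Let nearL (t : G) : \forall t' \near t, forall r, ~ L r -> h (t', r) = 0.
Proof. by apply: nearW => t' r nL; apply: h0; right. Qed.

Let L1_bounded0 (U : completeNormedModType R[i]) (T : (G -> V) -> U) (b : R) f :
  L1_bounded T b -> Cc f -> (forall r, f r = 0) -> T f = 0.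
Proof.
move=> TL cf f0; rewrite -(subrr (T f)) -(L1_boundedB TL cf cf).
by congr T; apply/funext => r; rewrite f0 subrr.
Qed.

Lemma Ck_bochner : Ck L (fun r => I (fun t => h (t, r))).
Proof.
have csw : continuous (fun x : G * G => h (x.2, x.1)).
  move=> x; apply: (@continuous_comp _ _ _ (fun x : G * G => (x.2, x.1)) h).
    by apply: cvg_pair; [exact: cvg_snd|exact: cvg_fst].
  exact: ch.
split=> [r|r nL].
  apply: (L1_bounded_family (L1_bounded_integral V) csw cK).
  by apply: nearW => r' t nK; apply: h0; left.
apply: (L1_bounded0 (L1_bounded_integral V) (CkCc hausdorffG cK (ct r))).
by move=> t; apply: h0; right.
Qed.

Variables (Lam : (G -> V) -> W) (c : R).
Hypothesis LamL1 : L1_bounded Lam c.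

Lemma Ck_L1_bounded : Ck K (fun t => Lam (fun r => h (t, r))).
Proof.
split=> [t|t nK]; first exact: (L1_bounded_family LamL1 ch cL (nearL t)).
apply: (L1_bounded0 LamL1 (CkCc hausdorffG cL (cr t))).
by move=> r; apply: h0; left.
Qed.

Let mL := fine (mu L).
Let mK := fine (mu K).
Let mL0 : 0 <= mL. Proof. exact: fine_ge0. Qed.
Let mK0 : 0 <= mK. Proof. exact: fine_ge0. Qed.

(** By [tube] there is one partition for which the Riemann sums in [t]
    approximate uniformly in [r]; since the supports lie in [L], they
    approximate in L1-norm, and [Lam] can be applied to them term by term. *)
Lemma L1_bounded_bochner :
  Lam (fun r => I (fun t => h (t, r))) = I (fun t => Lam (fun r => h (t, r))).
Proof.
case: (LamL1) => c0 LamD _.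
apply/eqP; rewrite -subr_eq0; apply/eqP; apply: rnorm_le_eps => e e0.
pose M := c * mL * mK.
have M0 : 0 <= M by rewrite !mulr_ge0.
pose d := e / (2 * (M + 1)).
have d0 : 0 < d by rewrite divr_gt0//; lra.
pose U (t : G) := [set t' | forall r, rnorm (h (t, r) - h (t', r)) <= d].
have gU : gauge U.
  move=> t; have := tube ch cL (nearL t) d0.
  by apply: filterS => t' ht r; exact: ltW.
have [P hP] := gpart_exists hausdorffG gU cK.
pose S r := riem mu (fun t => h (t, r)) P.
have hS r : rnorm (I (fun t => h (t, r)) - S r) <= d * mK.
  by apply: (riem_estimate hausdorffG mu_compact cK (ct r) (ltW d0) hP) => s t Ust _.
have [ES CS] : Lam S = riem mu (fun t => Lam (fun r => h (t, r))) P /\ Ck L S.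
  rewrite /S /riem; elim: (P) => [|p Q [IH1 IH2]].
    have C0 : Ck L (fun _ : G => 0 : V) by split=> // s; exact: cvg_cst.
    rewrite (_ : (fun r => _) = fun _ : G => 0 : V); last first.
      by apply/funext => r; rewrite big_nil.
    by rewrite big_nil; split=> //; exact: (L1_bounded0 LamL1 (CkCc hausdorffG cL C0)).
  have -> : (fun r => \sum_(q <- p :: Q) (fine (mu q.1))%:C *: h (q.2, r)) =
    fun r => (fine (mu p.1))%:C *: h (p.2, r) + \sum_(q <- Q) (fine (mu q.1))%:C *: h (q.2, r).
    by apply/funext => r; rewrite big_cons.
  split; first by rewrite LamD ?IH1 ?big_cons//; [exact: (CkCc hausdorffG cL (cr _))|
    exact: (CkCc hausdorffG cL IH2)].
  split=> [r|r nL]; last by rewrite IH2.2// h0 ?scaler0 ?addr0//; right.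
  apply: cvgD; last exact: IH2.1.
  by apply: cvgZ; [exact: cvg_cst|exact: (cr p.2).1].
have h1 := L1_bounded_unif LamL1 cL Ck_bochner CS (mulr_ge0 (ltW d0) mK0) hS.
have h2 := riem_estimate hausdorffG mu_compact cK Ck_L1_bounded
   (mulr_ge0 c0 (mulr_ge0 (ltW d0) mL0)) hP
   (fun s t Ust _ => L1_bounded_unif LamL1 cL (cr s) (cr t) (ltW d0) Ust).
rewrite (le_trans (rnorm_dist _ (Lam S) _))//.
rewrite [X in _ + X]rnormBC {2}ES.
have -> : e = 2 * d * (M + 1) by rewrite /d; field; lra.
have : c * (d * mK * mL) = d * M by rewrite /M; ring.
have : c * (d * mL) * mK = d * M by rewrite /M; ring.
rewrite -/mL in h1; rewrite -/mL -/mK in h2.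
lra.
Qed.

End Param.
End Integral.

(** * Translation invariance and Fubini's theorem *)

Section Haar.
Variables (R : realType) (G : topGroupType).
Hypothesis hausdorffG : hausdorff_space G.
Variable mu : {measure set (borel G) -> \bar R}.
Hypothesis haar_mu : left_haar_measure mu.
Implicit Types K L : set G.
Local Notation I := (bochner_integral mu).

Lemma mu_compact K : compact K -> (mu K < +oo)%E.
Proof. by case: haar_mu => _ + _ _ _; apply. Qed.

Lemma cvg_mulg (T : topologicalType) (f g : T -> G) (x : T) :
  {for x, continuous f} -> {for x, continuous g} ->
  {for x, continuous (fun t => (f t * g t)%g)}.
Proof.
move=> cf cg; apply: (@continuous_comp _ _ _ (fun t => (f t, g t))
  (fun xy : G * G => (xy.1 * xy.2)%g)); last exact: mulg_continuous.
by apply: cvg_pair.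
Qed.

Lemma cvg_invg (T : topologicalType) (f : T -> G) (x : T) :
  {for x, continuous f} -> {for x, continuous (fun t => (f t)^-1%g)}.
Proof.
by move=> cf; apply: (@continuous_comp _ _ _ f); [exact: cf|exact: invg_continuous].
Qed.

Lemma cont_cst (T U : topologicalType) (u : U) (x : T) :
  {for x, continuous (fun _ : T => u)}.
Proof. exact: cvg_cst. Qed.

Lemma cont_id (T : topologicalType) (x : T) : {for x, continuous (fun t : T => t)}.
Proof. exact: cvg_id. Qed.

Lemma mulgl_continuous (s : G) : continuous (fun x : G => (s * x)%g).
Proof. by move=> x; apply: cvg_mulg; [exact: cont_cst|exact: cont_id]. Qed.

Lemma translateE (s : G) (E : set G) :
  [set (s * x)%g | x in E] = (fun x => (s^-1 * x)%g) @^-1` E.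
Proof.
apply/seteqP; split=> [_ [x Ex <-]|x /= Ex]; first by rewrite /= mulKg.
by exists (s^-1 * x)%g => //; rewrite mulVKg.
Qed.

Lemma measurable_translate (s : G) (E : set (borel G)) : measurable E ->
  measurable ([set (s * x)%g | x in E] : set (borel G)).
Proof.
move=> mE; rewrite translateE -[X in measurable X]setTI.
suff : measurable_fun [set: borel G] (fun x : borel G => (s^-1 * x)%g : borel G) by apply.
apply: (@measurability _ _ (borel G) (borel G) setT _ (@open G)) => //.
move=> _ [U oU <-]; rewrite setTI; apply: (@open_measurableG _ ((fun x => (s^-1 * x)%g) @^-1` U)).
by move/continuousP : (@mulgl_continuous s^-1%g); apply.
Qed.

Lemma compact_translate (s : G) K : compact K -> compact [set (s * x)%g | x in K].
Proof.
move=> cK; apply: continuous_compact => //.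
exact: continuous_subspaceT (@mulgl_continuous s).
Qed.

Lemma compact_mulg K L : compact K -> compact L ->
  compact [set (x.1 * x.2)%g | x in K `*` L].
Proof.
move=> cK cL; apply: continuous_compact; last exact: compact_setX.
exact: continuous_subspaceT (@mulg_continuous G).
Qed.

Lemma compact_invg K : compact K -> compact [set (x^-1)%g | x in K].
Proof.
move=> cK; apply: continuous_compact => //.
exact: continuous_subspaceT (@invg_continuous G).
Qed.

Lemma mu_translate (s : G) (E : set (borel G)) : measurable E ->
  mu [set (s * x)%g | x in E] = mu E.
Proof. by case: haar_mu => + _ _ _ _; apply. Qed.

(** Left translation carries a fine partition of the support of the translated
    function to one of [K], and the Riemann sums agree because [mu] is
    invariant. *)
Lemma bochner_translate (V : completeNormedModType R[i]) (s : G) (F : G -> V) : Cc F ->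
  I (fun x => F (s * x)%g) = I F /\ Cc (fun x => F (s * x)%g).
Proof.
move=> cF; have [K cK CF] := Ck_ex hausdorffG cF.
pose K' := [set (s^-1 * x)%g | x in K].
have cK' : compact K' by exact: compact_translate.
have CF' : Ck K' (fun x => F (s * x)%g).
  split=> [x|x nK]; last by apply: CF.2 => Ksx; apply: nK; exists (s * x)%g; rewrite ?mulKg.
  by apply: (@continuous_comp _ _ _ (fun x => (s * x)%g)); [exact: mulgl_continuous|exact: CF.1].
split; last exact: (CkCc hausdorffG cK' CF').
apply/eqP; rewrite -subr_eq0; apply/eqP; apply: rnorm_le_eps => e e0.
have [d d0 hd] := riem_small mu K e0.
have mKK : mu K' = mu K by apply: mu_translate; exact: compact_measurableG.
have [P hP] := gpart_exists hausdorffG (osc_gauge CF'.1 d0) cK'.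
pose Q : seq (set (borel G) * G) :=
  [seq ([set (s * x)%g | x in (p.1 : set G)] : set (borel G), (s * p.2)%g) | p <- P].
have hQ : gpart (fun t => [set t' | rnorm (F t - F t') <= d]) K Q.
  have -> : K = [set (s * x)%g | x in K'].
    apply/seteqP; split=> [x Kx|_ [_ [x Kx <-] <-]]; last by rewrite mulVKg.
    by exists (s^-1 * x)%g; [exists x|rewrite mulVKg].
  rewrite /Q; elim: (P) (K') hP => [|[E t] P' IH] D /=; first by move->; rewrite image_set0.
  move=> [mE ED EU /IH h]; split.
  - exact: measurable_translate.
  - exact: image_subset.
  - by move=> _ [x Ex <-]; exact: EU.
  - rewrite (_ : _ `\` _ = [set (s * x)%g | x in D `\` E])//.
    rewrite !translateE; by [].
have RE : riem mu F Q = riem mu (fun x => F (s * x)%g) P.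
  rewrite /riem /Q big_map; clear Q hQ.
  elim: P K' {cK' CF' mKK} hP => [|[E t] P IH] D; first by rewrite !big_nil.
  by move=> [mE _ _ /IH h]; rewrite !big_cons /= mu_translate// h.
have h1 := riem_estimate hausdorffG mu_compact cK' CF' (ltW d0) hP (fun _ _ h _ => h).
have h2 := riem_estimate hausdorffG mu_compact cK CF (ltW d0) hQ (fun _ _ h _ => h).
rewrite (le_trans (rnorm_dist _ (riem mu F Q) _))//.
by rewrite [X in _ + X]rnormBC {1}RE (le_trans _ (ltW hd))// lerD// -mKK.
Qed.

(** The inner integral is itself a linear map bounded for the L1-norm. *)
Lemma fubini (V : completeNormedModType R[i]) (h : G * G -> V) K L :
  continuous h -> compact K -> compact L ->
  (forall t r, ~ K t \/ ~ L r -> h (t, r) = 0) ->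
  I (fun r => I (fun t => h (t, r))) = I (fun t => I (fun r => h (t, r))).
Proof.
move=> ch cK cL h0.
exact: (L1_bounded_bochner hausdorffG mu_compact ch cK cL h0
  (L1_bounded_integral hausdorffG mu_compact V)).
Qed.

End Haar.

(** * The modular function *)

Section Modular.
Variables (R : realType) (G : topGroupType).
Hypothesis hausdorffG : hausdorff_space G.
Hypothesis lcG : locally_compact [set: G].
Variable mu : {measure set (borel G) -> \bar R}.
Hypothesis haar_mu : left_haar_measure mu.
Implicit Types K L : set G.
Local Notation I := (bochner_integral mu).
Let muK := mu_compact haar_mu.
Let CkC := @CkCc R G hausdorffG.

Lemma compact_nbhs (s : G) : exists2 N : set G, nbhs s N & compact N.
Proof.
have [N sN [cN _]] := lcG (Logic.I : [set: G] s).
exists N => //; move: sN; rewrite /within /=; by apply: filterS => x; apply.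
Qed.

(** If [U] were null then so would be its translates, finitely many of which
    cover any given compact set; by inner regularity [mu] would vanish. *)
Lemma measure_open_gt0 (U : set G) (u : G) : open U -> U u -> (0 < mu U)%E.
Proof.
move=> oU Uu; rewrite lt_neqAle measure_ge0 andbT; apply/eqP => U0.
case: haar_mu => _ _ _ innerreg; apply.
have mU := open_measurableG oU.
have z K : compact K -> mu K = 0%E.
  move=> cK; have gV : gauge (fun s => [set (s * u^-1 * x)%g | x in U]).
    move=> s; rewrite translateE; apply: open_nbhs_nbhs; split; last first.
      by rewrite /= invgM invgK mulgVK.
    by move/continuousP : (@mulgl_continuous G (s * u^-1)^-1%g); apply.
  have [P hP] := gpart_exists hausdorffG gV cK.
  have mK := compact_measurableG hausdorffG cK.
  have := gpart_mu mK (muK cK) hP.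
  suff -> : \sum_(p <- P) fine (mu p.1) = 0.
    move=> h; have fK := muK cK.
    by rewrite -(@fineK _ (mu K)) -?h// ge0_fin_numE.
  move: (K : set (borel G)) hP {mK cK} => D; elim: P D => [|[E s] P IH] D /=.
    by rewrite big_nil.
  move=> [mE _ EV /IH h]; rewrite big_cons h addr0 /=.
  suff -> : mu E = 0%E by [].
  apply/eqP; rewrite eq_le measure_ge0 andbT U0 -(mu_translate haar_mu (s * u^-1)%g mU).
  apply: le_measure; rewrite ?inE//; exact: measurable_translate.
rewrite innerreg; last exact: openT.
apply/eqP; rewrite eq_le; apply/andP; split.
  by apply: ub_ereal_sup => _ [K [cK _] <-]; rewrite z.
by apply: ereal_sup_ubound; exists set0; [split => //; exact: compact0|rewrite measure0].
Qed.

Lemma Rintegral_gt0 (h : G -> R^o) (s0 : G) : Cc h -> (forall s, 0 <= h s) ->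
  0 < h s0 -> 0 < (\int[mu]_s h s)%R.
Proof.
move=> ch h0 hs; have [_ CC] := bochner_real hausdorffG muK ch.
have fE := N1_fin hausdorffG muK CC.
have E s : rnorm ((h s)%:C : Cplx R) = h s by rewrite rnormC ger0_norm.
have -> : (\int[mu]_s h s)%R = N1 mu (fun s => (h s)%:C : Cplx R).
  by rewrite /N1; apply: eq_Rintegral => s _; rewrite E.
rewrite -lte_fin -fE.
(* On [U] the integrand is bounded below by a positive constant. *)
pose U := [set s | h s0 / 2 < h s].
have oU : open U by move/continuousP : ch.1 => /(_ _ (@open_gt R (h s0 / 2))).
have Us : U s0 by rewrite /U /=; lra.
have mU := open_measurableG oU.
have mh : measurable_fun [set: borel G] (fun s => (rnorm ((h s)%:C : Cplx R))%:E).
  exact: measurable_rnormG CC.1.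
have h1 : ((h s0 / 2)%:E * mu U <= \int[mu]_s (rnorm ((h s)%:C : Cplx R))%:E)%E.
  rewrite -(integral_cst mu mU).
  apply: (@le_trans _ _ (\int[mu]_(s in U) (rnorm ((h s)%:C : Cplx R))%:E)%E).
    apply: ge0_le_integral => //.
    - by move=> s _; rewrite lee_fin; lra.
    - exact: measurable_funS mh.
    - by move=> s; rewrite /U /= lee_fin E; exact: ltW.
  apply: ge0_subset_integral => //.
  by move=> s _; rewrite lee_fin rnorm_ge0.
apply: lt_le_trans h1; apply: mule_gt0; first by rewrite lte_fin; lra.
exact: measure_open_gt0 oU Us.
Qed.

Lemma bump_exists : exists2 k : G -> R^o, Cc k & (forall s, 0 <= k s) /\ 0 < k 1%g.
Proof.
have [N N1 cN] := compact_nbhs 1%g.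
have cB : closed (~` N°) by apply: open_closedC; exact: open_interior.
have nB : ~ (~` N°) (1%g : G) by apply; exact: N1.
have /(@uniform_separatorP _ R)[f [cf f01 f0 f1]] :=
  @locally_compact_completely_regular G R lcG hausdorffG _ _ cB nB.
exists (fun s => 1 - f s); last first.
  split=> [s|]; last by rewrite (_ : f 1%g = 0) ?subr0//; apply: f0; exists 1%g.
  have : range f (f s) by exists s.
  by move/f01; rewrite /= in_itv /= => /andP[_ ?]; rewrite subr_ge0.
split=> [s|]; first by apply: (@cvgB _ R^o); [exact: cvg_cst|exact: cf].
apply: (subclosed_compact _ cN); first exact: closed_closure.
have : closed N by exact: compact_closed.
move=> /closure_id ->; apply: closureS => s /=; apply: contraNP => nN.
apply/eqP; rewrite (_ : f s = 1) ?subrr//; apply: f1; exists s => // Ns; apply: nN.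
exact: interior_subset.
Qed.

Lemma Cc_lmul (V : completeNormedModType R[i]) (a : G -> Cplx R) (F : G -> V) :
  continuous a -> Cc F -> Cc (fun s => (a s : R[i]) *: F s).
Proof.
move=> ca /(Ck_ex hausdorffG)[K cK CF]; apply: (CkC cK); split=> [s|s nK].
  by apply: cvgZC; [exact: ca|exact: CF.1].
by rewrite CF.2// scaler0.
Qed.

Lemma Cc_realC (h : G -> R^o) : continuous h ->
  Cc (fun s => (h s)%:C : Cplx R) -> Cc h.
Proof.
move=> ch [_ cC]; split=> //; apply: (subclosed_compact _ cC); first exact: closed_closure.
apply: closureS => s /=; apply: contraNN => /eqP.
by rewrite -[0]/(0%:C) => /complexI ->.
Qed.

Lemma Cc_rmul (V : completeNormedModType R[i]) (a : G -> Cplx R) (F : G -> V) :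
  Cc a -> continuous F -> Cc (fun s => (a s : R[i]) *: F s).
Proof.
move=> /(Ck_ex hausdorffG)[K cK Ca] cF; apply: (CkC cK); split=> [s|s nK].
  by apply: cvgZC; [exact: Ca.1|exact: cF].
by rewrite Ca.2// scale0r.
Qed.

Lemma Cc_rtranslate (V : completeNormedModType R[i]) (F : G -> V) (s : G) :
  Cc F -> Cc (fun t => F (t * s)%g).
Proof.
move=> /(Ck_ex hausdorffG)[K cK CF].
apply: (CkC (compact_mulg cK (@compact_set1 _ s^-1%g))); split=> [t|t nK].
  apply: (@continuous_comp _ _ _ (fun t => (t * s)%g)); last exact: CF.1.
  by apply: cvg_mulg; [exact: cont_id|exact: cont_cst].
by apply: CF.2 => Kt; apply: nK; exists ((t * s)%g, s^-1%g) => //=; rewrite mulgK.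
Qed.

Lemma Cc_inv (V : completeNormedModType R[i]) (F : G -> V) :
  Cc F -> Cc (fun t => F (t^-1)%g).
Proof.
move=> /(Ck_ex hausdorffG)[K cK CF].
apply: (CkC (compact_invg cK)); split=> [t|t nK].
  by apply: (@continuous_comp _ _ _ (fun t => t^-1%g)); [exact: invg_continuous|exact: CF.1].
by apply: CF.2 => Kt; apply: nK; exists (t^-1)%g => //=; rewrite invgK.
Qed.

(** Integrate [phi s *: g (s^-1 t)] over [s] and [t]: integrating over [t]
    first gives the left-hand side, while substituting [t s] for [s] in the
    other order and exchanging once more gives the right-hand side. Varying
    [phi] and [g] produces the modular function and the inversion formula at
    once. *)
Lemma bochner_scale_rtranslate (V : completeNormedModType R[i]) (phi : G -> Cplx R)
    (g : G -> V) : Cc phi -> Cc g ->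
  (I phi : R[i]) *: I g =
  I (fun s => (I (fun t => phi (t * s)%g) : R[i]) *: g (s^-1)%g).
Proof.
move=> cphi cg.
have [K cK Cp] := Ck_ex hausdorffG cphi; have [L cL Cg] := Ck_ex hausdorffG cg.
have Zr (a : R[i]) (F : G -> V) : Cc F -> I (fun s => a *: F s) = a *: I F.
  by move=> cF; exact: (bochnerZ hausdorffG muK a cF).1.
have Zl (F : G -> Cplx R) (v : V) : Cc F ->
    I (fun s => (F s : R[i]) *: v) = (I F : R[i]) *: v.
  move=> cF; apply: (bochner_comm hausdorffG muK (T := fun z : Cplx R => (z : R[i]) *: v)
     _ _ _ cF).1.
  - by move=> x y; exact: scalerDl.
  - by move=> r x; rewrite scalerA.
  - move=> x; apply: (@cvgZC R V (Cplx R) (nbhs x) _ (fun z => z) (fun=> v)).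
      exact: cvg_id.
    exact: cvg_cst.
have c1 : continuous (fun x : G * G => (phi x.1 : R[i]) *: g (x.1^-1 * x.2)%g).
  move=> x; apply: cvgZC.
    by apply: (@continuous_comp _ _ _ fst phi); [exact: cvg_fst|exact: Cp.1].
  apply: (@continuous_comp _ _ _ (fun x : G * G => (x.1^-1 * x.2)%g) g); last exact: Cg.1.
  by apply: cvg_mulg; [apply: cvg_invg; exact: cvg_fst|exact: cvg_snd].
have f1 := fubini hausdorffG haar_mu c1 cK (compact_mulg cK cL).
have c2 : continuous (fun x : G * G => (phi (x.2 * x.1)%g : R[i]) *: g (x.1^-1)%g).
  move=> x; apply: cvgZC.
    apply: (@continuous_comp _ _ _ (fun x : G * G => (x.2 * x.1)%g) phi); last exact: Cp.1.
    by apply: cvg_mulg; [exact: cvg_snd|exact: cvg_fst].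
  apply: (@continuous_comp _ _ _ (fun x : G * G => (x.1^-1)%g) g); last exact: Cg.1.
  by apply: cvg_invg; exact: cvg_fst.
have f2 := fubini hausdorffG haar_mu c2 (compact_invg cL) (compact_mulg cK cL).
rewrite (_ : (fun s => _ *: g s^-1%g) =
  fun s => I (fun t => (phi (t * s)%g : R[i]) *: g (s^-1)%g)); last first.
  apply/funext => s.
  exact: (esym (Zl (fun t => phi (t * s)%g) (g (s^-1)%g) (Cc_rtranslate s cphi))).
rewrite -f2 /=; last first.
  move=> s t nst; have [Ls|nL] := pselect (L (s^-1)%g); last first.
    by rewrite (Cg.2 _ nL); exact: scaler0.
  have [Kts|nK] := pselect (K (t * s)%g); last by rewrite (Cp.2 _ nK); exact: scale0r.
  case: nst => nst; case: nst; first by exists (s^-1)%g; rewrite ?invgK.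
  by exists ((t * s)%g, (s^-1)%g); [split|rewrite /= mulgK].
rewrite -(Zl phi (I g) cphi).
rewrite (_ : (fun s => (phi s : R[i]) *: I g) =
   fun s => I (fun t => (phi s : R[i]) *: g (s^-1 * t)%g)); last first.
  apply/funext => s; have [E C] := bochner_translate hausdorffG haar_mu (s^-1)%g cg.
  by rewrite -E; exact: (esym (Zr (phi s : R[i]) (fun t => g (s^-1 * t)%g) C)).
rewrite -f1 /=; last first.
  move=> s t nst; have [Ks|nK] := pselect (K s); last first.
    by rewrite (Cp.2 _ nK); exact: scale0r.
  have [Ls|nL] := pselect (L (s^-1 * t)%g); last by rewrite (Cg.2 _ nL); exact: scaler0.
  case: nst => nst; case: nst; first by [].
  by exists (s, (s^-1 * t)%g); [split|rewrite /= mulVKg].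
congr bochner_integral; apply/funext => t.
have cF : Cc (fun s => (phi s : R[i]) *: g (s^-1 * t)%g).
  apply: (Cc_rmul cphi (F := fun s => g (s^-1 * t)%g)) => s.
  apply: (@continuous_comp _ _ _ (fun s => (s^-1 * t)%g) g); last exact: Cg.1.
  by apply: cvg_mulg; [apply: cvg_invg; exact: cont_id|exact: cont_cst].
rewrite -(bochner_translate hausdorffG haar_mu t cF).1; congr bochner_integral.
by apply/funext => s; rewrite invgM -mulgA mulVg mulg1.
Qed.

Lemma bochner_rtranslate_continuous (F : G -> Cplx R) : Cc F ->
  continuous (fun s : G => I (fun t => F (t * s)%g)).
Proof.
move=> cF; have [K cK CF] := Ck_ex hausdorffG cF.
move=> s; have [N sN cN] := compact_nbhs s.
have cM := compact_mulg cK (compact_invg cN).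
set M := (X in compact X) in cM.
have ch : continuous (fun x : G * G => F (x.2 * x.1)%g).
  move=> x; apply: (@continuous_comp _ _ _ (fun x : G * G => (x.2 * x.1)%g) F).
    by apply: cvg_mulg; [exact: cvg_snd|exact: cvg_fst].
  exact: CF.1.
have hn : \forall s' \near s, forall t, ~ M t -> F (t * s')%g = 0.
  apply: filterS sN => s' Ns' t nM; apply: CF.2 => Kt; apply: nM.
  by exists ((t * s')%g, (s'^-1)%g); [split => //; exists s'|rewrite /= mulgK].
exact: (L1_bounded_family hausdorffG muK (L1_bounded_integral hausdorffG muK (Cplx R)) ch cM hn).
Qed.

Lemma rnorm_conj (z : R[i]) : rnorm (Num.conj z : Cplx R) = rnorm (z : Cplx R).
Proof. by congr complex.Re; exact: norm_conjC. Qed.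

Lemma conjC_cont : continuous (fun z : Cplx R => Num.conj (z : R[i]) : Cplx R).
Proof.
move=> z; apply/rcontP => e e0; have := near_rnorm z e0; apply: filterS => w.
by have := rnorm_conj ((z : R[i]) - (w : R[i])); rewrite rmorphB => ->.
Qed.

(** Test with [g] the conjugate of [e] multiplied by a bump function at [s0].
    *)
Lemma bochner_separating (e : G -> Cplx R) : continuous e ->
  (forall g : G -> Cplx R, Cc g -> I (fun s => (g s : R[i]) *: e s) = 0) ->
  forall s, e s = 0.
Proof.
move=> ce H s0.
have [k ck [k0 k1]] := bump_exists.
have [_ Ckc] := bochner_real hausdorffG muK ck.
have [_ Ck'] := bochner_translate hausdorffG haar_mu (s0^-1)%g Ckc.
have cce : continuous (fun s => Num.conj (e s : R[i]) : Cplx R).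
  by move=> s; apply: (@continuous_comp _ _ _ e); [exact: ce|exact: conjC_cont].
have Cg := Cc_rmul Ck' cce.
pose h s : R^o := k (s0^-1 * s)%g * rnorm (e s) ^+ 2.
have hE : (fun s => ((k (s0^-1 * s)%g)%:C *: Num.conj (e s : R[i]) : R[i]) *: e s) =
    fun s => (h s)%:C : Cplx R.
  apply/funext => s; rewrite /h rmorphM rmorphXn /= -normE.
  rewrite -[LHS]/((k (s0^-1 * s)%g)%:C * Num.conj (e s : R[i]) * (e s : R[i])).
  by rewrite -mulrA (mulrC (Num.conj _)) -normCK.
have ch : Cc h.
  apply: Cc_realC; last by rewrite -hE; exact: (Cc_rmul Cg ce).
  move=> s; apply: (@cvgM R).
    apply: (@continuous_comp _ _ _ (fun s => (s0^-1 * s)%g)); last exact: ck.1.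
    exact: mulgl_continuous.
  apply: (@cvgM R); exact: (rnorm_cvg (ce s)).
have := H _ Cg; rewrite hE.
have [E _] := bochner_real hausdorffG muK ch.
rewrite E -[0]/(0%:C) => /complexI h00.
apply/rnorm_eq0/eqP/negPn/negP => en0.
have : 0 < (\int[mu]_s h s)%R; last by rewrite h00 ltxx.
apply: (Rintegral_gt0 (s0 := s0) ch) => [s|].
  by rewrite mulr_ge0// sqr_ge0.
by rewrite /h mulVg mulr_gt0// exprn_gt0// lt_neqAle eq_sym en0 rnorm_ge0.
Qed.

(** [delta s] is the factor by which right translation by [s] multiplies the
    integral of a fixed bump function [k]. Taking [phi = k] in
    [bochner_scale_rtranslate] gives the inversion formula; comparing [phi =
    k] with an arbitrary [phi = F] shows that right translation multiplies the
    integral of [F] by the same factor, because the two sides agree when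
    tested against all [g]. *)
Lemma rtranslate_factor_exists : exists delta : G -> R,
  [/\ forall s, 0 < delta s,
      continuous (fun s => (delta s)%:C : Cplx R),
      forall (F : G -> Cplx R) s, Cc F ->
        I (fun t => F (t * s)%g) = (delta s)%:C *: I F
    & forall (V : completeNormedModType R[i]) (g : G -> V), Cc g ->
        I g = I (fun s => (delta s)%:C *: g (s^-1)%g)].
Proof.
have [k ck [k0 k1]] := bump_exists.
have [Ek Ckc] := bochner_real hausdorffG muK ck.
have kp : 0 < (\int[mu]_s k s)%R := Rintegral_gt0 ck k0 k1.
set m := (\int[mu]_s k s)%R in Ek kp.
have ckr s : Cc (fun t => k (t * s)%g : R^o).
  apply: Cc_realC; last exact: (Cc_rtranslate s Ckc).
  move=> t; apply: (@continuous_comp _ _ _ (fun t => (t * s)%g)); last exact: ck.1.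
  by apply: cvg_mulg; [exact: cont_id|exact: cont_cst].
pose delta s := m^-1 * (\int[mu]_t k (t * s)%g)%R.
have dE s : I (fun t => (k (t * s)%g)%:C : Cplx R) = (delta s * m)%:C.
  by rewrite (bochner_real hausdorffG muK (ckr s)).1 /delta mulrAC mulVf ?mul1r// gt_eqF.
have d1 : delta 1%g = 1.
  rewrite /delta (_ : (fun t => _) = k) ?mulVf// ?gt_eqF//.
  by apply/funext => t; rewrite mulg1.
have dc : continuous (fun s => (delta s)%:C : Cplx R).
  have -> : (fun s => (delta s)%:C : Cplx R) =
      fun s => (m^-1)%:C *: I (fun t => (k (t * s)%g)%:C : Cplx R).
    apply/funext => s; rewrite dE.
    transitivity ((m^-1 * (delta s * m))%:C : Cplx R); last exact: rmorphM.
    by rewrite mulrCA mulVf ?mulr1// gt_eqF.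
  move=> s; apply: (@cvgZC R (Cplx R)); first exact: cvg_cst.
  exact: bochner_rtranslate_continuous Ckc s.
have inv (V : completeNormedModType R[i]) (g : G -> V) : Cc g ->
        I g = I (fun s => (delta s)%:C *: g (s^-1)%g).
  move=> cg; have := bochner_scale_rtranslate Ckc cg.
  rewrite Ek (_ : (fun s => _) =
    fun s => m%:C *: ((delta s)%:C *: g (s^-1)%g)); last first.
    by apply/funext => s; rewrite dE scalerA mulrC rmorphM.
  rewrite (bochnerZ hausdorffG muK _ (Cc_lmul dc (Cc_inv cg))).1.
  by apply: scalerI; rewrite -[0]/(0%:C) (inj_eq (@complexI R)) gt_eqF.
have ringE (x a d b : R[i]) : x * (a - d * b) = a * x + (- b) * (d * x) by ring.
have rt (F : G -> Cplx R) s : Cc F -> I (fun t => F (t * s)%g) = (delta s)%:C *: I F.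
  move=> cF; apply/eqP; rewrite -subr_eq0; apply/eqP.
  have := @bochner_separating
    (fun s => I (fun t => F (t * s)%g) - (delta s)%:C *: I F).
  apply=> [s'|g cg].
    apply: cvgB; first exact: bochner_rtranslate_continuous.
    by apply: (@cvgZC R (Cplx R)); [exact: dc|exact: cvg_cst].
  have cgi := Cc_inv cg.
  have ki := bochner_scale_rtranslate cF cgi.
  have ii := inv _ _ cgi.
  rewrite (_ : (fun s => _ *: g (s^-1^-1)%g) =
    fun s => (I (fun t => F (t * s)%g) : R[i]) *: g s) in ki; last first.
    by apply/funext => t; rewrite invgK.
  rewrite (_ : (fun s => _ *: g (s^-1^-1)%g) = fun s => (delta s)%:C *: g s) in ii;
    last by apply/funext => t; rewrite invgK.
  have c1 : Cc (fun s => (I (fun t => F (t * s)%g) : R[i]) *: g s).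
    exact: (Cc_lmul (bochner_rtranslate_continuous cF) cg).
  have c2 : Cc (fun s => (delta s)%:C *: g s) by exact: Cc_lmul.
  have [E3 c3] := bochnerZ hausdorffG muK (- I F : R[i]) c2.
  rewrite (_ : (fun s => _) = fun s => (I (fun t => F (t * s)%g) : R[i]) *: g s +
    (- I F : R[i]) *: ((delta s)%:C *: g s)); last first.
    apply/funext => s'; exact: ringE.
  rewrite (bochnerD hausdorffG muK c1 c3).1 E3.
  by rewrite -ki -ii scaleNr subrr.
exists delta; split=> // s.
have d0 t : 0 <= delta t.
  apply: mulr_ge0; first by rewrite invr_ge0 ltW.
  by apply: Rintegral_ge0 => x _; exact: k0.
(* If [delta s] vanished, translating back by [s^-1] would give [k] integral
   0. *)
rewrite lt_neqAle d0 andbT; apply/eqP => ds.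
have := rt _ (s^-1)%g (Cc_rtranslate s Ckc).
rewrite (_ : (fun t => _) = fun t => (k t)%:C : Cplx R); last first.
  by apply/funext => t; rewrite mulgVK.
rewrite dE -ds mul0r scaler0 Ek -[0]/(0%:C) => /complexI mm.
by rewrite mm ltxx in kp.
Qed.

(** The inverse of the factor [delta] of [rtranslate_factor_exists] is the
    only number satisfying the normalisation of [modular], and [delta] is
    multiplicative. *)
Lemma modular_facts :
  [/\ forall s, 0 < modular mu s,
      continuous (fun s => (modular mu s^-1%g)%:C : Cplx R),
      forall (F : G -> Cplx R) s, Cc F ->
        I (fun t => F (t * s)%g) = (modular mu s^-1%g)%:C *: I F,
      forall (V : completeNormedModType R[i]) (g : G -> V), Cc g ->
        I g = I (fun s => (modular mu s^-1%g)%:C *: g (s^-1)%g)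
    & forall s t, modular mu (s * t)^-1%g = modular mu s^-1%g * modular mu t^-1%g].
Proof.
have [delta [d0 dc rt inv]] := rtranslate_factor_exists.
have [k ck [k0 k1]] := bump_exists.
have [Ek Ckc] := bochner_real hausdorffG muK ck.
have kp : 0 < (\int[mu]_s k s)%R := Rintegral_gt0 ck k0 k1.
have rtR (h : G -> R^o) t : Cc h ->
    (\int[mu]_s h (s * t)%g)%R = delta t * (\int[mu]_s h s)%R.
  move=> ch; have [Eh Ch] := bochner_real hausdorffG muK ch.
  have cht : Cc (fun s => h (s * t)%g : R^o).
    apply: Cc_realC; last exact: (Cc_rtranslate t Ch).
    move=> s; apply: (@continuous_comp _ _ _ (fun s => (s * t)%g)); last exact: ch.1.
    by apply: cvg_mulg; [exact: cont_id|exact: cont_cst].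
  have := rt _ t Ch; rewrite Eh (bochner_real hausdorffG muK cht).1 => e.
  apply: (@complexI R); rewrite rmorphM; exact: e.
have mE t : modular mu t = (delta t)^-1.
  pose S := [set c : R | 0 < c /\ forall h : G -> R^o, Cc h ->
    c * (\int[mu]_s h (s * t)%g)%R = (\int[mu]_s h s)%R].
  have Sd : S (delta t)^-1.
    split; first by rewrite invr_gt0.
    by move=> h ch; rewrite rtR// mulKf// gt_eqF.
  have [m0 /(_ _ ck)] : S (modular mu t) := @xgetPex _ 1 S (ex_intro _ _ Sd).
  rewrite rtR// mulrA => /(canRL (mulfK (lt0r_neq0 kp))); rewrite divff ?lt0r_neq0//.
  by move=> /(canRL (mulfK (lt0r_neq0 (d0 t)))); rewrite mul1r.
have dM s t : delta (s * t)%g = delta s * delta t.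
  have := rt _ (s * t)%g Ckc.
  have -> : (fun x : G => (k (x * (s * t))%g)%:C : Cplx R) =
      fun x => (fun x => (k (x * t)%g)%:C : Cplx R) (x * s)%g.
    by apply/funext => x; rewrite mulgA.
  rewrite (rt _ s (Cc_rtranslate t Ckc)) (rt _ t Ckc) Ek => h.
  have {}h : ((delta s)%:C * ((delta t)%:C * (\int[mu]_s k s)%R%:C) =
     (delta (s * t)%g)%:C * (\int[mu]_s k s)%R%:C)%R by exact: h.
  move: h; rewrite -!rmorphM => /complexI h.
  by apply: (mulIf (lt0r_neq0 kp)); rewrite -h mulrA.
have d1 : delta 1%g = 1.
  have := dM 1%g 1%g; rewrite mulg1 => h; apply: (mulfI (lt0r_neq0 (d0 1%g))).
  by rewrite -h mulr1.
have miE s : modular mu s^-1%g = delta s.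
  rewrite mE; have : delta s * delta s^-1%g = 1 by rewrite -dM mulgV.
  by move/(canRL (mulfK (lt0r_neq0 (d0 s^-1%g)))); rewrite mul1r.
split.
- by move=> s; rewrite mE invr_gt0.
- by rewrite (_ : (fun s => _) = fun s => (delta s)%:C : Cplx R)//;
    apply/funext => s; rewrite miE.
- by move=> F s cF; rewrite miE rt.
- move=> V g cg; rewrite (inv _ _ cg); congr bochner_integral.
  by apply/funext => s; rewrite miE.
- by move=> s t; rewrite !miE.
Qed.
End Modular.

(** * Hilbert spaces *)

Section Hilbert.
Variable R : realType.

(** Phrased in terms of the coefficients of a positive quadratic form, to
    serve also for the possibly degenerate form of a kernel. Taking [c = z /
    (b + d)] with small [d > 0] avoids a case distinction on [b = 0]. *)
Lemma cauchy_schwarz_abstract (a b : R) (z : R[i]) : 0 <= a -> 0 <= b ->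
  (forall c : R[i], 0 <= a%:C - Num.conj c * z - c * Num.conj z + c * Num.conj c * b%:C) ->
  rnorm (z : Cplx R) ^+ 2 <= a * b.
Proof.
move=> a0 b0 H; set n := rnorm (z : Cplx R).
have n0 : 0 <= n ^+ 2 by rewrite sqr_ge0.
have zz : z * Num.conj z = (n ^+ 2)%:C.
  by rewrite -normCK rmorphXn; congr (_ ^+ 2); exact: (normE (z : Cplx R)).
apply/ler_addgt0Pr => e e0.
pose d := e / (a + 1).
have d0 : 0 < d by rewrite divr_gt0//; lra.
pose t := (b + d)^-1.
have bd : 0 < b + d by lra.
have t0 : 0 < t by rewrite invr_gt0.
have := H (t%:C * z).
have -> : a%:C - Num.conj (t%:C * z) * z - t%:C * z * Num.conj z +
   t%:C * z * Num.conj (t%:C * z) * b%:C =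
   (a - 2 * t * n ^+ 2 + t ^+ 2 * n ^+ 2 * b)%:C.
  have -> : Num.conj (t%:C * z) = t%:C * Num.conj z.
    by rewrite rmorphM; congr (_ * _); exact: conj_real.
  transitivity (a%:C - 2 * t%:C * (z * Num.conj z) + t%:C ^+ 2 * (z * Num.conj z) * b%:C).
    by ring.
  rewrite zz; have -> : (2 : R[i]) = 2%:C by rewrite rmorph_nat.
  by rewrite -rmorphXn -!rmorphM -rmorphB -rmorphD.
rewrite -[0]/(0%:C) lecR => h.
have tb : t * b <= 1 by rewrite /t mulrC ler_pdivrMr//; lra.
have h2 : t * n ^+ 2 * (t * b) <= t * n ^+ 2 * 1 by rewrite ler_wpM2l// mulr_ge0// ltW.
have h3 : t * n ^+ 2 <= a.
  have -> : t * n ^+ 2 = 2 * t * n ^+ 2 - t * n ^+ 2 * 1 by ring.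
  have : t ^+ 2 * n ^+ 2 * b = t * n ^+ 2 * (t * b) by ring.
  by move: h h2; lra.
have h4 : n ^+ 2 <= a * (b + d).
  by move: h3; rewrite /t mulrC ler_pdivrMr.
have : a * d <= e.
  by rewrite /d mulrA ler_pdivrMr; [rewrite mulrC ler_wpM2l//; lra|lra].
by move: h4; rewrite mulrDr; lra.
Qed.

Variable H : hilbertType R.
Implicit Types x y z : H.

Lemma innerC x y : inner H y x = Num.conj (inner H x y).
Proof. by rewrite hermC expr0 mul1r. Qed.

Lemma innerDl x y z : inner H (x + y) z = inner H x z + inner H y z.
Proof. exact: linearDl. Qed.

Lemma innerZl (c : R[i]) x z : inner H (c *: x) z = c * inner H x z.
Proof. exact: linearZl_LR. Qed.

Lemma innerDr x y z : inner H x (y + z) = inner H x y + inner H x z.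
Proof. exact: linearDr. Qed.

Lemma innerZr (c : R[i]) x z : inner H x (c *: z) = Num.conj c * inner H x z.
Proof. exact: linearZr_LR. Qed.

Lemma innerNl x y : inner H (- x) y = - inner H x y.
Proof. exact: linearNl. Qed.

Lemma innerNr x y : inner H x (- y) = - inner H x y.
Proof. exact: linearNr. Qed.

Lemma inner0l x : inner H 0 x = 0.
Proof. by rewrite -(scale0r x) innerZl mul0r. Qed.

Lemma inner0r x : inner H x 0 = 0.
Proof. by rewrite -(scale0r x) innerZr rmorph0 mul0r. Qed.

Lemma inner_self x : inner H x x = (rnorm x ^+ 2)%:C.
Proof. by rewrite inner_norm normE rmorphXn. Qed.

Lemma inner_CS x y : rnorm (inner H x y : Cplx R) <= rnorm x * rnorm y.
Proof.
have := @cauchy_schwarz_abstract (rnorm x ^+ 2) (rnorm y ^+ 2) (inner H x y)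
  (sqr_ge0 _) (sqr_ge0 _) _.
rewrite -exprMn => h; rewrite -ler_sqr ?nnegrE ?mulr_ge0 ?rnorm_ge0//; apply: h => c.
have -> : (rnorm x ^+ 2)%:C - Num.conj c * inner H x y - c * Num.conj (inner H x y) +
   c * Num.conj c * (rnorm y ^+ 2)%:C = inner H (x - c *: y) (x - c *: y).
  rewrite -!inner_self -innerC innerDl !innerDr !innerNl !innerNr !innerZl !innerZr.
  by ring.
by rewrite inner_self -[0]/(0%:C) lecR sqr_ge0.
Qed.

Lemma cvg_inner (T : Type) (F : set_system T) {FF : Filter F} (f g : T -> H) x y :
  f @ F --> x -> g @ F --> y ->
  (fun t => inner H (f t) (g t) : Cplx R) @ F --> (inner H x y : Cplx R).
Proof.
apply: (@cvg_bilinear R H H (Cplx R) (inner H)) => [u v w|u v w|].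
- by rewrite innerDl innerNl.
- by rewrite innerDr innerNr.
- exact: inner_CS.
Qed.

Lemma inner_eq x y : (forall z, inner H x z = inner H y z) -> x = y.
Proof.
move=> h; apply/eqP; rewrite -subr_eq0; apply/eqP; apply: rnorm_eq0.
have := inner_self (x - y); rewrite innerDl innerNl h subrr -[0]/(0%:C) => /complexI.
by move=> /esym/eqP; rewrite sqrf_eq0 => /eqP.
Qed.

End Hilbert.

(** * The convolution algebra *)

Section Action.
Variables (R : realType) (G : topGroupType).
Hypothesis hausdorffG : hausdorff_space G.
Hypothesis lcG : locally_compact [set: G].
Variable mu : {measure set (borel G) -> \bar R}.
Hypothesis haar_mu : left_haar_measure mu.
Variable A : gcstarAlgType R G.
Implicit Types (a b : A) (s t : G) (f g h : G -> A) (K L : set G).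
Local Notation I := (bochner_integral mu).
Let muK := mu_compact haar_mu.
Let CkC := @CkCc R G hausdorffG.

Lemma gact_linear s : linear (@gact R G A s).
Proof. by move=> c a b; rewrite gactD gactZ. Qed.

HB.instance Definition _ s := GRing.isLinear.Build R[i] A A *:%R (@gact R G A s)
  (gact_linear s).

(** Both [gact s] and its inverse are contractive. *)
Lemma gact_rnorm s a : rnorm (gact s a) = rnorm a.
Proof.
have le t b : rnorm (gact t b) <= rnorm b.
  apply: (@star_hom_rnorm R A A (@gact R G A t : {linear A -> A})).
  by split=> *; [exact: gact_cmul|exact: gact_cstar].
apply/eqP; rewrite eq_le le /=.
by have := le s^-1%g (gact s a); rewrite -gactM mulVg gact1.
Qed.

Lemma gact0 s : gact s (0 : A) = 0.
Proof. exact: raddf0. Qed.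

Lemma gactB s a b : gact s (a - b) = gact s a - gact s b.
Proof. exact: raddfB. Qed.

Lemma cvg_gact (T : Type) (F : set_system T) {FF : Filter F} (u : T -> G)
    (v : T -> A) s a :
  u @ F --> s -> v @ F --> a -> (fun x => gact (u x) (v x)) @ F --> gact s a.
Proof.
move=> us /rcvgP va; apply/rcvgP => e e0; have e2 : 0 < e / 2 by lra.
have /rcvgP ua : (fun x => gact (u x) a) @ F --> gact s a.
  exact: (@cvg_comp _ _ _ u (fun x => gact x a) F (nbhs s) _ us (@gact_continuous R G A a s)).
move: (va _ e2) (ua _ e2); apply: filterS2 => t h1 h2.
rewrite (le_lt_trans (rnorm_dist _ (gact (u t) a) _))//.
by rewrite -gactB gact_rnorm; lra.
Qed.

(** [lact a h] and [tact t h] are the products [a h] and [u_t h] with the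
    canonical multipliers of the crossed product. *)
Definition lact a h : G -> A := fun r => cmul a (h r).
Definition tact t h : G -> A := fun r => gact t (h (t^-1 * r)%g).

Lemma cmul_cont a : continuous (fun b => cmul a b).
Proof. by move=> b; exact: (cvg_cmul (cvg_cst a) (@cvg_id _ (nbhs b))). Qed.

Lemma gact_cont s : continuous (@gact R G A s).
Proof. by move=> a; exact: (cvg_gact (cvg_cst s) (@cvg_id _ (nbhs a))). Qed.

Lemma Cc_lact a h : Cc h -> Cc (lact a h).
Proof.
move=> ch; apply: (bochner_comm hausdorffG muK (T := fun b => cmul a b) _ _ _ ch).2.
- by move=> x y; exact: cmulDr.
- by move=> r x; exact: cmulZr.
- exact: cmul_cont.
Qed.

Lemma Cc_tact t h : Cc h -> Cc (tact t h).
Proof.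
move=> ch; have [_ ch'] := bochner_translate hausdorffG haar_mu (t^-1)%g ch.
apply: (bochner_comm hausdorffG muK (T := @gact R G A t) _ _ _ ch').2.
- exact: gactD.
- by move=> r x; exact: gactZ.
- exact: gact_cont.
Qed.

Lemma Cc_involution f : Cc f -> Cc (involution mu f).
Proof.
move=> cf; have [_ mc _ _ _] := modular_facts hausdorffG lcG haar_mu.
apply: (Cc_lmul hausdorffG mc).
have [K cK Cf] := Ck_ex hausdorffG (Cc_inv hausdorffG cf).
apply: (CkC cK); split=> [s|s nK]; last by rewrite (Cf.2 _ nK) cstar0 gact0.
by apply: cvg_gact; [exact: cvg_id|apply: cvg_cstar; exact: Cf.1].
Qed.

Lemma cvg_translate (V : topologicalType) (T : topologicalType) (u v : T -> G)
    (F : G -> V) (x : T) : {for x, continuous u} -> {for x, continuous v} ->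
  continuous F -> {for x, continuous (fun y => F ((u y)^-1 * v y)%g)}.
Proof.
move=> cu cv cF; apply: (@continuous_comp _ _ _ (fun y => ((u y)^-1 * v y)%g) F).
  by apply: cvg_mulg; [exact: cvg_invg|].
exact: cF.
Qed.

(** Joint continuity and compact support of the integrand of [convolution] are
    what [L1_bounded_bochner] and [fubini] require. *)
Lemma convolution_family f h : Cc f -> Cc h ->
  exists K L, [/\ compact K, compact L,
    continuous (fun x : G * G => cmul (f x.1) (gact x.1 (h (x.1^-1 * x.2)%g))) &
    forall t r, ~ K t \/ ~ L r -> cmul (f t) (gact t (h (t^-1 * r)%g)) = 0].
Proof.
move=> /(Ck_ex hausdorffG)[K cK Cf] /(Ck_ex hausdorffG)[L cL Ch].
exists K, [set (x.1 * x.2)%g | x in K `*` L]; split=> //.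
- exact: compact_mulg.
- move=> x; apply: cvg_cmul.
    by apply: (@continuous_comp _ _ _ fst f); [exact: cvg_fst|exact: Cf.1].
  apply: cvg_gact; first exact: cvg_fst.
  by apply: (cvg_translate _ _ Ch.1); [exact: cvg_fst|exact: cvg_snd].
- move=> t r [nK|nKL]; first by rewrite (Cf.2 _ nK) cmul0r.
  have [Kt|nK] := pselect (K t); last by rewrite (Cf.2 _ nK) cmul0r.
  have -> : h (t^-1 * r)%g = 0.
    apply: Ch.2 => Lr; apply: nKL; exists (t, (t^-1 * r)%g); first by split.
    by rewrite /= mulVKg.
  by rewrite gact0 cmulr0.
Qed.

(** The convolution of [f] and [h] is the integral over [t] of the functions
    [lact (f t) (tact t h)], and [Lam] can be taken under the integral. *)
Lemma L1_bounded_convolution (W : completeNormedModType R[i]) (Lam : (G -> A) -> W) (c : R) f h :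
  L1_bounded mu Lam c -> Cc f -> Cc h ->
  [/\ Lam (convolution mu f h) = I (fun t => Lam (lact (f t) (tact t h))),
      Cc (fun t => Lam (lact (f t) (tact t h))) & Cc (convolution mu f h)].
Proof.
move=> LamL1 cf ch; have [K [L [cK cL cont supp]]] := convolution_family cf ch.
split.
- exact: (L1_bounded_bochner hausdorffG muK cont cK cL supp LamL1).
- exact: (CkC cK (Ck_L1_bounded hausdorffG muK cont cL supp LamL1)).
- exact: (CkC cL (Ck_bochner hausdorffG muK cont cK supp)).
Qed.

(** * Representations of the convolution algebra *)

Section Rep.
Variables (H : hilbertType R) (rho : (G -> A) -> H -> H).
Hypothesis rep : star_representation mu rho.
Implicit Types (c d : A) (x y z : H).

Lemma rho_lin y (k : R[i]) f g : Cc f -> Cc g ->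
  rho (fun s => k *: f s + g s) y = k *: rho f y + rho g y.
Proof. by case: rep => _ h _ _ cf cg; exact: (h k f g cf cg y). Qed.

Lemma rho_le y f : Cc f -> rnorm (rho f y) <= rnorm y * N1 mu f.
Proof.
case: rep => h _ _ _ cf; have [_ /(_ y)] := h f cf.
by rewrite !normE -rmorphM lecR mulrC.
Qed.

Lemma rho_L1_bounded y : L1_bounded mu (fun f => rho f y) (rnorm y).
Proof.
split; [exact: rnorm_ge0|by move=> k f g; exact: rho_lin|by move=> f; exact: rho_le].
Qed.

Lemma rho_linear f (k : R[i]) x y : Cc f -> rho f (k *: x + y) = k *: rho f x + rho f y.
Proof. by case: rep => h _ _ _ cf; have [hl _] := h f cf; exact: hl. Qed.

Lemma rho_conv y f h : Cc f -> Cc h ->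
  [/\ rho f (rho h y) = I (fun t => rho (lact (f t) (tact t h)) y),
      Cc (fun t => rho (lact (f t) (tact t h)) y) & Cc (convolution mu f h)].
Proof.
move=> cf ch.
have [E C1 C2] := L1_bounded_convolution (rho_L1_bounded y) cf ch.
by split=> //; case: rep => _ _ hc _; rewrite -hc.
Qed.

Lemma rho_adj f x y : Cc f -> inner H (rho f x) y = inner H x (rho (involution mu f) y).
Proof. by case: rep => _ _ _ h cf; exact: h. Qed.

Lemma rho_adjr f x y : Cc f -> inner H x (rho f y) = inner H (rho (involution mu f) x) y.
Proof. by move=> cf; rewrite innerC rho_adj// -innerC. Qed.

Lemma inner_bochner (V : hilbertType R) (F : G -> V) (z : V) : Cc F ->
  I (fun t => inner V (F t) z : Cplx R) = inner V (I F) z /\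
  Cc (fun t => inner V (F t) z : Cplx R).
Proof.
move=> cF; apply: (bochner_comm hausdorffG muK (T := fun w => inner V w z : Cplx R)
  _ _ _ cF).
- by move=> u v; exact: innerDl.
- by move=> r u; exact: innerZl.
- by move=> w; apply: cvg_inner; [exact: cvg_id|exact: cvg_cst].
Qed.

Lemma lact_tact s t a h : tact t (lact a (tact s h)) =
  lact (gact t a) (tact (t * s)%g h).
Proof.
by apply/funext => r; rewrite /tact /lact gact_cmul -gactM invgM mulgA.
Qed.

Lemma tactM s t h : tact t (tact s h) = tact (t * s)%g h.
Proof. by apply/funext => r; rewrite /tact -gactM invgM mulgA. Qed.

Lemma rho_lact_lin y (k : R[i]) a b h : Cc h ->
  rho (lact (k *: a + b) h) y = k *: rho (lact a h) y + rho (lact b h) y.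
Proof.
move=> ch; rewrite -rho_lin; [|exact: (Cc_lact)..].
by congr (rho _ y); apply/funext => r; rewrite /lact cmulDl cmulZl.
Qed.

(** The convolutions of [(c h')^*] with [d h] and of [h'^*] with [c^* d h]
    have the same integrand. *)
Lemma rho_lact_adj c d h h' y y' : Cc h -> Cc h' ->
  inner H (rho (lact (cmul (cstar c) d) h) y) (rho h' y') =
  inner H (rho (lact d h) y) (rho (lact c h') y').
Proof.
move=> ch ch'; have cl a g : Cc g -> Cc (lact a g) by exact: (Cc_lact).
have ci g : Cc g -> Cc (involution mu g).
  exact: (Cc_involution).
have rc f g : Cc f -> Cc g -> rho f (rho g y) = rho (convolution mu f g) y.
  by move=> cf cg; case: rep => _ _ hc _; rewrite hc.
rewrite rho_adjr// [RHS]rho_adjr; last exact: cl.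
rewrite !rc; [|by [exact: ci|exact: cl|apply: ci; exact: cl]..].
suff -> : convolution mu (involution mu h') (lact (cmul (cstar c) d) h) =
  convolution mu (involution mu (lact c h')) (lact d h) by [].
apply/funext => s; rewrite /convolution; congr bochner_integral.
apply/funext => t; rewrite /involution /lact !cmulZl; congr (_ *: _).
by rewrite cstarM !gact_cmul !cmulA.
Qed.

(** The modular factor produced by the substitution of [t s] for [t] in the
    convolution integral is the one carried by the involution. *)
Lemma rho_tact_unitary s h h' y y' : Cc h -> Cc h' ->
  inner H (rho (tact s h) y) (rho (tact s h') y') = inner H (rho h y) (rho h' y').
Proof.
move=> ch ch'; have ct g : Cc g -> Cc (tact s g) by exact: (Cc_tact).
have ci g : Cc g -> Cc (involution mu g).
  exact: (Cc_involution).
have [m0 mc mr _ mM] := modular_facts hausdorffG lcG haar_mu.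
rewrite rho_adjr; last exact: ct.
rewrite [RHS]rho_adjr//.
have [E1 C1 _] := rho_conv y (ci _ (ct _ ch')) (ct _ ch).
have [E2 C2 _] := rho_conv y (ci _ ch') ch.
rewrite E1 E2.
have [<- C1'] := inner_bochner y' C1.
have [<- C2'] := inner_bochner y' C2.
have := mr _ s C2'.
have Q t : inner H (rho (lact (involution mu h' (t * s)%g) (tact (t * s)%g h)) y) y' =
   (modular mu s^-1%g)%:C *
   inner H (rho (lact (involution mu (tact s h') t) (tact t (tact s h))) y) y'.
  rewrite -innerZl tactM; congr (inner H _ y').
  have -> : involution mu h' (t * s)%g =
      (modular mu s^-1%g)%:C *: involution mu (tact s h') t + 0.
    rewrite addr0 /involution scalerA -rmorphM mulrC -mM; congr (_ *: _).
    by rewrite /tact -gact_cstar -gactM invgM.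
  have ch'' := Cc_tact (t * s)%g ch.
  rewrite rho_lact_lin//.
  have -> : rho (lact 0 (tact (t * s)%g h)) y = 0; last by rewrite addr0.
  have := rho_lact_lin y 1 0 0 ch''; rewrite scale1r addr0 scale1r => X0.
  by apply: (addrI (rho (lact 0 (tact (t * s)%g h)) y)); rewrite -X0 addr0.
rewrite (_ : (fun t => _) = fun t => (modular mu s^-1%g)%:C *:
  (inner H (rho (lact (involution mu (tact s h') t) (tact t (tact s h))) y) y' : Cplx R)).
  rewrite (bochnerZ hausdorffG muK _ C1').1 => e.
  have n0 : (modular mu s^-1%g)%:C != 0.
    by rewrite -[0]/(0%:C) (inj_eq (@complexI R)) gt_eqF.
  exact: (mulfI n0 e).
by apply/funext => t; exact: Q.
Qed.

Lemma rho_lact_tact_continuous y f : Cc f ->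
  continuous (fun p : A * G => rho (lact p.1 (tact p.2 f)) y).
Proof.
move=> cf; have [K cK Cf] := Ck_ex hausdorffG cf.
move=> [a t]; have [N tN cN] := compact_nbhs lcG t.
apply: (L1_bounded_family hausdorffG muK (rho_L1_bounded y)
  (h := fun p : (A * G) * G => cmul p.1.1 (gact p.1.2 (f (p.1.2^-1 * p.2)%g)))
  _ (compact_mulg cN cK)).
- move=> x.
  have c12 : {for x, continuous (fun p : (A * G) * G => p.1.2)}.
    by apply: (@continuous_comp _ _ _ fst snd); [exact: cvg_fst|exact: cvg_snd].
  apply: cvg_cmul.
    by apply: (@continuous_comp _ _ _ fst fst); exact: cvg_fst.
  apply: cvg_gact; first exact: c12.
  by apply: (cvg_translate c12 _ Cf.1); exact: cvg_snd.
- exists (setT, N) => //=; first by split => //; exact: filterT.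
  move=> [b u] /= [_ Nu] r nM.
  have -> : f (u^-1 * r)%g = 0.
    apply: Cf.2 => Kr; apply: nM; exists (u, (u^-1 * r)%g); first by split.
    by rewrite /= mulVKg.
  by rewrite gact0 cmulr0.
Qed.

Lemma rho_tact_continuous y f : Cc f -> continuous (fun t => rho (tact t f) y).
Proof.
move=> cf; have [K cK Cf] := Ck_ex hausdorffG cf.
move=> t; have [N tN cN] := compact_nbhs lcG t.
apply: (L1_bounded_family hausdorffG muK (rho_L1_bounded y)
  (h := fun p : G * G => gact p.1 (f (p.1^-1 * p.2)%g)) _ (compact_mulg cN cK)).
- move=> x; apply: cvg_gact; first exact: cvg_fst.
  by apply: (cvg_translate _ _ Cf.1); [exact: cvg_fst|exact: cvg_snd].
- apply: filterS tN => u Nu r nM.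
  have -> : f (u^-1 * r)%g = 0.
    apply: Cf.2 => Kr; apply: nM; exists (u, (u^-1 * r)%g); first by split.
    by rewrite /= mulVKg.
  by rewrite gact0.
Qed.

End Rep.
End Action.

(** * The Hilbert space of a positive kernel *)

(** Positivity is tested on formal linear combinations of points, given by
    lists of pairs. *)
Record posKernel (R : realType) (X : Type) := PosKernel {
  kfun :> X -> X -> R[i];
  kherm : forall x y, kfun y x = Num.conj (kfun x y);
  kpos : forall l : seq (R[i] * X),
    0 <= \sum_(p <- l) \sum_(q <- l) p.1 * Num.conj q.1 * kfun p.2 q.2
}.

Section PreHilbert.
Variables (R : realType) (X : Type) (k : posKernel R X).
Implicit Types (l m n : seq (R[i] * X)) (f g : X -> Cplx R) (c : R[i]).

(** The form defined by [k] on formal combinations is [kip]; [kvec l]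
    represents the combination [l] in the reproducing kernel space, and [kev
    f] extends a function [f] on [X] to combinations, conjugate-linearly like
    the second argument of [kip]. *)
Definition kev f m : Cplx R := \sum_(q <- m) Num.conj q.1 *: f q.2.
Definition kvec l : X -> Cplx R := fun x => \sum_(p <- l) p.1 * k p.2 x.
Definition kip l m : R[i] := kev (kvec l) m.
Definition kscale c l := [seq (c * p.1, p.2) | p <- l].
Definition knorm l : R := Num.sqrt (complex.Re (kip l l)).

Lemma kev_cat f l m : kev f (l ++ m) = kev f l + kev f m.
Proof. by rewrite /kev big_cat. Qed.

Lemma kev_scale f c l : kev f (kscale c l) = Num.conj c *: kev f l.
Proof.
rewrite /kev big_map scaler_sumr; apply: eq_bigr => p _ /=.
by rewrite rmorphM scalerA.
Qed.

Lemma kev_lin c f g m : kev (c *: f + g) m = c *: kev f m + kev g m.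
Proof.
rewrite /kev scaler_sumr -big_split /=; apply: eq_bigr => p _.
by rewrite -[(c *: f + g) _]/(c *: f _ + g _) scalerDr !scalerA mulrC.
Qed.

Lemma kev0 m : kev 0 m = 0.
Proof. by rewrite /kev big1// => p _; exact: scaler0. Qed.

Lemma kvec_cat l m : kvec (l ++ m) = kvec l + kvec m.
Proof. by apply/funext => x; rewrite /kvec big_cat. Qed.

Lemma kvec_scale c l : kvec (kscale c l) = c *: kvec l.
Proof.
apply/funext => x; rewrite -[RHS]/(c * kvec l x) /kvec big_map mulr_sumr.
by apply: eq_bigr => p _; rewrite mulrA.
Qed.

Lemma kipE l m : kip l m = \sum_(p <- l) \sum_(q <- m) p.1 * Num.conj q.1 * k p.2 q.2.
Proof.
rewrite exchange_big /=; apply: eq_bigr => q _.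
rewrite -[LHS]/(Num.conj q.1 * kvec l q.2) /kvec mulr_sumr; apply: eq_bigr => p _.
by rewrite mulrA (mulrC (Num.conj _)).
Qed.

Lemma kipC l m : kip m l = Num.conj (kip l m).
Proof.
rewrite !kipE exchange_big /= rmorph_sum; apply: eq_bigr => q _.
rewrite rmorph_sum; apply: eq_bigr => p _.
transitivity (Num.conj q.1 * p.1 * Num.conj (k q.2 p.2)).
  by rewrite -kherm (mulrC p.1).
by rewrite /= !rmorphM /= conjCK.
Qed.

Lemma kip_ge0 l : 0 <= kip l l. Proof. by rewrite kipE; exact: kpos. Qed.

Lemma knorm_ge0 l : 0 <= knorm l. Proof. exact: sqrtr_ge0. Qed.

Lemma knorm2 l : (knorm l ^+ 2)%:C = kip l l.
Proof.
have h := ge0_complexE (kip_ge0 l); rewrite [RHS]h sqr_sqrtr//.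
by have := kip_ge0 l; rewrite h -[0]/(0%:C) lecR.
Qed.

Lemma kip_CS l m : rnorm (kip l m : Cplx R) <= knorm l * knorm m.
Proof.
have := @cauchy_schwarz_abstract R (knorm l ^+ 2) (knorm m ^+ 2) (kip l m)
  (sqr_ge0 _) (sqr_ge0 _) _.
rewrite -exprMn => h; rewrite -ler_sqr ?nnegrE ?mulr_ge0 ?rnorm_ge0 ?knorm_ge0//.
apply: h => c.
have kD n : kev (kvec (l ++ kscale (- c) m)) n = (- c) *: kip m n + kip l n.
  by rewrite kvec_cat kvec_scale addrC kev_lin.
have E : kip (l ++ kscale (- c) m) (l ++ kscale (- c) m) =
   (- c * kip m l + kip l l) + Num.conj (- c) * (- c * kip m m + kip l m).
  by rewrite {1}/kip kev_cat kev_scale !kD.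
have -> : (knorm l ^+ 2)%:C - Num.conj c * kip l m - c * Num.conj (kip l m) +
   c * Num.conj c * (knorm m ^+ 2)%:C = kip (l ++ kscale (- c) m) (l ++ kscale (- c) m).
  rewrite !knorm2 -kipC E (rmorphN (@Num.conj R[i])) /=; ring.
exact: kip_ge0.
Qed.

(** The completion is realized as a space of functions on [X]: those that are
    limits of functions [kvec l] in the norm dual to [knorm]. *)
Definition kapprox f l (e : R) :=
  forall m, rnorm (kev f m - kip l m : Cplx R) <= e * knorm m.

Definition kclosure : {pred (X -> Cplx R)} :=
  fun f => `[< forall e : R, 0 < e -> exists l, kapprox f l e >].

Lemma kclosureP f :
  reflect (forall e : R, 0 < e -> exists l, kapprox f l e) (f \in kclosure).
Proof. exact: asboolP. Qed.

Lemma kapprox_lin c f g l m (d e : R) : kapprox f l d -> kapprox g m e ->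
  kapprox (c *: f + g) (kscale c l ++ m) (rnorm (c : Cplx R) * d + e).
Proof.
move=> hf hg n; rewrite kev_lin /kip kvec_cat kvec_scale kev_lin.
rewrite opprD addrACA -scalerBr (le_trans (rnormD _ _))// mulrDl lerD//.
by rewrite rnormZ -mulrA ler_wpM2l ?rnorm_ge0//; exact: hf.
Qed.

Lemma kclosure_submod : GRing.submod_closed kclosure.
Proof.
split.
  apply/kclosureP => e e0; exists [::] => m; rewrite kev0.
  have -> : kip [::] m = 0.
    by rewrite kipE big_nil.
  by rewrite subr0 rnorm0 mulr_ge0 ?knorm_ge0// ltW.
move=> c f g /kclosureP hf /kclosureP hg; apply/kclosureP => e e0.
pose d := e / (2 * (rnorm (c : Cplx R) + 1)).
have c0 := rnorm_ge0 (c : Cplx R).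
have d0 : 0 < d by rewrite divr_gt0//; lra.
have [l hl] := hf d d0; have [m hm] := hg (e / 2) ltac:(lra).
exists (kscale c l ++ m) => n.
apply: (le_trans (kapprox_lin c hl hm n)); rewrite ler_wpM2r ?knorm_ge0//.
have : rnorm (c : Cplx R) * d <= e / 2; last by lra.
rewrite /d mulrA ler_pdivrMr; last by lra.
have -> : e / 2 * (2 * (rnorm (c : Cplx R) + 1)) = e * (rnorm (c : Cplx R) + 1) by field.
by rewrite mulrC ler_wpM2l//; lra.
Qed.

HB.instance Definition _ := GRing.isSubmodClosed.Build R[i] (X -> Cplx R) kclosure
  kclosure_submod.

Record kspace := KSpace {kval : X -> Cplx R; kvalP : kval \in kclosure}.
HB.instance Definition _ := [isSub for kval].
HB.instance Definition _ := [Choice of kspace by <:].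
HB.instance Definition _ := [SubChoice_isSubLmodule of kspace by <:].

Implicit Types (u v w : kspace).

Lemma kvalD u v : kval (u + v) = kval u + kval v. Proof. by []. Qed.
Lemma kvalZ c u : kval (c *: u) = c *: kval u. Proof. by []. Qed.

Lemma kevD u v m : kev (kval (u + v)) m = kev (kval u) m + kev (kval v) m.
Proof. by rewrite kvalD -{1}(scale1r (kval u)) kev_lin scale1r. Qed.

Lemma kevZ c u m : kev (kval (c *: u)) m = c *: kev (kval u) m.
Proof. by rewrite kvalZ -(addr0 (c *: kval u)) kev_lin kev0 addr0. Qed.

Lemma kevB u v m : kev (kval (u - v)) m = kev (kval u) m - kev (kval v) m.
Proof. by rewrite -(scaleN1r v) kevD kevZ scaleN1r. Qed.

(** [krnorm u] is the norm of [u] as a functional on formal combinations. *)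
Definition kbounds u : set R :=
  [set M | 0 <= M /\ forall m, rnorm (kev (kval u) m) <= M * knorm m].
Definition krnorm u : R := inf (kbounds u).

Lemma kbounds_inf u : has_inf (kbounds u).
Proof.
split; last by exists 0 => M [].
have /kclosureP/(_ 1 ltr01)[l hl] := kvalP u.
exists (1 + knorm l); split=> [|m]; first by rewrite addr_ge0// knorm_ge0.
have := rnormD (kev (kval u) m - kip l m) (kip l m); rewrite subrK => h.
by rewrite (le_trans h)// mulrDl lerD//; exact: kip_CS.
Qed.

Lemma krnorm_ge0 u : 0 <= krnorm u.
Proof. by apply: lb_le_inf; [have [] := kbounds_inf u|move=> M []]. Qed.

Lemma krnorm_le u M : 0 <= M -> (forall m, rnorm (kev (kval u) m) <= M * knorm m) ->
  krnorm u <= M.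
Proof. by move=> M0 h; apply: ge_inf; [have [] := kbounds_inf u|split]. Qed.

Lemma kev_le u m : rnorm (kev (kval u) m) <= krnorm u * knorm m.
Proof.
have [m0|m0] := eqVneq (knorm m) 0.
  have [[M [M0 hM]] _] := kbounds_inf u.
  by rewrite (le_trans (hM m))// m0 !mulr0.
have mp : 0 < knorm m by rewrite lt_neqAle eq_sym m0 knorm_ge0.
rewrite -ler_pdivrMr//; apply: lb_le_inf; first by have [] := kbounds_inf u.
by move=> M [_ /(_ m)]; rewrite ler_pdivrMr.
Qed.

Lemma kev1 f (x : X) : kev f [:: (1, x)] = f x.
Proof. by rewrite /kev big_seq1 rmorph1 scale1r. Qed.

Definition kcnorm u : R[i] := (krnorm u)%:C.

Lemma kcnormD u v : kcnorm (u + v) <= kcnorm u + kcnorm v.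
Proof.
rewrite /kcnorm -rmorphD lecR; apply: krnorm_le; first by rewrite addr_ge0// krnorm_ge0.
by move=> m; rewrite kevD (le_trans (rnormD _ _))// mulrDl lerD// kev_le.
Qed.

Let krnormZ_le c u : krnorm (c *: u) <= rnorm (c : Cplx R) * krnorm u.
Proof.
apply: krnorm_le; first by rewrite mulr_ge0// ?rnorm_ge0// krnorm_ge0.
by move=> m; rewrite kevZ rnormZ -mulrA ler_wpM2l ?rnorm_ge0// kev_le.
Qed.

Lemma kcnormZ c u : kcnorm (c *: u) = `|c| * kcnorm u.
Proof.
have -> : `|c| = (rnorm (c : Cplx R))%:C by exact: (normE (c : Cplx R)).
rewrite /kcnorm -rmorphM; congr (_%:C); apply/eqP; rewrite eq_le krnormZ_le /=.
have [->|c0] := eqVneq c 0.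
  by rewrite rnorm0 mul0r krnorm_ge0.
have cp : 0 < rnorm (c : Cplx R).
  rewrite lt_neqAle rnorm_ge0 andbT eq_sym; apply/eqP => /rnorm_eq0 cc.
  by move: c0; rewrite [c]cc eqxx.
rewrite -ler_pdivlMl//; have := krnormZ_le c^-1 (c *: u).
rewrite scalerA mulVf// scale1r => h; rewrite (le_trans h)// ler_wpM2r ?krnorm_ge0//.
rewrite le_eqVlt; apply/orP; left; apply/eqP.
apply: (mulfI (lt0r_neq0 cp)); rewrite mulfV ?lt0r_neq0//.
have := rnormZ c (c^-1 : Cplx R); rewrite -[c *: _]/(c * c^-1) mulfV// => <-.
by have := @rnormC R 1; rewrite normr1.
Qed.

Lemma kcnorm_eq0 u : kcnorm u = 0 -> u = 0.
Proof.
move=> h; have /complexI u0 : (krnorm u)%:C = 0%:C by exact: h.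
apply/val_inj/funext => x.
rewrite -[LHS](kev1 (kval u) x); apply: rnorm_eq0; apply/eqP.
by rewrite eq_le rnorm_ge0 andbT (le_trans (kev_le _ _))// u0 mul0r.
Qed.

HB.instance Definition _ := Lmodule_isNormed.Build R[i] kspace kcnormD kcnormZ kcnorm_eq0.

Definition kinj l : kspace.
Proof.
refine (@KSpace (kvec l) _); apply/kclosureP => e e0; exists l => m.
by rewrite subrr rnorm0 mulr_ge0 ?knorm_ge0// ltW.
Defined.

Lemma kinj_cat l m : kinj (l ++ m) = kinj l + kinj m.
Proof. by apply/val_inj; exact: kvec_cat. Qed.

Lemma kinj_scale c l : kinj (kscale c l) = c *: kinj l.
Proof. by apply/val_inj; exact: kvec_scale. Qed.

Lemma kinjE l : kinj l = \sum_(p <- l) p.1 *: kinj [:: (1, p.2)].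
Proof.
elim: l => [|[c x] l IH].
  by rewrite big_nil; apply/val_inj/funext => x; rewrite /= /kvec big_nil.
rewrite big_cons -IH -cat1s kinj_cat; congr (_ + _).
by rewrite -kinj_scale /kscale /= mulr1.
Qed.

Lemma rnorm_kinj l : rnorm (kinj l) = knorm l.
Proof.
apply/eqP; rewrite eq_le krnorm_le ?knorm_ge0//=; last by move=> m; exact: kip_CS.
have [l0|l0] := eqVneq (knorm l) 0; first by rewrite l0 krnorm_ge0.
have lp : 0 < knorm l by rewrite lt_neqAle eq_sym l0 knorm_ge0.
have := kev_le (kinj l) l; rewrite -[kev _ _]/(kip l l) -knorm2.
by rewrite rnormC ger0_norm ?sqr_ge0// expr2 ler_pM2r.
Qed.

Lemma kinj_dense u (e : R) : 0 < e -> exists l, rnorm (u - kinj l) <= e.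
Proof.
move=> e0; have /kclosureP/(_ _ e0)[l hl] := kvalP u.
exists l; apply: krnorm_le; first exact: ltW.
by move=> m; rewrite kevB; exact: hl.
Qed.

(** Evaluations are bounded for [krnorm], so a Cauchy filter has a pointwise
    limit; the Cauchy estimates pass to it. *)
Lemma kspace_complete (F : set_system kspace) : ProperFilter F -> cauchy F -> cvg F.
Proof.
move=> FF /cauchyP cF.
have {}cF (e : R) : 0 < e -> exists u, \forall v \near F, rnorm (u - v) < e.
  move=> e0; have [u Fu] := cF e%:C ltac:(by rewrite ltcR).
  exists u; apply: (@filterS _ F _ (ball u e%:C)) Fu => v.
  by rewrite -ball_normE /ball_ /= normE ltcR.
have lims x : exists z : Cplx R, (fun u => kval u x : Cplx R) @ F --> z.
  exists (lim ((fun u => kval u x : Cplx R) @ F)).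
  apply: rcauchy_cvg => e e0.
  have n0 := knorm_ge0 [:: (1, x)].
  have d0 : 0 < e / (knorm [:: (1, x)] + 1) by rewrite divr_gt0//; lra.
  have [u Fu] := cF _ d0; exists (kval u x); apply: filterS Fu => v /= uv.
  have := kev_le (u - v) [:: (1, x)]; rewrite kevB !kev1 => h.
  apply: (le_lt_trans h); apply: (@le_lt_trans _ _ (e / (knorm [:: (1, x)] + 1) *
     knorm [:: (1, x)])); first by rewrite ler_wpM2r// ltW.
  by rewrite mulrAC ltr_pdivrMr ?ltr_pM2l//; lra.
have [f hf] := choice lims.
have hev m : (fun u => kev (kval u) m) @ F --> kev f m.
  rewrite /kev; elim: m => [|q m IH].
    rewrite big_nil (_ : (fun u => _) = fun=> 0); first exact: cvg_cst.
    by apply/funext => u; rewrite big_nil.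
  rewrite big_cons (_ : (fun u => _) = fun u => Num.conj q.1 *: kval u q.2 +
    \sum_(p <- m) Num.conj p.1 *: kval u p.2); last first.
    by apply/funext => u; rewrite big_cons.
  apply: (@cvgD _ (Cplx R)); last exact: IH.
  apply: (@cvgZC R (Cplx R) kspace F _ (fun=> Num.conj q.1 : Cplx R)
    (fun u => kval u q.2)); last exact: hf.
  exact: cvg_cst.
have close (e : R) u : 0 < e -> (\forall v \near F, rnorm (u - v) < e) ->
    forall m, rnorm (kev (kval u) m - kev f m) <= e * knorm m.
  move=> e0 Fu m; apply/ler_addgt0Pr => d d0.
  have /rcvgP/(_ _ d0) hm := hev m.
  near F => v.
  rewrite (le_trans (rnorm_dist _ (kev (kval v) m) _))// lerD//.
    rewrite -kevB (le_trans (kev_le _ _))// ler_wpM2r ?knorm_ge0// ltW//.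
    by near: v.
  by rewrite rnormBC ltW//; near: v.
have fK : f \in kclosure.
  apply/kclosureP => e e0; have e2 : 0 < e / 2 by lra.
  have [u Fu] := cF _ e2; have [l hl] := kinj_dense u e2; exists l => m.
  rewrite (le_trans (rnorm_dist _ (kev (kval u) m) _))//.
  have h1 := close _ _ e2 Fu m; rewrite rnormBC in h1.
  have h2 := kev_le (u - kinj l) m; rewrite kevB -[kev (kval (kinj l)) m]/(kip l m) in h2.
  have h3 : krnorm (u - kinj l) * knorm m <= e / 2 * knorm m.
    by rewrite ler_wpM2r// knorm_ge0.
  by rewrite (splitr e) mulrDl; lra.
apply/cvg_ex; exists (KSpace fK).
have : (fun u : kspace => u) @ F --> KSpace fK; last by [].
apply/rcvgP => e e0; have e3 : 0 < e / 3 by lra.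
have [u Fu] := cF _ e3.
have h1 : rnorm (u - KSpace fK) <= e / 3.
  apply: krnorm_le; first exact: ltW.
  by move=> m; rewrite kevB; exact: close.
apply: filterS Fu => v uv; rewrite (le_lt_trans (rnorm_dist _ u _))//.
by rewrite rnormBC; lra.
Unshelve. all: by end_near. Qed.

HB.instance Definition _ := Uniform_isComplete.Build kspace kspace_complete.

Lemma kev_diff u l m : rnorm (kev (kval u) l - kev (kval u) m) <=
  rnorm u * rnorm (kinj l - kinj m).
Proof.
have -> : kinj l - kinj m = kinj (l ++ kscale (- 1) m).
  by rewrite kinj_cat kinj_scale scaleN1r.
have -> : kev (kval u) l - kev (kval u) m = kev (kval u) (l ++ kscale (- 1) m).
  by rewrite kev_cat kev_scale rmorphN rmorph1 scaleN1r.
by rewrite rnorm_kinj; exact: kev_le.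
Qed.

(** On the dense subspace the inner product with [u] is evaluation of [u], and
    in general it is determined by continuity. *)
Definition kinnerP u v (z : Cplx R) :=
  forall l, rnorm (z - kev (kval u) l) <= rnorm u * rnorm (v - kinj l).

Lemma kinner_ex u v : exists z, kinnerP u v z.
Proof.
exact: (lipschitz_limit (rnorm_ge0 u) (kev_diff u) (fun e => @kinj_dense v e)).
Qed.

Definition kinner u v : R[i] := xget 0 [set z | kinnerP u v z].

Lemma kinner_spec u v : kinnerP u v (kinner u v).
Proof.
have [z hz] := kinner_ex u v.
exact: (@xgetPex _ 0 [set z | kinnerP u v z] (ex_intro _ z hz)).
Qed.

Lemma eq0_small (V : normedModType R[i]) (x : V) (C : R) : 0 <= C ->
  (forall e : R, 0 < e -> e <= 1 -> rnorm x <= C * e) -> x = 0.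
Proof.
move=> C0 h; apply: rnorm_le_eps => e e0.
pose d := Num.min 1 (e / (C + 1)).
have d0 : 0 < d by rewrite lt_min ltr01 divr_gt0//; lra.
have d1 : d <= 1 by rewrite ge_min lexx.
apply: (le_trans (h d d0 d1)).
have : d <= e / (C + 1) by rewrite ge_min lexx orbT.
rewrite ler_pdivlMr; last by lra.
by rewrite mulrDr mulr1 mulrC; lra.
Qed.

Lemma kinner_linl v c u w : kinner (c *: u + w) v = c * kinner u v + kinner w v.
Proof.
apply/eqP; rewrite -subr_eq0; apply/eqP.
pose M := rnorm (c *: u + w) + rnorm (c : Cplx R) * rnorm u + rnorm w.
apply: (@eq0_small (Cplx R) _ M).
  by rewrite /M !addr_ge0// ?mulr_ge0// rnorm_ge0.
move=> e e0 _; have [l hl] := kinj_dense v e0.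
have h1 := kinner_spec (c *: u + w) v l.
have h2 := kinner_spec u v l; have h3 := kinner_spec w v l.
have ee (r : R) : 0 <= r -> r * rnorm (v - kinj l) <= r * e.
  by move=> r0; rewrite ler_wpM2l.
set a := kinner _ v in h1 *; set b := kinner u v in h2 *; set d := kinner w v in h3 *.
rewrite kevD kevZ in h1.
have rE (x y z p q : R[i]) : x - (c * y + z) =
   (x - (c * p + q)) - (c * (y - p) + (z - q)) by ring.
have E : (a - (c * b + d) : Cplx R) = (a - (c *: kev (kval u) l + kev (kval w) l)) -
   (c *: ((b : Cplx R) - kev (kval u) l) + (d - kev (kval w) l)) by exact: rE.
rewrite E (le_trans (rnormB _ _))// /M !mulrDl -addrA lerD//.
  by apply: (le_trans h1); apply: ee; exact: rnorm_ge0.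
rewrite (le_trans (rnormD _ _))// lerD//; last by apply: (le_trans h3); apply: ee; exact: rnorm_ge0.
rewrite rnormZ -mulrA ler_wpM2l ?rnorm_ge0//.
by apply: (le_trans h2); apply: ee; exact: rnorm_ge0.
Qed.

(** The means of transferring hermitian symmetry and the value on the diagonal
    from [kip] to the completion. *)
Lemma kinner_approx u v l m (e : R) : 0 < e -> e <= 1 ->
  rnorm (u - kinj m) <= e -> rnorm (v - kinj l) <= e ->
  rnorm (kinner u v - kip m l : Cplx R) <= (rnorm u + rnorm v + 1) * e.
Proof.
move=> e0 e1 hu hv; have h1 := kinner_spec u v l.
have h2 := kev_le (u - kinj m) l; rewrite kevB -[kev (kval (kinj m)) l]/(kip m l) in h2.
rewrite (le_trans (rnorm_dist _ (kev (kval u) l) _))//.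
have u0 := rnorm_ge0 u; have v0 := rnorm_ge0 v.
have h3 : rnorm u * rnorm (v - kinj l) <= rnorm u * e by rewrite ler_wpM2l.
have h4 : knorm l <= rnorm v + e.
  rewrite -rnorm_kinj; have := rnormB v (v - kinj l); rewrite opprB addrC subrK; lra.
have h5 : krnorm (u - kinj m) * knorm l <= e * (rnorm v + e).
  by apply: ler_pM; rewrite ?krnorm_ge0 ?knorm_ge0.
have h6 : e * e <= e * 1 by rewrite ler_wpM2l// ltW.
have -> : (rnorm u + rnorm v + 1) * e = rnorm u * e + e * (rnorm v + 1) by ring.
apply: lerD; first exact: le_trans h3.
by apply: (le_trans h2); apply: (le_trans h5); rewrite !mulrDr; lra.
Qed.

Lemma kinner_herm u v : kinner v u = Num.conj (kinner u v).
Proof.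
apply/eqP; rewrite -subr_eq0; apply/eqP.
have u0 := rnorm_ge0 u; have v0 := rnorm_ge0 v.
apply: (@eq0_small (Cplx R) _ (2 * (rnorm u + rnorm v + 1))); first by lra.
move=> e e0 e1; have [l hl] := kinj_dense v e0; have [m hm] := kinj_dense u e0.
have h1 := kinner_approx e0 e1 hm hl; have h2 := kinner_approx e0 e1 hl hm.
rewrite (le_trans (rnorm_dist _ (kip l m : Cplx R) _))//.
have -> : rnorm ((kip l m : Cplx R) - (Num.conj (kinner u v) : Cplx R)) =
   rnorm (kinner u v - kip m l : Cplx R).
  rewrite (kipC m l) [RHS]rnormBC -[RHS]rnorm_conj; congr rnorm.
  exact: (esym (rmorphB (@Num.conj R[i]) _ _)).
have -> : 2 * (rnorm u + rnorm v + 1) * e =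
  (rnorm v + rnorm u + 1) * e + (rnorm u + rnorm v + 1) * e by ring.
exact: lerD.
Qed.

Lemma kinner_self u : kinner u u = (rnorm u ^+ 2)%:C.
Proof.
apply/eqP; rewrite -subr_eq0; apply/eqP.
have u0 := rnorm_ge0 u.
apply: (@eq0_small (Cplx R) _ (2 * (rnorm u + rnorm u + 1))); first by lra.
move=> e e0 e1; have [l hl] := kinj_dense u e0.
have h1 := kinner_approx e0 e1 hl hl.
rewrite (le_trans (rnorm_dist _ (kip l l : Cplx R) _))//.
rewrite -{2}knorm2 rnormCB -rnorm_kinj subr_sqr normrM.
have h2 := rnorm_distl u (kinj l); rewrite distrC in h2.
have l0 := rnorm_ge0 (kinj l).
have h3 : rnorm (kinj l) <= rnorm u + e.
  have := rnormB u (u - kinj l); rewrite opprB addrC subrK; lra.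
have h4 : `|rnorm (kinj l) - rnorm u| * `|rnorm (kinj l) + rnorm u| <=
    e * (rnorm u + rnorm u + 1).
  by apply: ler_pM => //; [exact: le_trans hl|rewrite ger0_norm//; lra].
have -> : 2 * (rnorm u + rnorm u + 1) * e =
  (rnorm u + rnorm u + 1) * e + e * (rnorm u + rnorm u + 1) by ring.
exact: lerD.
Qed.

Lemma kinner_kinj l m : kinner (kinj l) (kinj m) = kip l m.
Proof.
have := kinner_spec (kinj l) (kinj m) m; rewrite subrr rnorm0 mulr0 => h.
have : rnorm (kinner (kinj l) (kinj m) - kip l m : Cplx R) = 0.
  by apply/eqP; rewrite eq_le rnorm_ge0 andbT.
by move/rnorm_eq0/eqP; rewrite subr_eq0 => /eqP.
Qed.

Lemma kinner_linr u c v w : kinner u (c *: v + w) = Num.conj c * kinner u v + kinner u w.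
Proof.
rewrite (kinner_herm (c *: v + w) u) kinner_linl.
by rewrite (kinner_herm v u) (kinner_herm w u) rmorphD rmorphM.
Qed.

Lemma kinner_bilinear :
  bilinear_for (GRing.mul : GRing.Scale.law R[i] R[i])
    (Num.conj \; *%R : GRing.Scale.law R[i] R[i]) kinner.
Proof. by split=> [v c u w|u c v w]; [exact: kinner_linl|exact: kinner_linr]. Qed.

HB.instance Definition _ := bilinear_isBilinear.Build R[i] kspace kspace R[i]
  *%R (Num.conj \; *%R) kinner kinner_bilinear.

Lemma kinner_hermitian u v : kinner u v = (-1) ^+ false * Num.conj (kinner v u).
Proof. by rewrite expr0 mul1r; exact: kinner_herm. Qed.

HB.instance Definition _ := isHermitianSesquilinear.Build R[i] kspace false Num.conj
  kinner kinner_hermitian.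

Lemma kinner_gt0 u : u != 0 -> 0 < kinner u u.
Proof.
move=> u0; rewrite kinner_self -[0]/(0%:C) ltcR exprn_gt0// lt_neqAle rnorm_ge0 andbT.
by rewrite eq_sym; apply: contraNneq u0 => /rnorm_eq0 ->.
Qed.

HB.instance Definition _ := isDotProduct.Build R[i] kspace kinner kinner_gt0.

Lemma kinner_norm u : kinner u u = `|u| ^+ 2.
Proof. by rewrite kinner_self normE rmorphXn. Qed.

Definition khilbert : hilbertType R := @Hilbert R kspace kinner kinner_norm.

End PreHilbert.

(** [K] is the reproducing kernel Hilbert space of [k], and [j x] is the
    function [k x]. *)
Theorem kolmogorov (R : realType) (X : Type) (k : posKernel R X) :
  exists (K : hilbertType R) (j : X -> K),
    (forall x y, inner K (j x) (j y) = k x y) /\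
    (forall (z : K) (e : R), 0 < e -> exists l : seq (R[i] * X),
       rnorm (z - \sum_(p <- l) p.1 *: j p.2) <= e).
Proof.
exists (khilbert k), (fun x => kinj k [:: (1, x)] : khilbert k); split.
  move=> x y; rewrite -[LHS]/(kinner (kinj k [:: (1, x)]) (kinj k [:: (1, y)])).
  by rewrite kinner_kinj kipE !big_seq1 /= rmorph1 !mul1r.
move=> z e e0; have [l hl] := kinj_dense z e0.
by exists l; rewrite kinjE in hl; exact: hl.
Qed.

(** * Operators defined on spanning families *)

Section Graph.
Variables (R : realType) (Z : Type) (V W : completeNormedModType R[i]).
Variables (u : Z -> V) (v : Z -> W).
Implicit Types (l : seq (R[i] * Z)) (p : V) (q : W).

Definition lsum (U : lmodType R[i]) (w : Z -> U) l : U := \sum_(a <- l) a.1 *: w a.2.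

Lemma lsum_cat (U : lmodType R[i]) (w : Z -> U) l m : lsum w (l ++ m) = lsum w l + lsum w m.
Proof. by rewrite /lsum big_cat. Qed.

Lemma lsum_scale (U : lmodType R[i]) (w : Z -> U) (c : R[i]) l :
  lsum w [seq (c * a.1, a.2) | a <- l] = c *: lsum w l.
Proof. by rewrite /lsum big_map scaler_sumr; apply: eq_bigr => a _; rewrite scalerA. Qed.

(** The closure of the linear relation spanned by the pairs [(u z, v z)]. As a
    relation, it can be shown to contain limits and integrals before it is
    known to be single-valued. *)
Definition graph p q := forall e : R, 0 < e ->
  exists l, rnorm (p - lsum u l) <= e /\ rnorm (q - lsum v l) <= e.

Lemma graph_gen z : graph (u z) (v z).
Proof.
move=> e e0; exists [:: (1, z)].
by rewrite /lsum !big_seq1 !scale1r !subrr !rnorm0 ltW.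
Qed.

Lemma graph_closed p q :
  (forall e : R, 0 < e -> exists p' q', [/\ graph p' q', rnorm (p - p') <= e &
     rnorm (q - q') <= e]) -> graph p q.
Proof.
move=> h e e0; have e2 : 0 < e / 2 by lra.
have [p' [q' [g hp hq]]] := h _ e2; have [l [hl hl']] := g _ e2.
exists l; split.
  by rewrite (le_trans (rnorm_dist _ p' _))//; lra.
by rewrite (le_trans (rnorm_dist _ q' _))//; lra.
Qed.

Lemma graph_lin (c : R[i]) p q p' q' : graph p q -> graph p' q' ->
  graph (c *: p + p') (c *: q + q').
Proof.
move=> g g' e e0; pose n := rnorm (c : Cplx R); have n0 : 0 <= n := rnorm_ge0 _.
pose d := e / (n + 1); have d0 : 0 < d by rewrite divr_gt0//; lra.
have de : n * d + d = e by rewrite /d; field; lra.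
have [l [hl hl']] := g _ d0; have [m [hm hm']] := g' _ d0.
exists ([seq (c * a.1, a.2) | a <- l] ++ m); rewrite !lsum_cat !lsum_scale.
split.
  rewrite opprD addrACA -scalerBr (le_trans (rnormD _ _))// rnormZ -de lerD//.
  by rewrite ler_wpM2l.
rewrite opprD addrACA -scalerBr (le_trans (rnormD _ _))// rnormZ -de lerD//.
by rewrite ler_wpM2l.
Qed.

Lemma graph0 : graph 0 0.
Proof. by move=> e e0; exists [::]; rewrite /lsum !big_nil !subrr !rnorm0 ltW. Qed.

Lemma graph_sum (J : Type) (r : seq J) (c : J -> R[i]) (P : J -> V) (Q : J -> W) :
  (forall j, graph (P j) (Q j)) ->
  graph (\sum_(j <- r) c j *: P j) (\sum_(j <- r) c j *: Q j).
Proof.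
move=> g; elim: r => [|j r IH]; first by rewrite !big_nil; exact: graph0.
by rewrite !big_cons; exact: graph_lin.
Qed.

Section Integral.
Variable G : topGroupType.
Hypothesis hausdorffG : hausdorff_space G.
Variable mu : {measure set (borel G) -> \bar R}.
Hypothesis mu_compact : forall K : set G, compact K -> (mu K < +oo)%E.

(** Both integrals are limits of Riemann sums along the same partitions. *)
Lemma graph_bochner (P : G -> V) (Q : G -> W) : Cc P -> Cc Q ->
  (forall t, graph (P t) (Q t)) ->
  graph (bochner_integral mu P) (bochner_integral mu Q).
Proof.
move=> cP cQ g; have [K cK [CP CQ]] := Ck2 hausdorffG cP cQ.
have PF := fineF_proper hausdorffG cK.
apply: graph_closed => e e0.
have /rcvgP/(_ _ e0) h1 := riem_cvg hausdorffG mu_compact cK CP.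
have /rcvgP/(_ _ e0) h2 := riem_cvg hausdorffG mu_compact cK CQ.
have [X [hX1 hX2]] := filter_ex (filterI h1 h2).
exists (riem mu P X), (riem mu Q X); split; [|exact: ltW..].
by apply: graph_sum => j; exact: g.
Qed.
End Integral.

Variable M : R.
Hypothesis M0 : 0 <= M.
Hypothesis bound : forall l, rnorm (lsum v l) <= M * rnorm (lsum u l).

Lemma graph_le p q : graph p q -> rnorm q <= M * rnorm p.
Proof.
have M0' := M0; move=> g; apply/ler_addgt0Pr => e e0.
pose d := e / (M + 1); have d0 : 0 < d by rewrite divr_gt0//; lra.
have de : d + M * d = e by rewrite /d; field; lra.
have [l [hl hl']] := g _ d0.
have h1 : rnorm q <= d + rnorm (lsum v l).
  by have := rnormD (q - lsum v l) (lsum v l); rewrite subrK; lra.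
have h2 : rnorm (lsum u l) <= rnorm p + d.
  by have := rnormB p (p - lsum u l); rewrite subKr; lra.
have h3 : M * rnorm (lsum u l) <= M * (rnorm p + d) by rewrite ler_wpM2l.
have h4 := bound l; rewrite mulrDr in h3; lra.
Qed.

Lemma graph_unique p q q' : graph p q -> graph p q' -> q = q'.
Proof.
move=> g g'; have := graph_le (graph_lin (- 1) g' g).
rewrite !scaleN1r addNr rnorm0 mulr0 => h.
apply/eqP; rewrite -subr_eq0 addrC; apply/eqP; apply: rnorm_eq0.
by apply/eqP; rewrite eq_le h rnorm_ge0.
Qed.

Hypothesis dense : forall p (e : R), 0 < e -> exists l, rnorm (p - lsum u l) <= e.

(** The images of the approximations of [p] in the span of [u] form a Cauchy
    filter. *)
Lemma graph_total p : exists q, graph p q.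
Proof.
have M0' := M0.
have [l m|q hq] := lipschitz_limit (u := lsum u) (w := lsum v) M0 _ (dense p).
  have := bound (l ++ [seq (- 1 * a.1, a.2) | a <- m]).
  by rewrite !lsum_cat !lsum_scale !scaleN1r.
exists q => e e0; pose d := e / (M + 1).
have d0 : 0 < d by rewrite divr_gt0//; lra.
have de : d + M * d = e by rewrite /d; field; lra.
have Md : 0 <= M * d by rewrite mulr_ge0// ltW.
have [l hl] := dense p d0; exists l; split; first by lra.
have := ler_wpM2l M0 hl; have := hq l; lra.
Qed.

Definition extend p : W := xget 0 [set q | graph p q].

Lemma extendP p : graph p (extend p).
Proof.
have [q hq] := graph_total p.
exact: (@xgetPex _ 0 [set q | graph p q] (ex_intro _ q hq)).
Qed.

Lemma extend_gen z : extend (u z) = v z.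
Proof. exact: (graph_unique (extendP _) (graph_gen z)). Qed.

Lemma extend_linear (c : R[i]) p p' : extend (c *: p + p') = c *: extend p + extend p'.
Proof. exact: (graph_unique (extendP _) (graph_lin c (extendP p) (extendP p'))). Qed.

Lemma extend_le p : rnorm (extend p) <= M * rnorm p.
Proof. exact: graph_le (extendP p). Qed.

End Graph.

Section DenseEq.
Variables (R : realType) (Z : Type) (V W : completeNormedModType R[i]) (u : Z -> V).
Hypothesis dense : forall p (e : R), 0 < e -> exists l, rnorm (p - lsum u l) <= e.

Lemma lin_bounded_continuous (T : V -> W) (M : R) :
  (forall (c : R[i]) x y, T (c *: x + y) = c *: T x + T y) -> 0 <= M ->
  (forall x, rnorm (T x) <= M * rnorm x) -> continuous T.
Proof.
move=> TL M0 TM x; apply/rcontP => e e0.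
pose d := e / (M + 1); have d0 : 0 < d by rewrite divr_gt0//; lra.
have := near_rnorm x d0; apply: filterS => y xy.
have -> : T x - T y = T (x - y).
  by rewrite (addrC x) -(scaleN1r y) TL scaleN1r addrC.
apply: (le_lt_trans (TM _)); apply: (@le_lt_trans _ _ (M * d)).
  by rewrite ler_wpM2l// ltW.
by rewrite /d mulrA ltr_pdivrMr; [rewrite mulrC ltr_pM2l//; lra|lra].
Qed.

(** Homogeneity enters only through the zeros of [T], so that conjugate-linear
    functionals are allowed. *)
Lemma dense_eq0 (T : V -> W) (M : R) :
  (forall x y, T (x + y) = T x + T y) ->
  (forall (c : R[i]) x, T x = 0 -> T (c *: x) = 0) -> 0 <= M ->
  (forall x, rnorm (T x) <= M * rnorm x) ->
  (forall z, T (u z) = 0) -> forall x, T x = 0.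
Proof.
move=> TD TZ M0 TM Tu x; apply: rnorm_le_eps => e e0.
pose d := e / (M + 1); have d0 : 0 < d by rewrite divr_gt0//; lra.
have [l hl] := dense x d0.
have T0 : T 0 = 0 by apply: (addrI (T 0)); rewrite -TD !addr0.
have Tl : T (lsum u l) = 0.
  rewrite /lsum; elim: (l) => [|a m IH]; first by rewrite big_nil.
  by rewrite big_cons TD IH addr0 TZ.
have -> : T x = T (x - lsum u l).
  by apply: (addIr (T (lsum u l))); rewrite -[RHS]TD subrK Tl addr0.
apply: (le_trans (TM _)); apply: (@le_trans _ _ (M * d)); first by rewrite ler_wpM2l.
by rewrite /d mulrA ler_pdivrMr; [rewrite mulrC ler_pM2l//; lra|lra].
Qed.

Lemma dense_eq (T T' : V -> W) (M M' : R) :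
  (forall (c : R[i]) x y, T (c *: x + y) = c *: T x + T y) ->
  (forall (c : R[i]) x y, T' (c *: x + y) = c *: T' x + T' y) ->
  0 <= M -> 0 <= M' ->
  (forall x, rnorm (T x) <= M * rnorm x) ->
  (forall x, rnorm (T' x) <= M' * rnorm x) ->
  (forall z, T (u z) = T' (u z)) -> forall x, T x = T' x.
Proof.
move=> TL TL' M0 M0' TM TM' E x; apply/eqP; rewrite -subr_eq0; apply/eqP.
have DL (c : R[i]) p q :
    T (c *: p + q) - T' (c *: p + q) = c *: (T p - T' p) + (T q - T' q).
  by rewrite TL TL' opprD addrACA scalerBr.
have D0 : T 0 - T' 0 = 0.
  have := DL 1 0 0; rewrite !scale1r addr0 => h.
  by apply: (addrI (T 0 - T' 0)); rewrite -h addr0.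
apply: (@dense_eq0 (fun x => T x - T' x) (M + M')) x => [p q|c p h||p|z].
- by have := DL 1 p q; rewrite !scale1r.
- by have := DL c p 0; rewrite D0 h scaler0 !addr0.
- exact: addr_ge0.
- by rewrite mulrDl (le_trans (rnormB _ _))// lerD.
- by rewrite E subrr.
Qed.
End DenseEq.

(** * The kernel of a representation and a completely positive map *)

Section Gram.
Variables (R : realType) (A B : cstarAlgType R) (psi : {linear B -> A}).
Hypothesis cp : completely_positive psi.

(** The matrix of the [b_i^* b_j] is [x^* x] for the matrix [x] with first row
    [b] and zeros elsewhere. *)
Lemma cp_gram n (b : 'I_n -> B) : exists c : 'I_n -> 'I_n -> A,
  forall i j, psi (cmul (cstar (b i)) (b j)) = \sum_k cmul (cstar (c k i)) (c k j).
Proof.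
case: n b => [|n] b; first by exists (fun _ _ => 0) => - [].
pose a : 'M[B]_n.+1 := \matrix_(i, j) cmul (cstar (b i)) (b j).
have [|x hx] := cp (a := a).
  exists (\matrix_(k, i) if k == ord0 then b i else 0) => i j.
  rewrite mxE (bigD1 ord0)//= !mxE eqxx big1 ?addr0// => k k0.
  by rewrite !mxE (negPf k0) cmulr0.
exists (fun k i => x k i) => i j; rewrite -hx !mxE.
by [].
Qed.
End Gram.

Section Kernel.
Variables (R : realType) (G : topGroupType).
Hypothesis hausdorffG : hausdorff_space G.
Hypothesis lcG : locally_compact [set: G].
Variable mu : {measure set (borel G) -> \bar R}.
Hypothesis haar_mu : left_haar_measure mu.
Variables (A B : gcstarAlgType R G) (psi : {linear B -> A}).
Hypotheses (ccp_psi : ccp psi) (equiv_psi : equivariant psi).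
Variables (H : hilbertType R) (rho : (G -> A) -> H -> H).
Hypothesis rep : star_representation mu rho.
Variables (f : G -> A) (y : H).
Hypothesis cf : Cc f.
Implicit Types (s t : G) (x : B * G) (l : seq (R[i] * (B * G))).
Local Notation I := (bochner_integral mu).
Let ct s := Cc_tact hausdorffG haar_mu s cf.

(** [repv a t] and [rept t] are formally [a u_t z] and [u_t z], where [z = rho
    f y]. As [rho] may be degenerate, the multipliers do not act on [H]; they
    are applied to [f] instead. *)
Definition repv (a : A) t : H := rho (lact a (tact t f)) y.
Definition rept t : H := rho (tact t f) y.
(** The kernel of the Stinespring dilation of [psi]: at [(b, t)] and [(b',
    t')] it is formally the inner product of [psi (b'^* b) u_t z] and [u_t'
    z], where [z = rho f y]. *)
Definition stinespring x x' : R[i] :=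
  inner H (repv (psi (cmul (cstar x'.1) x.1)) x.2) (rept x'.2).
Definition gtrans s x : B * G := (gact s x.1, (s * x.2)%g).
Definition lmulX (b : B) x : B * G := (cmul b x.1, x.2).

Lemma repv_lin (c : R[i]) a a' t : repv (c *: a + a') t = c *: repv a t + repv a' t.
Proof. exact: (rho_lact_lin hausdorffG haar_mu rep y c a a' (ct t)). Qed.

Lemma repv_sum (J : Type) (r : seq J) (F : J -> A) t :
  repv (\sum_(i <- r) F i) t = \sum_(i <- r) repv (F i) t.
Proof.
elim: r => [|i r IH].
  rewrite !big_nil; have := repv_lin 1 0 0 t; rewrite scale1r addr0 scale1r => h.
  by apply: (addrI (repv 0 t)); rewrite -h addr0.
by rewrite !big_cons -{1}(scale1r (F i)) repv_lin scale1r IH.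
Qed.

Lemma repv_adj a a' t t' :
  inner H (repv (cmul (cstar a') a) t) (rept t') = inner H (repv a t) (repv a' t').
Proof. exact: (rho_lact_adj hausdorffG lcG haar_mu rep a' a y y (ct t) (ct t')). Qed.

Lemma inner_suml (J : Type) (r : seq J) (F : J -> H) z :
  inner H (\sum_(i <- r) F i) z = \sum_(i <- r) inner H (F i) z.
Proof. by elim: r => [|i r IH]; rewrite ?big_nil ?inner0l// !big_cons innerDl IH. Qed.

Lemma inner_sumr (J : Type) (r : seq J) (F : J -> H) z :
  inner H z (\sum_(i <- r) F i) = \sum_(i <- r) inner H z (F i).
Proof. by elim: r => [|i r IH]; rewrite ?big_nil ?inner0r// !big_cons innerDr IH. Qed.

(** Complete positivity of [psi] writes the matrix of the [psi (b_j^* b_i)] as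
    a sum of matrices [c_j^* c_i], and the [c_i] can be moved to the two sides
    of the inner product. *)
Lemma stinespring_gram n (x : 'I_n -> B * G) : exists c : 'I_n -> 'I_n -> A,
  forall i j, stinespring (x i) (x j) =
    \sum_k inner H (repv (c k i) (x i).2) (repv (c k j) (x j).2).
Proof.
have [c hc] := cp_gram ccp_psi.1 (fun i => (x i).1).
exists c => i j; rewrite /stinespring hc repv_sum inner_suml.
by apply: eq_bigr => k _; exact: repv_adj.
Qed.

Lemma stinespring_herm x x' : stinespring x' x = Num.conj (stinespring x x').
Proof.
have [c hc] := stinespring_gram (fun i : 'I_2 => if i == ord0 then x else x').
have h1 := hc ord0 ord_max; have h2 := hc ord_max ord0.
rewrite /= in h1 h2; rewrite h1 h2 rmorph_sum; apply: eq_bigr => k _.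
exact: innerC.
Qed.

Lemma stinespring_pos l :
  0 <= \sum_(p <- l) \sum_(q <- l) p.1 * Num.conj q.1 * stinespring p.2 q.2.
Proof.
pose X (i : 'I_(size l)) := (tnth (in_tuple l) i).2.
pose z (i : 'I_(size l)) := (tnth (in_tuple l) i).1.
have [c hc] := stinespring_gram X.
pose S k := \sum_i z i *: repv (c k i) (X i).2.
have -> : \sum_(p <- l) \sum_(q <- l) p.1 * Num.conj q.1 * stinespring p.2 q.2 =
    \sum_k inner H (S k) (S k).
  rewrite big_tnth; under eq_bigr => i _ do rewrite big_tnth.
  transitivity (\sum_i \sum_j \sum_k z i * Num.conj (z j) *
      inner H (repv (c k i) (X i).2) (repv (c k j) (X j).2)).
    by apply: eq_bigr => i _; apply: eq_bigr => j _; rewrite hc mulr_sumr.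
  under eq_bigr do rewrite exchange_big /=.
  rewrite exchange_big /=; apply: eq_bigr => k _.
  rewrite /S inner_suml; apply: eq_bigr => i _.
  rewrite inner_sumr; apply: eq_bigr => j _.
  by rewrite innerZl innerZr mulrA.
by apply: sumr_ge0 => k _; rewrite inner_self -[0]/(0%:C) lecR sqr_ge0.
Qed.

Definition stinespring_kernel : posKernel R (B * G) :=
  PosKernel stinespring_herm stinespring_pos.

Lemma stinespring_gtrans s x x' :
  stinespring (gtrans s x) (gtrans s x') = stinespring x x'.
Proof.
rewrite /stinespring /gtrans /= -gact_cstar -gact_cmul equiv_psi.
rewrite /repv /rept -lact_tact -(tactM x'.2 s).
by rewrite (rho_tact_unitary hausdorffG lcG haar_mu rep)//; exact: (Cc_lact hausdorffG haar_mu).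
Qed.

Lemma stinespring_lmul b x x' :
  stinespring (lmulX b x) x' = stinespring x (lmulX (cstar b) x').
Proof. by rewrite /stinespring /lmulX /= cstarM cstarK cmulA. Qed.

Lemma stinespring_lin (c : R[i]) b b' t x' :
  stinespring (c *: b + b', t) x' = c * stinespring (b, t) x' + stinespring (b', t) x'.
Proof.
by rewrite /stinespring /= cmulDr cmulZr linearP repv_lin innerDl innerZl.
Qed.

Lemma gtransM s t x : gtrans s (gtrans t x) = gtrans (s * t)%g x.
Proof. by rewrite /gtrans /= -gactM mulgA. Qed.

Lemma gtrans_lmul s b x : gtrans s (lmulX b x) = lmulX (gact s b) (gtrans s x).
Proof. by rewrite /gtrans /lmulX /= gact_cmul. Qed.

Lemma lmulXM b b' x : lmulX b (lmulX b' x) = lmulX (cmul b b') x.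
Proof. by rewrite /lmulX /= cmulA. Qed.

Lemma gtrans1 x : gtrans 1%g x = x.
Proof. by case: x => b t; rewrite /gtrans /= gact1 mul1g. Qed.

Lemma cvg_stinespring (T : topologicalType) (u v : T -> B * G) (p : T) :
  {for p, continuous u} -> {for p, continuous v} ->
  (fun q => stinespring (u q) (v q) : Cplx R) @ p --> (stinespring (u p) (v p) : Cplx R).
Proof.
move=> cu cv.
have fstu (w : T -> B * G) : {for p, continuous w} -> {for p, continuous (fun q => (w q).1)}.
  by move=> cw; apply: (@continuous_comp _ _ _ w fst) => //; exact: cvg_fst.
have sndu (w : T -> B * G) : {for p, continuous w} -> {for p, continuous (fun q => (w q).2)}.
  by move=> cw; apply: (@continuous_comp _ _ _ w snd) => //; exact: cvg_snd.
apply: cvg_inner; last first.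
  apply: (@continuous_comp _ _ _ (fun q => (v q).2) rept); first exact: sndu.
  exact: (rho_tact_continuous hausdorffG lcG haar_mu rep cf).
apply: (@continuous_comp _ _ _ (fun q => (psi (cmul (cstar (v q).1) (u q).1), (u q).2))
  (fun q : A * G => repv q.1 q.2)); last first.
  exact: (rho_lact_tact_continuous hausdorffG lcG haar_mu rep cf).
apply: cvg_pair; last exact: sndu.
apply: (@continuous_comp _ _ _ (fun q => cmul (cstar (v q).1) (u q).1) psi).
  by apply: cvg_cmul; [apply: cvg_cstar; exact: fstu|exact: fstu].
apply: (@lin_bounded_continuous R B A psi 1) => //.
  by move=> c b b'; exact: linearP.
by move=> b; rewrite mul1r ler_rnorm; exact: ccp_psi.2.
Qed.

End Kernel.

(** * The representation of a covariant family of vectors *)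

Section InnerLsum.
Variables (R : realType) (Z : Type).
Implicit Types (l : seq (R[i] * Z)).

Lemma inner_lsum (H H' : hilbertType R) (u v : Z -> H) (u' v' : Z -> H') :
  (forall z z', inner H (u z) (v z') = inner H' (u' z) (v' z')) ->
  forall l m, inner H (lsum u l) (lsum v m) = inner H' (lsum u' l) (lsum v' m).
Proof.
move=> h l m; rewrite /lsum !inner_suml; apply: eq_bigr => a _.
rewrite !inner_sumr; apply: eq_bigr => b _.
by rewrite !innerZl !innerZr h.
Qed.

Lemma inner_rnorm_le (H H' : hilbertType R) (x : H) (x' : H') :
  inner H x x <= inner H' x' x' -> rnorm x <= rnorm x'.
Proof.
by rewrite !inner_self lecR ler_sqr// nnegrE rnorm_ge0.
Qed.

Lemma inner_rnorm (H H' : hilbertType R) (x : H) (x' : H') :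
  inner H x x = inner H' x' x' -> rnorm x = rnorm x'.
Proof. by move=> h; apply/eqP; rewrite eq_le !inner_rnorm_le// h. Qed.

End InnerLsum.

Section Covariant.
Variables (R : realType) (G : topGroupType).
Hypothesis hausdorffG : hausdorff_space G.
Hypothesis lcG : locally_compact [set: G].
Variable mu : {measure set (borel G) -> \bar R}.
Hypothesis haar_mu : left_haar_measure mu.
Variables (B : gcstarAlgType R G) (K : hilbertType R) (j : B * G -> K).
Implicit Types (b c : B) (s t : G) (x : B * G) (l : seq (R[i] * (B * G))) (F : G -> B).
Local Notation I := (bochner_integral mu).
Let muK := mu_compact haar_mu.

Hypothesis dense : forall p (e : R), 0 < e -> exists l, rnorm (p - lsum j l) <= e.
Hypothesis j_lin : forall (k : R[i]) b c t, j (k *: b + c, t) = k *: j (b, t) + j (c, t).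
Hypothesis j_cont : continuous j.
Hypothesis j_gtrans : forall s x x',
  inner K (j (gtrans s x)) (j (gtrans s x')) = inner K (j x) (j x').
Hypothesis j_lmul : forall b x x',
  inner K (j (lmulX b x)) (j x') = inner K (j x) (j (lmulX (cstar b) x')).

(** Left multiplication by [b] on formal combinations. That it respects
    equality of vectors of [K] is a consequence of [lop_le]. *)
Local Notation lop b := (lsum (fun x => j (lmulX b x))).

Lemma lop_lin (k : R[i]) b c l : lop (k *: b + c) l = k *: lop b l + lop c l.
Proof.
rewrite /lsum scaler_sumr -big_split; apply: eq_bigr => a _ /=.
rewrite [lmulX (k *: b + c) a.2]/lmulX cmulDl cmulZl j_lin scalerDr !scalerA.
by rewrite mulrC.
Qed.

Lemma lop_adj b c l m : inner K (lop b l) (lop c m) = inner K (lsum j l) (lop (cmul (cstar b) c) m).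
Proof.
apply: inner_lsum => x x'; rewrite j_lmul.
by congr (inner K _ (j _)); rewrite /lmulX /= cmulA.
Qed.

Lemma lopD b c l : lop (b + c) l = lop b l + lop c l.
Proof. by have := lop_lin 1 b c l; rewrite !scale1r. Qed.

Lemma lop0 l : lop 0 l = 0.
Proof. by apply: (addrI (lop 0 l)); rewrite -lopD !addr0. Qed.

Lemma lopZ (k : R[i]) b l : lop (k *: b) l = k *: lop b l.
Proof. by have := lop_lin k b 0 l; rewrite lop0 !addr0. Qed.

Lemma lopB b c l : lop (b - c) l = lop b l - lop c l.
Proof. by rewrite lopD -[- c]scaleN1r lopZ scaleN1r. Qed.

(** With [b^* b = 2g - g^2], the square norm of [b w] is that of [w] minus
    that of [w - g w]. *)
Lemma lop_le1 b l : rnorm b < 1 -> rnorm (lop b l) <= rnorm (lsum j l).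
Proof.
move=> b1; have [||g [gs _ gE]] := @sqrt_one_minus R B (cmul (cstar b) b).
- by rewrite cstarM cstarK.
- by rewrite rnorm_cstar2 expr_lt1// rnorm_ge0.
apply: inner_rnorm_le; set w := lsum j l.
have gw : inner K w (lop g l) = inner K (lop g l) w.
  by apply: inner_lsum => x x'; rewrite j_lmul gs.
have E : inner K (lop b l) (lop b l) =
    inner K w w - inner K (w - lop g l) (w - lop g l).
  rewrite lop_adj -/w gE lopB lopD innerDr innerNr innerDr.
  have -> : inner K w (lop (cmul g g) l) = inner K (lop g l) (lop g l).
    by rewrite lop_adj gs.
  rewrite innerDl !innerDr !innerNl !innerNr -gw.
  have rE (p q r : R[i]) : q + q - r = p - (p - q + (- q - - r)) by ring.
  exact: rE.
by rewrite E lerBlDr lerDl inner_self -[0]/(0%:C) lecR sqr_ge0.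
Qed.

Lemma lop_le b l : rnorm (lop b l) <= rnorm b * rnorm (lsum j l).
Proof.
have w0 := rnorm_ge0 (lsum j l); have b0 := rnorm_ge0 b.
apply/ler_addgt0Pr => e e0.
pose d := e / (rnorm (lsum j l) + 1); have d0 : 0 < d by rewrite divr_gt0//; lra.
pose r := rnorm b + d; have r0 : 0 < r by rewrite /r; lra.
have /(@lop_le1 _ l) : rnorm ((r^-1)%:C *: b) < 1.
  rewrite rnormZR ger0_norm ?invr_ge0 ?ltW// mulrC ltr_pdivrMr// mul1r /r; lra.
rewrite lopZ rnormZR ger0_norm ?invr_ge0 ?(ltW r0)// mulrC ler_pdivrMr// => h.
apply: (le_trans h); rewrite mulrC /r mulrDl lerD2l /d mulrAC ler_pdivrMr; last by lra.
by rewrite ler_pM2l//; lra.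
Qed.

Definition gsum s l := [seq (a.1, gtrans s a.2) | a <- l].

Lemma lsum_gsum (V : lmodType R[i]) (w : B * G -> V) s l :
  lsum w (gsum s l) = lsum (fun x => w (gtrans s x)) l.
Proof. by rewrite /lsum big_map. Qed.

Lemma rnorm_gsum s l : rnorm (lsum j (gsum s l)) = rnorm (lsum j l).
Proof.
by apply: inner_rnorm; rewrite lsum_gsum; apply: inner_lsum => x x'.
Qed.

Lemma cvg_gtrans (T : topologicalType) (u : T -> G) (v : T -> B * G) (p : T) :
  {for p, continuous u} -> {for p, continuous v} ->
  {for p, continuous (fun q => gtrans (u q) (v q))}.
Proof.
move=> cu cv; apply: cvg_pair.
  apply: cvg_gact; first exact: cu.
  by apply: (@continuous_comp _ _ _ v fst) => //; exact: cvg_fst.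
have cv2 : {for p, continuous (fun q => (v q).2)}.
  by apply: (@continuous_comp _ _ _ v snd) => //; exact: cvg_snd.
exact: (cvg_mulg cu cv2).
Qed.

Lemma cvg_lmulX (T : topologicalType) (u : T -> B) (v : T -> B * G) (p : T) :
  {for p, continuous u} -> {for p, continuous v} ->
  {for p, continuous (fun q => lmulX (u q) (v q))}.
Proof.
move=> cu cv; apply: cvg_pair.
  apply: cvg_cmul; first exact: cu.
  by apply: (@continuous_comp _ _ _ v fst) => //; exact: cvg_fst.
by apply: (@continuous_comp _ _ _ v snd) => //; exact: cvg_snd.
Qed.

Lemma cvg_j (T : topologicalType) (u : T -> B * G) (p : T) :
  {for p, continuous u} -> {for p, continuous (fun q => j (u q))}.
Proof. by move=> cu; apply: (@continuous_comp _ _ _ u j) => //; exact: j_cont. Qed.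

Lemma j_lmul0 x : j (lmulX 0 x) = 0.
Proof.
by have := lop0 [:: (1, x)]; rewrite /lsum big_seq1 scale1r.
Qed.

(** The integrated form of the covariant pair formed by left multiplication
    and translation, on the generators [j x]. *)
Definition integrand F x s : K := j (lmulX (F s) (gtrans s x)).

Lemma Cc_integrand F x : Cc F -> Cc (integrand F x).
Proof.
move=> /(Ck_ex hausdorffG)[L cL [cF F0]]; apply: (CkCc hausdorffG cL).
split=> [s|s nL]; last by rewrite /integrand F0// j_lmul0.
exact: (cvg_j (cvg_lmulX (cF s) (cvg_gtrans (@cont_id _ s) (@cont_cst _ _ x s)))).
Qed.

Definition rep_gen F x : K := I (integrand F x).

Lemma rep_gen_lin (k : R[i]) F F' x : Cc F -> Cc F' ->
  rep_gen (fun s => k *: F s + F' s) x = k *: rep_gen F x + rep_gen F' x.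
Proof.
move=> cF cF'; have [C1 C2] := (Cc_integrand x cF, Cc_integrand x cF').
have [E1 C3] := bochnerZ hausdorffG muK k C1.
rewrite /rep_gen -E1 -(bochnerD hausdorffG muK C3 C2).1; congr (I _).
by apply/funext => s; rewrite /integrand {1}/lmulX cmulDl cmulZl j_lin.
Qed.

Lemma rep_gen_le F l : Cc F -> rnorm (lsum (rep_gen F) l) <= N1 mu F * rnorm (lsum j l).
Proof.
move=> cF.
have [E C] := bochner_sum hausdorffG muK l
  (fun a => (bochnerZ hausdorffG muK a.1 (Cc_integrand a.2 cF)).2).
have -> : lsum (rep_gen F) l = I (fun s => \sum_(a <- l) a.1 *: integrand F a.2 s).
  rewrite E /lsum; apply: eq_bigr => a _.
  by rewrite (bochnerZ hausdorffG muK a.1 (Cc_integrand a.2 cF)).1.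
apply: (le_trans (rnorm_bochner hausdorffG muK C)).
rewrite mulrC; apply: (N1_mono hausdorffG muK C cF (rnorm_ge0 _)) => s.
rewrite mulrC -(rnorm_gsum s l).
by have := lop_le (F s) (gsum s l); rewrite lsum_gsum.
Qed.

Definition covariant_rep F := extend j (rep_gen F).

Section Fixed.
Variable F : G -> B.
Hypothesis cF : Cc F.
Let N0 := N1_ge0 mu F.
Let bd l := rep_gen_le l cF.

Lemma covariant_rep_gen x : covariant_rep F (j x) = rep_gen F x.
Proof. exact: extend_gen N0 bd dense x. Qed.

Lemma covariant_rep_linear (k : R[i]) p q : covariant_rep F (k *: p + q) = k *: covariant_rep F p + covariant_rep F q.
Proof. exact: extend_linear N0 bd dense k p q. Qed.

Lemma covariant_rep_le p : rnorm (covariant_rep F p) <= N1 mu F * rnorm p.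
Proof. exact: extend_le N0 bd dense p. Qed.

Lemma covariant_repD p q : covariant_rep F (p + q) = covariant_rep F p + covariant_rep F q.
Proof. by have := covariant_rep_linear 1 p q; rewrite !scale1r. Qed.

Lemma covariant_rep0 : covariant_rep F 0 = 0.
Proof. by apply: (addrI (covariant_rep F 0)); rewrite -covariant_repD !addr0. Qed.

Lemma covariant_repZ (k : R[i]) p : covariant_rep F (k *: p) = k *: covariant_rep F p.
Proof. by have := covariant_rep_linear k p 0; rewrite covariant_rep0 !addr0. Qed.

Lemma covariant_rep_cont : continuous (covariant_rep F).
Proof. exact: (lin_bounded_continuous covariant_rep_linear N0 covariant_rep_le). Qed.
End Fixed.

Lemma covariant_rep_lin (k : R[i]) F F' : Cc F -> Cc F' -> forall p,
  covariant_rep (fun s => k *: F s + F' s) p = k *: covariant_rep F p + covariant_rep F' p.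
Proof.
move=> cF cF'.
have C := (bochnerD hausdorffG muK (bochnerZ hausdorffG muK k cF).2 cF').2.
apply: (dense_eq dense (M := N1 mu (fun s => k *: F s + F' s))
  (M' := rnorm (k : Cplx R) * N1 mu F + N1 mu F')).
- by move=> c p q; exact: covariant_rep_linear.
- move=> c p q; rewrite (covariant_rep_linear cF) (covariant_rep_linear cF') !scalerDr.
  have swap (v : K) : k *: (c *: v) = c *: (k *: v) by rewrite !scalerA mulrC.
  by rewrite swap; exact: addrACA.
- exact: N1_ge0.
- by rewrite addr_ge0 ?mulr_ge0 ?N1_ge0 ?rnorm_ge0.
- by move=> p; exact: covariant_rep_le.
- move=> p; rewrite mulrDl (le_trans (rnormD _ _))// lerD ?covariant_rep_le//.
  by rewrite rnormZ -mulrA ler_wpM2l ?covariant_rep_le ?rnorm_ge0.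
- by move=> x; rewrite !covariant_rep_gen// rep_gen_lin.
Qed.

(** On a generator both sides are iterated integrals of the same function on
    [G * G], after a left translation, and [fubini] exchanges them. *)
Lemma covariant_rep_conv F F' : Cc F -> Cc F' -> forall p,
  covariant_rep (convolution mu F F') p = covariant_rep F (covariant_rep F' p).
Proof.
move=> cF cF'.
have L1 x : L1_bounded mu (fun f => rep_gen f x) (rnorm (j x)).
  split=> [|k f g cf cg|f cf]; [exact: rnorm_ge0|exact: rep_gen_lin|].
  by have := rep_gen_le [:: (1, x)] cf; rewrite /lsum !big_seq1 !scale1r mulrC.
(* This instance only serves to obtain the compact support of the convolution.
   *)
have [_ _ C] := L1_bounded_convolution hausdorffG haar_mu (L1 (0, 1%g)) cF cF'.
apply: (dense_eq dense (M := N1 mu (convolution mu F F')) (M' := N1 mu F * N1 mu F')).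
- by move=> c p q; exact: covariant_rep_linear.
- by move=> c p q; rewrite (covariant_rep_linear cF') (covariant_rep_linear cF).
- exact: N1_ge0.
- by rewrite mulr_ge0 ?N1_ge0.
- by move=> p; exact: covariant_rep_le.
- by move=> p; rewrite (le_trans (covariant_rep_le cF _))// -mulrA ler_wpM2l ?N1_ge0 ?covariant_rep_le.
move=> x; rewrite !covariant_rep_gen//.
have [-> _ _] := L1_bounded_convolution hausdorffG haar_mu (L1 x) cF cF'.
have [<- _] := bochner_comm hausdorffG muK (T := covariant_rep F) (covariant_repD cF)
  (fun r => covariant_repZ cF r%:C) (covariant_rep_cont cF) (Cc_integrand x cF').
pose h (p : G * G) := j (lmulX (F p.1) (gtrans p.1 (lmulX (F' p.2) (gtrans p.2 x)))).
transitivity (I (fun t => I (fun s => h (t, s)))).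
  congr (I _); apply/funext => t.
  have ct := Cc_lact hausdorffG haar_mu (F t) (Cc_tact hausdorffG haar_mu t cF').
  have [E _] := bochner_translate hausdorffG haar_mu t (Cc_integrand x ct).
  rewrite -[LHS]/(I (integrand (lact (F t) (tact t F')) x)) -E.
  congr (I _); apply/funext => s.
  by rewrite /integrand /lact /tact /h /= gtrans_lmul lmulXM gtransM mulKg.
have [L cL CF] := Ck_ex hausdorffG cF; have [L' cL' CF'] := Ck_ex hausdorffG cF'.
rewrite -(fubini hausdorffG haar_mu (h := h) (K := L) (L := L'))//.
- by congr (I _); apply/funext => s; rewrite /= /integrand covariant_rep_gen.
- move=> p.
  have c1 : {for p, continuous (fun q : G * G => F q.1)}.
    by apply: (@continuous_comp _ _ _ fst F); [exact: cvg_fst|exact: CF.1].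
  have c2 : {for p, continuous (fun q : G * G => F' q.2)}.
    by apply: (@continuous_comp _ _ _ snd F'); [exact: cvg_snd|exact: CF'.1].
  have c3 : {for p, continuous (fun q : G * G => gtrans q.2 x)}.
    by apply: cvg_gtrans; [exact: cvg_snd|exact: cont_cst].
  have c4 : {for p, continuous (fun q : G * G => q.1)} by exact: cvg_fst.
  exact: (cvg_j (cvg_lmulX c1 (cvg_gtrans c4 (cvg_lmulX c2 c3)))).
- move=> t s [nL|nL]; first by rewrite /h CF.2// j_lmul0.
  by rewrite /h CF'.2// gtrans_lmul gact0 lmulXM cmulr0 j_lmul0.
Qed.

Lemma j_lmulZ (k : R[i]) b x : j (lmulX (k *: b) x) = k *: j (lmulX b x).
Proof. by have := lopZ k b [:: (1, x)]; rewrite /lsum !big_seq1 !scale1r. Qed.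

Lemma integrand_adj F s x x' : inner K (integrand F x s) (j x') =
  inner K (j x) (j (gtrans s^-1%g (lmulX (cstar (F s)) x'))).
Proof.
rewrite /integrand j_lmul -(j_gtrans s^-1%g).
by rewrite gtransM mulVg gtrans1.
Qed.

(** The inversion formula for the integral contributes the modular factor of
    the involution. *)
Lemma rep_gen_adj F x x' : Cc F ->
  inner K (rep_gen F x) (j x') = inner K (j x) (rep_gen (involution mu F) x').
Proof.
move=> cF; have ci := Cc_involution hausdorffG lcG haar_mu cF.
have [E C] := inner_bochner hausdorffG haar_mu (j x') (Cc_integrand x cF).
have [E' C'] := bochner_comm hausdorffG muK (T := fun w => inner K (j x) w : Cplx R)
  (innerDr (j x)) (fun r w => etrans (innerZr _ _ _) (congr1 (fun z => z * _) (conj_real _)))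
  (fun w => cvg_inner (cvg_cst _) (@cvg_id _ (nbhs w))) (Cc_integrand x' ci).
rewrite -E -E'.
have [_ _ _ inv _] := modular_facts hausdorffG lcG haar_mu.
rewrite (inv _ _ C).
apply: (congr1 (@bochner_integral R G mu (Cplx R))); apply/funext => s /=.
rewrite integrand_adj invgK /integrand /involution j_lmulZ innerZr.
rewrite conj_real.
by rewrite gtrans_lmul.
Qed.

Lemma covariant_rep_adj F : Cc F -> forall p q,
  inner K (covariant_rep F p) q = inner K p (covariant_rep (involution mu F) q).
Proof.
move=> cF; have ci := Cc_involution hausdorffG lcG haar_mu cF.
have N0 := N1_ge0 mu F; have N0' := N1_ge0 mu (involution mu F).
have bd p q : rnorm (inner K (covariant_rep F p) q - inner K p (covariant_rep (involution mu F) q) : Cplx R)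
    <= (N1 mu F + N1 mu (involution mu F)) * (rnorm p * rnorm q).
  rewrite mulrDl (le_trans (rnormB _ _))// lerD// (le_trans (inner_CS _ _))//.
    by rewrite mulrA ler_wpM2r ?rnorm_ge0 ?covariant_rep_le.
  by rewrite mulrCA ler_wpM2l ?rnorm_ge0 ?covariant_rep_le.
have gen x q : inner K (covariant_rep F (j x)) q - inner K (j x) (covariant_rep (involution mu F) q) = 0 :> Cplx R.
  move: q; apply: (dense_eq0 dense (W := Cplx R)
     (M := (N1 mu F + N1 mu (involution mu F)) * rnorm (j x))).
  - by move=> p q; rewrite covariant_repD// !innerDr opprD addrACA.
  - by move=> c p h; rewrite covariant_repZ// !innerZr -mulrBr h mulr0.
  - by rewrite mulr_ge0 ?addr_ge0 ?rnorm_ge0.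
  - by move=> q; rewrite -mulrA.
  - by move=> x'; rewrite !covariant_rep_gen// rep_gen_adj// subrr.
move=> p q; apply/eqP; rewrite -subr_eq0; apply/eqP; move: p.
apply: (dense_eq0 dense (W := Cplx R)
     (M := (N1 mu F + N1 mu (involution mu F)) * rnorm q)).
- by move=> p p'; rewrite covariant_repD// !innerDl opprD addrACA.
- by move=> c p h; rewrite covariant_repZ// !innerZl -mulrBr h mulr0.
- by rewrite mulr_ge0 ?addr_ge0 ?rnorm_ge0.
- by move=> p; rewrite -mulrA (mulrC (rnorm q)).
- by move=> x; exact: gen.
Qed.

Lemma covariant_rep_star : star_representation mu covariant_rep.
Proof.
split=> [F cF|c F F' cF cF' x|F F' cF cF' x|F cF x y].
- split=> [c p q|p]; first exact: covariant_rep_linear.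
  by rewrite !normE -rmorphM lecR; exact: covariant_rep_le.
- exact: covariant_rep_lin.
- exact: covariant_rep_conv.
- exact: covariant_rep_adj.
Qed.

End Covariant.

(** * Linearity and continuity of the kernel vectors *)

Section KernelVectors.
Variables (R : realType) (G : topGroupType).
Hypothesis hausdorffG : hausdorff_space G.
Hypothesis lcG : locally_compact [set: G].
Variable mu : {measure set (borel G) -> \bar R}.
Hypothesis haar_mu : left_haar_measure mu.
Variables (A B : gcstarAlgType R G) (psi : {linear B -> A}).
Hypotheses (ccp_psi : ccp psi) (equiv_psi : equivariant psi).
Variables (H : hilbertType R) (rho : (G -> A) -> H -> H).
Hypothesis rep : star_representation mu rho.
Variables (f : G -> A) (y : H).
Hypothesis cf : Cc f.
Variables (K : hilbertType R) (j : B * G -> K).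
Hypothesis j_inner : forall x x', inner K (j x) (j x') = stinespring psi rho f y x x'.
Hypothesis dense : forall p (e : R), 0 < e -> exists l, rnorm (p - lsum j l) <= e.

Lemma dense_inner_eq p q : (forall x, inner K p (j x) = inner K q (j x)) -> p = q.
Proof.
move=> h; apply: inner_eq => z; apply/eqP; rewrite -subr_eq0; apply/eqP; move: z.
apply: (dense_eq0 dense (W := Cplx R) (M := rnorm p + rnorm q)).
- by move=> z z'; rewrite !innerDr opprD addrACA.
- by move=> c z h0; rewrite !innerZr -mulrBr h0 mulr0.
- by rewrite addr_ge0 ?rnorm_ge0.
- by move=> z; rewrite mulrDl (le_trans (rnormB _ _))// lerD ?inner_CS.
- by move=> x; rewrite h subrr.
Qed.

(** A vector is determined by its inner products with the [j x]. *)
Lemma kernel_lin (k : R[i]) b c t : j (k *: b + c, t) = k *: j (b, t) + j (c, t).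
Proof.
apply: dense_inner_eq => x; rewrite innerDl innerZl !j_inner.
exact: (stinespring_lin hausdorffG haar_mu psi rep).
Qed.

(** The square norm of [j p - j q] is a combination of values of the kernel,
    which is jointly continuous. *)
Lemma kernel_continuous : continuous j.
Proof.
move=> p; apply/rcontP => e e0.
have st (u v : B * G -> B * G) : {for p, continuous u} -> {for p, continuous v} ->
    (fun q => inner K (j (u q)) (j (v q)) : Cplx R) @ p
      --> (inner K (j (u p)) (j (v p)) : Cplx R).
  move=> cu cv.
  have E : (fun q => inner K (j (u q)) (j (v q)) : Cplx R) =
      (fun q => stinespring psi rho f y (u q) (v q)).
    by apply/funext => q; rewrite j_inner.
  by rewrite E j_inner; exact: (cvg_stinespring hausdorffG lcG haar_mu ccp_psi rep).
have cid : {for p, continuous (fun q : B * G => q)} by exact: cvg_id.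
have cc : {for p, continuous (fun _ : B * G => p)} by exact: cvg_cst.
have dst (u v w : B * G -> Cplx R) (a : Cplx R) :
    u @ p --> a -> v @ p --> a -> w @ p --> a ->
    (fun q => (a - u q) - (v q - w q)) @ p --> (0 : Cplx R).
  move=> hu hv hw; have h := cvgB (cvgB (cvg_cst a) hu) (cvgB hv hw).
  by rewrite !subrr in h; exact: h.
have D := dst _ _ _ _ (st _ _ cc cid) (st _ _ cid cc) (st _ _ cid cid).
have e2 : 0 < e ^+ 2 by rewrite exprn_gt0.
have /rcvgP/(_ _ e2) := D; apply: filterS => q.
have -> : (inner K (j p) (j p) - inner K (j p) (j q)) -
     (inner K (j q) (j p) - inner K (j q) (j q)) =
     (rnorm (j p - j q) ^+ 2)%:C.
  by rewrite -inner_self !(innerDl, innerDr, innerNl, innerNr) opprD !opprK.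
rewrite sub0r rnormN rnormC ger0_norm ?sqr_ge0//.
by rewrite ltr_sqr ?nnegrE ?rnorm_ge0 ?ltW.
Qed.

End KernelVectors.

(** * Maximal norms *)

Section OperatorNorm.
Variables (R : realType) (G : topGroupType).
Hypothesis hausdorffG : hausdorff_space G.
Variable mu : {measure set (borel G) -> \bar R}.
Variable A : gcstarAlgType R G.
Implicit Types (f : G -> A).

Section Rep.
Variables (H : hilbertType R) (rho : (G -> A) -> H -> H).
Hypothesis rep : star_representation mu rho.

Let N1f f (x : H) : Cc f -> `|x| <= 1 -> rnorm (rho f x) <= N1 mu f.
Proof.
move=> cf x1; apply: (le_trans (rho_le rep x cf)).
by rewrite ler_piMl ?N1_ge0// -lecR -normE.
Qed.

Let opset f : Cc f -> has_sup [set rnorm (rho f x) | x in [set x : H | `|x| <= 1]].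
Proof.
move=> cf; split; first by exists (rnorm (rho f 0)), 0 => //=; rewrite normr0.
by exists (N1 mu f) => _ [x /= x1 <-]; exact: N1f.
Qed.

Lemma operator_norm_ge0 f : Cc f -> 0 <= operator_norm (rho f).
Proof.
move=> cf; apply: (le_trans (rnorm_ge0 (rho f 0))).
by apply: (sup_upper_bound (opset cf)); exists 0 => //=; rewrite normr0.
Qed.

Lemma operator_norm_leN1 f : Cc f -> operator_norm (rho f) <= N1 mu f.
Proof.
move=> cf; apply: sup_le_ub; first by case: (opset cf).
by move=> _ [x /= x1 <-]; exact: N1f.
Qed.

Lemma operator_norm_bound f x : Cc f ->
  rnorm (rho f x) <= operator_norm (rho f) * rnorm x.
Proof.
move=> cf; have := rnorm_ge0 x; rewrite le_eqVlt => /predU1P[x0|x0].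
  by rewrite -x0 mulr0 (le_trans (rho_le rep x cf))// -x0 mul0r.
pose c := (rnorm x)^-1; have c0 : 0 < c by rewrite invr_gt0.
rewrite -ler_pdivrMr// mulrC -/c.
have rho0 : rho f 0 = 0.
  by apply: rnorm_eq0; apply/eqP; rewrite eq_le rnorm_ge0 andbT
    (le_trans (rho_le rep 0 cf))// rnorm0 mul0r.
have -> : c * rnorm (rho f x) = rnorm (rho f (c%:C *: x)).
  rewrite -[c%:C *: x]addr0 (rho_linear rep _ _ _ cf) rho0 addr0 rnormZR.
  by rewrite gtr0_norm.
apply: (sup_upper_bound (opset cf)); exists (c%:C *: x) => //=.
by rewrite normE rnormZR gtr0_norm// mulVf ?gt_eqF.
Qed.

Lemma operator_norm_le f (M : R) : Cc f ->
  (forall x, rnorm (rho f x) <= M * rnorm x) -> 0 <= M -> operator_norm (rho f) <= M.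
Proof.
move=> cf h M0; apply: sup_le_ub; first by case: (opset cf).
move=> _ [x /= x1 <-]; apply: (le_trans (h x)).
by rewrite ler_piMr// -lecR -normE.
Qed.
End Rep.

Lemma operator_norm_le_max f (H : hilbertType R) (rho : (G -> A) -> H -> H) :
  Cc f -> star_representation mu rho -> operator_norm (rho f) <= max_norm mu f.
Proof.
move=> cf rep; rewrite /max_norm; apply: sup_upper_bound; last by exists H, rho.
split; first by exists (operator_norm (rho f)), H, rho.
by exists (N1 mu f) => _ [H' [rho' [rep' ->]]]; exact: operator_norm_leN1.
Qed.

Lemma max_norm_le f (M : R) : Cc f -> 0 <= M ->
  (forall (H : hilbertType R) (rho : (G -> A) -> H -> H), star_representation mu rho ->
     forall x, rnorm (rho f x) <= M * rnorm x) -> max_norm mu f <= M.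
Proof.
move=> cf M0 h; rewrite /max_norm; set S := [set r | _].
have [S0|/set0P S0] := eqVneq S set0; first by rewrite S0 sup0.
apply: sup_le_ub => // _ [H [rho [rep ->]]].
by apply: (operator_norm_le rep) => //; exact: h.
Qed.

Lemma max_norm_ge0 f : Cc f -> 0 <= max_norm mu f.
Proof.
move=> cf; rewrite {1}/max_norm; set S := [set r | _].
have [S0|/set0P [_ [H [rho [rep _]]]]] := eqVneq S set0; first by rewrite S0 sup0.
by apply: (le_trans (operator_norm_ge0 rep cf)); exact: operator_norm_le_max.
Qed.

End OperatorNorm.

(** * Comparison of maximal norms along an embedding *)

Section Comparison.
Variables (R : realType) (G : topGroupType).
Hypothesis hausdorffG : hausdorff_space G.
Hypothesis lcG : locally_compact [set: G].
Variable mu : {measure set (borel G) -> \bar R}.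
Hypothesis haar_mu : left_haar_measure mu.
Variables (A B : gcstarAlgType R G).
Local Notation I := (bochner_integral mu).
Let muK := mu_compact haar_mu.

Section Embedding.
Variable iota : {linear A -> B}.
Hypothesis iota_hom : star_hom iota.

Lemma star_hom_continuous : continuous iota.
Proof.
apply: (@lin_bounded_continuous R A B iota 1) => // [c a b|a]; first exact: linearP.
by rewrite mul1r; exact: star_hom_rnorm.
Qed.

Lemma Cc_star_hom (f : G -> A) : Cc f -> Cc (iota \o f).
Proof.
move=> cf; apply: (bochner_comm hausdorffG muK (T := iota) _ _ _ cf).2.
- by move=> a b; exact: raddfD.
- by move=> r a; exact: linearZ.
- exact: star_hom_continuous.
Qed.
End Embedding.

Variables (psi : {linear B -> A}) (iota : {linear A -> B}).
Hypotheses (ccp_psi : ccp psi) (equiv_psi : equivariant psi).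
Hypotheses (iota_hom : star_hom iota) (equiv_iota : equivariant iota).
Hypothesis psi_iota : forall a, psi (iota a) = a.

Section Vector.
Variables (H : hilbertType R) (rho : (G -> A) -> H -> H).
Hypothesis rep : star_representation mu rho.
Variables (f : G -> A) (y : H).
Hypothesis cf : Cc f.
Variables (K : hilbertType R) (j : B * G -> K).
Hypothesis j_inner : forall x x', inner K (j x) (j x') = stinespring psi rho f y x x'.
Hypothesis dense : forall p (e : R), 0 < e -> exists l, rnorm (p - lsum j l) <= e.

Let u (z : A * G) : K := j (iota z.1, z.2).
Let v (z : A * G) : H := repv rho f y z.1 z.2.

(** As [psi] is a left inverse of [iota], the values of the kernel at points
    of the image of [iota] are the inner products of the vectors [repv a t].
    *)
Let isometry l : rnorm (lsum u l) = rnorm (lsum v l).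
Proof.
apply: inner_rnorm; apply: inner_lsum => z z'.
rewrite /u /v j_inner /stinespring /= -iota_hom.2 -iota_hom.1 psi_iota.
exact: (repv_adj hausdorffG lcG haar_mu rep y cf).
Qed.

Let j_cont : continuous j := kernel_continuous hausdorffG lcG haar_mu ccp_psi rep cf j_inner.
Let j_lin := kernel_lin hausdorffG haar_mu rep cf j_inner dense.

Let Cc_u (g : G -> A) : Cc g -> Cc (fun t => u (g t, t)).
Proof.
move=> /(Ck_ex hausdorffG)[L cL [cg g0]]; apply: (CkCc hausdorffG cL).
split=> [t|t nL].
  have ci : {for t, continuous (fun t => iota (g t))}.
    by apply: (@continuous_comp _ _ _ g iota); [exact: cg|exact: star_hom_continuous].
  have cp : {for t, continuous (fun t => (iota (g t), t))}.
    by apply: cvg_pair; [exact: ci|exact: cvg_id].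
  by apply: (@continuous_comp _ _ _ (fun t => (iota (g t), t)) j) => //; exact: j_cont.
rewrite /u /= g0// raddf0.
by have := j_lin (- 1) 0 0 t; rewrite scaler0 addr0 scaleN1r addNr.
Qed.

(** The vector of [K] corresponding to [rho g (rho f y)] under the isometry.
    *)
Let zeta (g : G -> A) : K := I (fun t => u (g t, t)).

Let zeta_graph g : Cc g -> graph u v (zeta g) (rho g (rho f y)).
Proof.
move=> cg; have [-> Cv _] := rho_conv hausdorffG haar_mu rep y cg cf.
apply: (graph_bochner hausdorffG muK (Cc_u cg) Cv) => t.
exact: (graph_gen u v (g t, t)).
Qed.

Let zeta_rnorm g : Cc g -> rnorm (zeta g) = rnorm (rho g (rho f y)).
Proof.
move=> cg; apply/eqP; rewrite eq_le.
have bd l : rnorm (lsum v l) <= 1 * rnorm (lsum u l) by rewrite mul1r isometry.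
have bd' l : rnorm (lsum u l) <= 1 * rnorm (lsum v l) by rewrite mul1r isometry.
have := graph_le ler01 bd (zeta_graph cg); rewrite mul1r => ->; rewrite andbT.
have gs : graph v u (rho g (rho f y)) (zeta g).
  by move=> e e0; have [l [h1 h2]] := zeta_graph cg e0; exists l.
by have := graph_le ler01 bd' gs; rewrite mul1r.
Qed.

Let zeta_lin (k : R[i]) g h : Cc g -> Cc h ->
  zeta (fun s => k *: g s + h s) = k *: zeta g + zeta h.
Proof.
move=> cg ch; have [E C] := bochnerZ hausdorffG muK k (Cc_u cg).
rewrite /zeta -E -(bochnerD hausdorffG muK C (Cc_u ch)).1.
apply: (congr1 (@bochner_integral R G mu K)); apply/funext => s.
by rewrite /u /= linearP j_lin.
Qed.

Let j_gtrans s x x' : inner K (j (gtrans s x)) (j (gtrans s x')) = inner K (j x) (j x').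
Proof. by rewrite !j_inner; exact: (stinespring_gtrans hausdorffG lcG haar_mu equiv_psi rep). Qed.

Let j_lmul b x x' : inner K (j (lmulX b x)) (j x') = inner K (j x) (j (lmulX (cstar b) x')).
Proof. by rewrite !j_inner; exact: stinespring_lmul. Qed.

Let F := iota \o f.
Let cF : Cc F := Cc_star_hom iota_hom cf.

(** The correspondence intertwines [rho f] with the operator of [iota \o f] in
    the representation on [K]. *)
Let zeta_conv (g : G -> A) : Cc g -> covariant_rep mu j F (zeta g) = zeta (convolution mu f g).
Proof.
move=> cg.
have zL1 : L1_bounded mu zeta (rnorm (rho f y)).
  split; [exact: rnorm_ge0|exact: zeta_lin|move=> h ch].
  by rewrite zeta_rnorm//; exact: (rho_le rep).
have [-> _ _] := L1_bounded_convolution hausdorffG haar_mu zL1 cf cg.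
pose h (p : G * G) := j (lmulX (F p.1) (gtrans p.1 (iota (g p.2), p.2))).
have sg p := covariant_rep_gen hausdorffG haar_mu dense j_lin j_cont j_gtrans j_lmul cF p.
have sD := covariant_repD hausdorffG haar_mu dense j_lin j_cont j_gtrans j_lmul cF.
have sZ := covariant_repZ hausdorffG haar_mu dense j_lin j_cont j_gtrans j_lmul cF.
have sC := covariant_rep_cont hausdorffG haar_mu dense j_lin j_cont j_gtrans j_lmul cF.
have [<- _] := bochner_comm hausdorffG muK sD (fun r => sZ r%:C) sC (Cc_u cg).
transitivity (I (fun t => I (fun s => h (s, t)))).
  apply: (congr1 (@bochner_integral R G mu K)); apply/funext => t.
  by rewrite /= /u sg.
have [L cL Cf] := Ck_ex hausdorffG cF; have [L' cL' Cg] := Ck_ex hausdorffG cg.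
rewrite (fubini hausdorffG haar_mu (h := h) _ cL cL').
- apply: (congr1 (@bochner_integral R G mu K)); apply/funext => s.
  have ct := Cc_lact hausdorffG haar_mu (f s) (Cc_tact hausdorffG haar_mu s cg).
  have [E _] := bochner_translate hausdorffG haar_mu s (Cc_u ct).
  rewrite /zeta -E.
  apply: (congr1 (@bochner_integral R G mu K)); apply/funext => t.
  rewrite /h /u /lact /tact /lmulX /gtrans /F /= mulKg.
  by rewrite iota_hom.1 equiv_iota.
- move=> p.
  have c1 : {for p, continuous (fun q : G * G => F q.1)}.
    by apply: (@continuous_comp _ _ _ fst F); [exact: cvg_fst|exact: Cf.1].
  have c2 : {for p, continuous (fun q : G * G => iota (g q.2))}.
    apply: (@continuous_comp _ _ _ (fun q : G * G => g q.2) iota).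
      by apply: (@continuous_comp _ _ _ snd g); [exact: cvg_snd|exact: Cg.1].
    exact: star_hom_continuous.
  have c3 : {for p, continuous (fun q : G * G => (iota (g q.2), q.2))}.
    by apply: cvg_pair; [exact: c2|exact: cvg_snd].
  have c4 : {for p, continuous (fun q : G * G => q.1)} by exact: cvg_fst.
  exact: (cvg_j j_cont (cvg_lmulX c1 (cvg_gtrans c4 c3))).
- move=> s t nst.
  have j0 r : j (0, r) = 0.
    by have := j_lin (- 1) 0 0 r; rewrite scaler0 addr0 scaleN1r addNr.
  have -> : h (s, t) = j (0, (s * t)%g).
    rewrite /h /lmulX /gtrans /=; congr (j (_, _)).
    case: nst => [nL|nL]; first by rewrite Cf.2// cmul0r.
    by rewrite Cg.2// raddf0 gact0 cmulr0.
  exact: j0.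
Qed.

(** Let [w = rho f y] and [w' = rho f^* w]. The vectors [w'] and [rho f w']
    correspond to [zeta f^*] and its image under an operator bounded by [M],
    so that [rho f w'] has norm at most [M |w'|]. The estimates [|w'|^2 <=
    |rho f w'| |w|] and [|w|^2 <= |w'| |y|] then bound first [w'] by [M |w|],
    and then [w] by [M |y|]. *)
Lemma rho_le_max_norm_embedding :
  rnorm (rho f y) <= max_norm mu (iota \o f) * rnorm y.
Proof.
set M := max_norm _ _.
have M0 : 0 <= M := max_norm_ge0 mu cF.
have srep : star_representation mu (covariant_rep mu j).
  exact: (covariant_rep_star hausdorffG lcG haar_mu dense j_lin j_cont j_gtrans j_lmul).
have ci := Cc_involution hausdorffG lcG haar_mu cf.
pose w := rho f y; pose w' := rho (involution mu f) w.
have w0 := rnorm_ge0 w; have w0' := rnorm_ge0 w'; have y0 := rnorm_ge0 y.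
have h1 : rnorm (rho f w') <= M * rnorm w'.
  have [E1 E2 Cv] := rho_conv hausdorffG haar_mu rep w cf ci.
  have rc : rho f w' = rho (convolution mu f (involution mu f)) w.
    by case: rep => _ _ hc _; rewrite hc.
  rewrite rc -zeta_rnorm// -(zeta_conv ci) /w' -/w -(zeta_rnorm ci).
  apply: (le_trans (operator_norm_bound srep _ cF)).
  by rewrite ler_wpM2r ?rnorm_ge0// (operator_norm_le_max cF srep).
have h2 : rnorm w' ^+ 2 <= rnorm (rho f w') * rnorm w.
  have E : (rnorm w' ^+ 2)%:C = inner H (rho f w') w.
    by rewrite -inner_self (rho_adj rep _ _ cf).
  have := inner_CS (rho f w') w; rewrite -E rnormC ger0_norm ?sqr_ge0//.
have h3 : rnorm w ^+ 2 <= rnorm w' * rnorm y.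
  have E : (rnorm w ^+ 2)%:C = inner H w' y.
    by rewrite -inner_self /w (rho_adjr rep)//.
  have := inner_CS w' y; rewrite -E rnormC ger0_norm ?sqr_ge0//.
have h4 : rnorm w' <= M * rnorm w.
  move: w0'; rewrite le_eqVlt => /predU1P[<-|w'0]; first by rewrite mulr_ge0.
  rewrite -(ler_pM2l w'0) -expr2 (le_trans h2)//.
  by rewrite mulrA ler_wpM2r// mulrC.
move: w0; rewrite le_eqVlt -/w => /predU1P[<-|w00]; first by rewrite mulr_ge0.
rewrite -(ler_pM2l w00) -expr2 (le_trans h3)//.
by rewrite mulrA ler_wpM2r// mulrC.
Qed.
End Vector.

(** Every representation of the algebra of [A], at every vector, is compared
    with one of the algebra of [B], obtained by dilating along [psi]. *)
Lemma max_norm_le_embedding (f : G -> A) : Cc f ->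
  max_norm mu f <= max_norm mu (iota \o f).
Proof.
move=> cf; apply: (max_norm_le cf).
  by apply: max_norm_ge0; exact: Cc_star_hom.
move=> H rho rep y.
have [K [j [j_inner dense]]] := kolmogorov
  (stinespring_kernel hausdorffG lcG haar_mu ccp_psi rep y cf).
apply: (rho_le_max_norm_embedding rep cf (j := j) j_inner) => p e e0.
by have [l hl] := dense p e e0; exists l.
Qed.
End Comparison.

Lemma ccp_id (R : realType) (A : cstarAlgType R) : ccp (idfun : {linear A -> A}).
Proof.
split=> [n a [x hx]|x]; last exact: lexx.
by exists x => i k; rewrite !mxE -hx.
Qed.

(** * Injective and maximal norms *)

Theorem corollary3p3 (R : realType) (G : topGroupType)
    (hausdorffG : hausdorff_space G) (lcG : locally_compact [set: G])
    (mu : {measure set (borel G) -> \bar R}) (haar_mu : left_haar_measure mu)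
    (A : gcstarAlgType R G) (injA : G_injective A) :
  forall f : G -> A, Cc f -> inj_norm mu f = max_norm mu f.
Proof.
move=> f cf; rewrite /inj_norm; set S := [set r | _].
have lbS : lbound S (max_norm mu f).
  move=> _ [B [iota [emb ->]]].
  have [psi [ccp_psi equiv_psi psi_iota]] :=
    injA A idfun (ccp_id A) (fun s a => erefl) B iota emb.
  case: emb => hom equiv_iota _.
  exact: (max_norm_le_embedding hausdorffG lcG haar_mu ccp_psi equiv_psi hom equiv_iota psi_iota cf).
have Smax : S (max_norm mu f) by exists A, idfun; split => //.
apply/eqP; rewrite eq_le; apply/andP; split.
  by apply: ge_inf => //; exists (max_norm mu f).
by apply: lb_le_inf => //; exists (max_norm mu f).
Qed.
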